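(* For $j=0,1$ let $H_j$ be a Jacobi operator in $\ell^2(\mathbb{Z})$ with separated boundary conditions, let $\phi_j(z,n)$ be a real entire solution of $\tau_ju=zu$ such that $\phi_j(z,\cdot)$ is nontrivial and lies in the domain of $H_j$ near $-\infty$ for every $z\in\mathbb{C}$, and let $\rho_j$ be the corresponding spectral measure. Suppose that $\phi_0(z,n)$, $\phi_1(z,n)$ are of growth order at most $s$ for some $s>0$ and $\phi_0(z,n)\asymp\phi_1(z,n)$ for one $n\in\mathbb{Z}$ as $|z|\to\infty$ along some non-real rays dissecting the complex plane into sectors of opening angles less than $\pi/s$. Furthermore, assume that $H_0$ and $H_1$ have purely discrete spectrum with convergence exponent at most $s$. If the spectral measures $\rho_0$ and $\rho_1$ are equal, then $H_1=H_0$.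
   Context: For $j=0,1$, $a_j,b_j$ are real sequences on $\mathbb{Z}$ with $a_j(n)>0$ for all $n$; $(\tau_jf)(n)=a_j(n)f(n+1)+a_j(n-1)f(n-1)+b_j(n)f(n)$ and $W_j(f,g)(n)=a_j(n)\big(f(n)g(n+1)-f(n+1)g(n)\big)$ (independent of $n$ if $f,g$ solve $\tau_ju=zu$ for the same $z$). $\tau_j$ is limit circle at $\pm\infty$ if for some (equivalently all) $z\in\mathbb{C}$ all solutions of $\tau_ju=zu$ are square summable near $\pm\infty$, and limit point otherwise. At each limit circle endpoint a boundary condition is fixed: $f$ satisfies it if $\lim_{n\to\pm\infty}W_j(v_\pm,f)(n)=0$, where $v_\pm$ is a fixed nontrivial real solution of $\tau_jv=\lambda_0v$ for some $\lambda_0\in\mathbb{R}$ ($v_\pm$ may depend on $j$); at a limit point endpoint no condition is imposed. The Jacobi operator $H_j$ is the self-adjoint operator $f\mapsto\tau_jf$ in $\ell^2(\mathbb{Z})$ with domain all $f\in\ell^2(\mathbb{Z})$ such that $\tau_jf\in\ell^2(\mathbb{Z})$ and $f$ satisfies the boundary conditions (if any). A real entire solution $\phi(z,n)$ is a solution of $\tau_j\phi(z,\cdot)=z\phi(z,\cdot)$ for every $z\in\mathbb{C}$ such that for each $n$ the function $\phi(\cdot,n)$ is entire and real on $\mathbb{R}$. It is of growth order at most $s$ if the entire functions $\phi(\cdot,n)$ and $\phi(\cdot,n+1)$ are of growth order at most $s$ for one (and hence all) $n\in\mathbb{Z}$. A solution lies in the domain of $H_j$ near $\pm\infty$ if it is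 square summable near $\pm\infty$ and satisfies the boundary condition of $H_j$ at $\pm\infty$ (if any). Spectral measure: given $\phi_j$ there is a real entire solution $\theta_j(z,n)$ with $W_j(\theta_j,\phi_j)=1$. For $z\in\mathbb{C}\setminus\mathbb{R}$ let $u_{j,+}(z,\cdot)$ be the (unique up to multiples) nontrivial solution of $\tau_ju=zu$ lying in the domain of $H_j$ near $+\infty$, and put $M_j(z)=-W_j(\theta_j(z),u_{j,+}(z))/W_j(\phi_j(z),u_{j,+}(z))$. Then $\rho_j$ is the Borel measure on $\mathbb{R}$ given by $$\tfrac12\big(\rho_j((x_0,x_1))+\rho_j([x_0,x_1])\big)=\lim_{\varepsilon\downarrow0}\frac1\pi\int_{x_0}^{x_1}\mathrm{Im}\,M_j(x+\mathrm{i}\varepsilon)\,dx;$$ it does not depend on the choice of $\theta_j$. The convergence exponent of a discrete set $S\subseteq\mathbb{C}$ is $\inf\{t\ge0:\sum_{\mu\in S}\frac{1}{1+|\mu|^t}<\infty\}\in[0,\infty]$. $\phi_0(z,n)\asymp\phi_1(z,n)$ means that both $\phi_0(z,n)/\phi_1(z,n)=O(1)$ and $\phi_1(z,n)/\phi_0(z,n)=O(1)$ in the specified limit. A non-real ray is a ray from the origin not contained in the real axis. *)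

(* Defs.v *)
From HB Require Import structures.
From mathcomp Require Import all_boot all_order all_algebra.
From mathcomp Require Import complex.
From mathcomp Require Import all_classical all_reals all_analysis.
Set Implicit Arguments.
Unset Strict Implicit.
Unset Printing Implicit Defensive.
Set Warnings "-redundant-canonical-projection".
Import Order.TTheory GRing.Theory Num.Theory numFieldNormedType.Exports.
Import Normc.
Local Open Scope classical_set_scope.
Local Open Scope ring_scope.
Local Open Scope complex_scope.

(* The usual topology of the complex numbers: R[i] as a normed space over
   itself, so that [derivable f z 1] is complex differentiability at z. *)
HB.instance Definition _ (R : realType) := GRing.ComAlgebra.copy R[i] R[i]^o.
HB.instance Definition _ (R : realType) := NormedModule.copy R[i] R[i]^o.

Section Entire.
Variable R : realType.

Definition entire (f : R[i] -> R[i]) := forall z : R[i], derivable f z 1.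

(* inf {t >= 0 : |f z| <= exp (|z| ^ t) for all large |z|} *)
Definition growth_order (f : R[i] -> R[i]) : \bar R :=
  ereal_inf [set t%:E | t in [set t : R | 0 <= t /\
    exists r0 : R, forall z, r0 <= normc z ->
      normc (f z) <= expR (normc z `^ t)]].

Definition convergence_exponent (S : set R[i]) : \bar R :=
  ereal_inf [set t%:E | t in [set t : R | 0 <= t /\
    (\esum_(mu in S) ((1 + normc mu `^ t)^-1)%:E < +oo)%E]].

Definition ray (t r : R) : R[i] := (r * cos t) +i* (r * sin t).

(* The rays with the angles t 0 < t 1 < ... < t m = t 0 + 2 pi (of which the
   last one is the first one again) are non-real, and the m sectors into which
   they dissect the plane have opening angles less than alpha. *)
Definition dissecting_rays (alpha : R) (m : nat) (t : nat -> R) :=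
  [/\ (0 < m)%N, t m = t 0 + 2 * pi &
   forall k, (k < m)%N ->
     [/\ t k < t k.+1, t k.+1 - t k < alpha & sin (t k) != 0]].

Definition bounded_along (t : R) (q : R[i] -> R[i]) :=
  exists C : R, \forall r \near +oo, normc (q (ray t r)) <= C.

Definition asymp_along (t : R) (f g : R[i] -> R[i]) :=
  bounded_along t (fun z => f z / g z) /\
  bounded_along t (fun z => g z / f z).

End Entire.

Section Operators.
Variable R : realType.

Definition normsq (D : set int) (f : int -> R[i]) : \bar R :=
  \esum_(n in D) (normc (f n) ^+ 2)%:E.

Definition square_summable (D : set int) (f : int -> R[i]) :=
  (normsq D f < +oo)%E.

Definition ell2 : set (int -> R[i]) := square_summable setT.

(* Unbounded operators in l^2(Z) are represented by their graphs, so that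
   equality of operators includes equality of the domains. *)
Definition operator := set ((int -> R[i]) * (int -> R[i])).

(* T (f, z f + g) says that f is in the domain of T and (T - z) f = g. *)
Definition resolvent_set (T : operator) : set R[i] :=
  [set z | exists K : R, forall g, ell2 g ->
    exists f : int -> R[i], [/\ T (f, fun n => z * f n + g n),
      forall f' : int -> R[i], T (f', fun n => z * f' n + g n) -> f' = f &
      (normsq setT f <= K%:E * normsq setT g)%E]].

Definition spectrum (T : operator) : set R[i] := ~` resolvent_set T.

Definition eigenspace (T : operator) (z : R[i]) : set (int -> R[i]) :=
  [set f | T (f, fun n => z * f n)].

Definition finite_dim (E : set (int -> R[i])) :=
  exists (d : nat) (e : 'I_d -> int -> R[i]),
    forall f, E f -> exists c : 'I_d -> R[i],
      forall n, f n = \sum_(i < d) c i * e i n.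

(* Isolated points of the spectrum that are eigenvalues of finite
   multiplicity. *)
Definition discrete_spectrum (T : operator) : set R[i] :=
  [set z | [/\ isolated (spectrum T) z,
    exists2 f, eigenspace T z f & exists n, f n != 0 &
    finite_dim (eigenspace T z)]].

Definition purely_discrete (T : operator) :=
  spectrum T `<=` discrete_spectrum T.

End Operators.

Section Jacobi.
Variable R : realType.

Definition tau (a b : int -> R) (f : int -> R[i]) (n : int) : R[i] :=
  (a n)%:C * f (n + 1) + (a (n - 1))%:C * f (n - 1) + (b n)%:C * f n.

Definition solution (a b : int -> R) (z : R[i]) (u : int -> R[i]) :=
  forall n, tau a b u n = z * u n.

Definition nontrivial (u : int -> R[i]) := exists n, u n != 0.

Definition wronskian (a : int -> R) (f g : int -> R[i]) (n : int) : R[i] :=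
  (a n)%:C * (f n * g (n + 1) - f (n + 1) * g n).

Definition near_pinfty : set int := [set n | 0 <= n].
Definition near_ninfty : set int := [set n | n <= 0].

Definition limit_circle (D : set int) (a b : int -> R) :=
  exists z, forall u, solution a b z u -> square_summable D u.

(* The real solutions jvp and jvn define the boundary conditions at +oo and
   -oo; they play no role at an endpoint in the limit point case. *)
Record jacobi := Jacobi {
  ja : int -> R;
  jb : int -> R;
  ja_gt0 : forall n, 0 < ja n;
  jvp : int -> R;
  jvp_sol : exists lambda : R, solution ja jb lambda%:C (fun n => (jvp n)%:C);
  jvp_neq0 : nontrivial (fun n => (jvp n)%:C);
  jvn : int -> R;
  jvn_sol : exists lambda : R, solution ja jb lambda%:C (fun n => (jvn n)%:C);
  jvn_neq0 : nontrivial (fun n => (jvn n)%:C) }.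

Variable J : jacobi.

Definition bc_pinfty (f : int -> R[i]) :=
  limit_circle near_pinfty (ja J) (jb J) ->
  (fun k : nat => wronskian (ja J) (fun n => (jvp J n)%:C) f k%:Z) @ \oo
    --> (0 : R[i]).

Definition bc_ninfty (f : int -> R[i]) :=
  limit_circle near_ninfty (ja J) (jb J) ->
  (fun k : nat => wronskian (ja J) (fun n => (jvn J n)%:C) f (- k%:Z)) @ \oo
    --> (0 : R[i]).

Definition jacobi_domain : set (int -> R[i]) :=
  [set f | [/\ ell2 f, ell2 (tau (ja J) (jb J) f), bc_pinfty f &
               bc_ninfty f]].

Definition jacobi_operator : operator R :=
  [set fg | jacobi_domain fg.1 /\ fg.2 = tau (ja J) (jb J) fg.1].

Definition in_domain_near_pinfty (u : int -> R[i]) :=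
  square_summable near_pinfty u /\ bc_pinfty u.

Definition in_domain_near_ninfty (u : int -> R[i]) :=
  square_summable near_ninfty u /\ bc_ninfty u.

Definition real_entire_solution (phi : R[i] -> int -> R[i]) :=
  (forall z, solution (ja J) (jb J) z (phi z)) /\
  forall n, entire (phi^~ n) /\ forall x : R, complex.Im (phi x%:C n) = 0.

Definition growth_order_at_most (s : R) (phi : R[i] -> int -> R[i]) :=
  exists n, (growth_order (phi^~ n) <= s%:E)%E /\
            (growth_order (phi^~ (n + 1)%R) <= s%:E)%E.

(* The Wronskians of solutions are independent of n; they are taken at 0. *)
Definition weyl_M (theta phi u : R[i] -> int -> R[i]) (z : R[i]) : R[i] :=
  - wronskian (ja J) (theta z) (u z) 0 / wronskian (ja J) (phi z) (u z) 0.

Definition spectral_measure (phi : R[i] -> int -> R[i])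
    (rho : {measure set (measurableTypeR R) -> \bar R}) :=
  exists theta u : R[i] -> int -> R[i],
  [/\ real_entire_solution theta,
      forall z n, wronskian (ja J) (theta z) (phi z) n = 1,
      forall z : R[i], complex.Im z != 0 ->
        [/\ solution (ja J) (jb J) z (u z), nontrivial (u z) &
            in_domain_near_pinfty (u z)] &
      forall x0 x1 : R, x0 < x1 ->
        (pi^-1 * \int[lebesgue_measure]_(x in `]x0, x1[)
                    complex.Im (weyl_M theta phi u ((x : R) +i* (e : R))))%:E @[e --> (0 : R)^'+] -->
        ((2^-1)%:E * (rho `]x0, x1[%classic + rho `[x0, x1]%classic))%E].

End Jacobi.

(* Main.v *)
Require Import Defs.
From HB Require Import structures.
From mathcomp Require Import all_boot all_order all_algebra.
From mathcomp Require Import complex.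
From mathcomp Require Import all_classical all_reals all_analysis.
From mathcomp Require Import ring lra zify.
Set Implicit Arguments.
Unset Strict Implicit.
Unset Printing Implicit Defensive.
Import Order.TTheory GRing.Theory Num.Theory numFieldNormedType.Exports.
Import Normc.
Local Open Scope classical_set_scope.
Local Open Scope ring_scope.
Local Open Scope complex_scope.

(* Let psi_j = theta_j + M_j phi_j be the Weyl solution at +oo, normalised by
   W(psi_j, phi_j) = 1; then - phi_j(k) psi_j(n), k <= n, is the Green function
   of H_j, hence bounded by 1 / |Im z|.  Near a real point M_j is a simple pole
   with real residue plus a holomorphic function, and Stieltjes inversion
   recovers the residue from rho_j.  So if rho_0 = rho_1, then M_0 - M_1 extends
   to an entire function and, for n = m and n = m + 1,
     F = phi_1(m) psi_0(n) - phi_0(n) psi_1(m)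
   extends to an entire function of z.  Multiplied by phi_0(m) phi_1(n) it is
   bounded, off the real axis, by products of the phi_j times 1 + 1 / |Im z|; so
   F is a quotient of entire functions of growth order at most s and has itself
   growth order at most s.  On the given rays F is bounded, because the ratios
   phi_0 / phi_1 are bounded there for every n as soon as they are for one n.
   By Phragmen-Lindelof F is constant.  For n = m it tends to 0, so it vanishes;
   together with the constant for n = m + 1 this gives
     phi_1(m) = d_m phi_0(m) and psi_1(m) = d_m psi_0(m), d_m independent of z.
   As z G(z, m, m) -> -1 for both Green functions, d_m ^ 2 = 1, and the
   Wronskians give d_m d_(m+1) = a_0(m) / a_1(m) > 0.  Therefore d_m does not
   depend on m, the Green functions coincide, and so do the operators. *)

(** * Holomorphic functions and Cauchy's theorem for rectangles *)

(** No bound is available for theta_j, M_j or psi_j separately: only the entries of the Green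
    functions are controlled. This dictates the multiplier of F: after multiplication by phi_0(m)
    phi_1(n) every psi_j stands next to a phi_j in a Green entry, up to the constant 1 / a_1(m) when
    n = m + 1. Returning from the product to F requires a lower bound for the divisor; it is
    obtained locally, by removing the zeros of the divisor in a disc and applying Borel-Caratheodory
    to the zero-free rest. Order at most s only yields bounds exp (C (1 + |z|)^p) with p > s; the
    opening angles are finitely many and strictly below pi / s, which leaves room for such a p.
    Bounds that blow up like 1 / |Im z| are carried across the real axis by the maximum principle on
    squares centred there. Comparability passes from one n to all n because on a non-real ray
    phi_j(n + 1) has exactly the size |z| |phi_j(n)|, for both operators. The index n = m + 1 is the
    one at which the Wronskian can be used to solve for phi_1(m) and psi_1(m). *)

Section ComplexModulus.
Variable R : realType.
Implicit Types (z w : R[i]) (x y : R).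

Lemma normc_ge0 z : 0 <= normc z.
Proof. by case: z => a b; rewrite sqrtr_ge0. Qed.

Lemma normcN z : normc (- z) = normc z.
Proof. by case: z => a b; rewrite /normc /= !sqrrN. Qed.

Lemma normc_eq0 z : (normc z == 0) = (z == 0).
Proof.
by apply/eqP/eqP => [/eq0_normc //|->]; rewrite normc0.
Qed.

Lemma normc_gt0 z : (0 < normc z) = (z != 0).
Proof. by rewrite lt_def normc_ge0 normc_eq0 andbT. Qed.

Lemma ler_normcB z w : normc (z - w) <= normc z + normc w.
Proof. by rewrite -[normc w]normcN; exact: le_normcD. Qed.

Lemma normcBC z w : normc (z - w) = normc (w - z).
Proof. by rewrite -normcN opprB. Qed.

Lemma ler_normc_tri z w : normc z <= normc w + normc (z - w).
Proof. by have := le_normcD w (z - w); rewrite addrC subrK. Qed.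

Lemma normcX z n : normc (z ^+ n) = normc z ^+ n.
Proof. by elim: n => [|n ih]; rewrite ?normc1 // !exprS normcM ih. Qed.

Lemma normc_sqr z : normc z ^+ 2 = complex.Re z ^+ 2 + complex.Im z ^+ 2.
Proof. by case: z => a b; rewrite /normc sqr_sqrtr // addr_ge0 ?sqr_ge0. Qed.

Lemma Re_le_normc z : `|complex.Re z| <= normc z.
Proof.
case: z => a b; rewrite /normc /= -sqrtr_sqr ler_sqrt ?addr_ge0 ?sqr_ge0 //.
by rewrite lerDl sqr_ge0.
Qed.

Lemma Im_le_normc z : `|complex.Im z| <= normc z.
Proof.
case: z => a b; rewrite /normc /= -sqrtr_sqr ler_sqrt ?addr_ge0 ?sqr_ge0 //.
by rewrite lerDr sqr_ge0.
Qed.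

Lemma normc_le_ReIm z : normc z <= `|complex.Re z| + `|complex.Im z|.
Proof.
rewrite -(@ler_pXn2r _ 2) ?nnegrE ?normc_ge0 ?addr_ge0 // normc_sqr.
rewrite -(real_normK (num_real (complex.Re z))) -(real_normK (num_real (complex.Im z))).
have := normr_ge0 (complex.Re z); have := normr_ge0 (complex.Im z); nra.
Qed.

Lemma normr_normc z : `|z| = (normc z)%:C.
Proof. by rewrite normc_def; case: z. Qed.

Lemma normc_real x : normc x%:C = `|x|.
Proof. by rewrite /normc /= expr0n /= addr0 sqrtr_sqr. Qed.

Lemma normc_i : normc ('i : R[i]) = 1.
Proof. by rewrite /normc /= expr0n expr1n add0r sqrtr1. Qed.

Lemma normc_conj z : normc (z^*)%C = normc z.
Proof. by case: z => a b; rewrite /normc /= sqrrN. Qed.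

Lemma complexE z : z = (complex.Re z)%:C + 'i * (complex.Im z)%:C.
Proof. by case: z => a b; apply/eqP; rewrite eq_complex /=; apply/andP; split; apply/eqP; ring. Qed.

Lemma mkcE x y : x +i* y = x%:C + 'i * y%:C.
Proof. exact: complexE. Qed.

Lemma normc_sum I (r : seq I) (P : pred I) (F : I -> R[i]) :
  normc (\sum_(i <- r | P i) F i) <= \sum_(i <- r | P i) normc (F i).
Proof.
elim/big_rec2 : _ => [|i y1 y2 _ ih]; first by rewrite normc0.
by apply: (le_trans (le_normcD _ _)); rewrite lerD2l.
Qed.

Lemma normc_le_eps z : (forall e, 0 < e -> normc z <= e) -> z = 0.
Proof.
move=> h; apply/eqP; rewrite -normc_eq0 eq_le normc_ge0 andbT.
by apply/ler_addgt0Pr => e e0; rewrite add0r h.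
Qed.

End ComplexModulus.

(** * Complex differentiability and continuity in epsilon-delta form *)

Section Holomorphy.
Variable R : realType.
Implicit Types (f g : R[i] -> R[i]) (z w h d : R[i]).

(* [d] is the complex derivative of [f] at [z], in first-order form. *)
Definition cdiff f z d := forall e : R, 0 < e -> exists2 D : R, 0 < D &
  forall h, normc h < D -> normc (f (z + h) - f z - d * h) <= e * normc h.

Definition ccont f z := forall e : R, 0 < e -> exists2 D : R, 0 < D &
  forall h, normc h < D -> normc (f (z + h) - f z) <= e.

(** Differentiability at the single point [z]. Holomorphy is expressed by asking for it at all
    points of a disc, a rectangle or the plane. *)
Definition hol f z := exists d, cdiff f z d.

Lemma cdiff_ext f g z d (r : R) : 0 < r ->
  (forall w, normc (w - z) < r -> f w = g w) -> cdiff f z d -> cdiff g z d.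
Proof.
move=> r0 fg fz e e0; have [D D0 H] := fz e e0.
exists (Num.min D r) => [|h]; first by rewrite lt_min D0.
rewrite lt_min => /andP[hD hr]; rewrite -!fg ?subrr ?normc0 //; first exact: H.
by rewrite addrC addKr.
Qed.

Lemma hol_ext f g z (r : R) : 0 < r ->
  (forall w, normc (w - z) < r -> f w = g w) -> hol f z -> hol g z.
Proof. by move=> r0 fg [d fd]; exists d; exact: (cdiff_ext r0 fg fd). Qed.

Lemma cdiff_ccont f z d : cdiff f z d -> ccont f z.
Proof.
move=> fz e e0; have [D D0 H] := fz 1 ltr01.
set M := 1 + normc d.
have M0 : 0 < M by rewrite ltr_pwDl // normc_ge0.
exists (Num.min D (e / M)) => [|h]; first by rewrite lt_min D0 divr_gt0.
rewrite lt_min => /andP[/H hD he].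
have -> : f (z + h) - f z = (f (z + h) - f z - d * h) + d * h by ring.
apply: (le_trans (le_normcD _ _)); rewrite normcM.
apply: (le_trans (lerD hD (lexx _))); rewrite -mulrDl.
by rewrite -/M mulrC -ler_pdivlMr // ltW.
Qed.

Lemma hol_ccont f z : hol f z -> ccont f z.
Proof. by move=> [d /cdiff_ccont]. Qed.

Lemma ccont_near f z e : ccont f z -> 0 < e -> exists2 D : R, 0 < D &
  forall w, normc (w - z) < D -> normc (f w - f z) <= e.
Proof.
move=> fz e0; have [D D0 H] := fz e e0; exists D => // w /H.
by rewrite [z + _]addrC subrK.
Qed.

Lemma cdiff_cst c z : cdiff (fun=> c) z 0.
Proof.
move=> e e0; exists 1 => // h _.
by rewrite subrr mul0r subrr normc0 mulr_ge0 ?normc_ge0 ?ltW.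
Qed.

Lemma cdiff_id z : cdiff id z 1.
Proof.
move=> e e0; exists 1 => // h _.
by rewrite mul1r [z + h]addrC addrK subrr normc0 mulr_ge0 ?normc_ge0 ?ltW.
Qed.

Lemma cdiffD f g z d1 d2 : cdiff f z d1 -> cdiff g z d2 ->
  cdiff (fun w => f w + g w) z (d1 + d2).
Proof.
move=> fz gz e e0.
have e2 : 0 < e / 2 by rewrite divr_gt0.
have [D1 D10 H1] := fz _ e2; have [D2 D20 H2] := gz _ e2.
exists (Num.min D1 D2) => [|h]; first by rewrite lt_min D10.
rewrite lt_min => /andP[/H1 h1 /H2 h2].
have -> : f (z + h) + g (z + h) - (f z + g z) - (d1 + d2) * h =
  (f (z + h) - f z - d1 * h) + (g (z + h) - g z - d2 * h) by ring.
apply: (le_trans (le_normcD _ _)); lra.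
Qed.

Lemma cdiffM f g z d1 d2 : cdiff f z d1 -> cdiff g z d2 ->
  cdiff (fun w => f w * g w) z (d1 * g z + f z * d2).
Proof.
move=> fz gz e e0.
set M := 1 + normc (g z) + normc (f z) + normc d1.
have M0 : 0 < M by rewrite /M; have := normc_ge0 (g z); have := normc_ge0 (f z); have := normc_ge0 d1; lra.
(* The error splits into three terms, each at most [e' * M * normc h]; [e' <= 1] keeps [g (z + h)]
   below [M]. *)
have e3 : 0 < Num.min 1 (e / (3 * M)) by rewrite lt_min ltr01 divr_gt0 // mulr_gt0.
set e' := Num.min 1 _ in e3.
have e'1 : e' <= 1 by rewrite ge_min lexx.
have e'M : e' * (3 * M) <= e by rewrite -ler_pdivlMr ?mulr_gt0 // ge_min lexx orbT.
have [D1 D10 H1] := fz _ e3; have [D2 D20 H2] := gz _ e3.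
have [D3 D30 H3] := cdiff_ccont gz e3.
exists (Num.min (Num.min D1 D2) D3) => [|h]; first by rewrite !lt_min D10 D20.
rewrite !lt_min => /andP[/andP[/H1 h1 /H2 h2] /H3 h3].
have -> : f (z + h) * g (z + h) - f z * g z - (d1 * g z + f z * d2) * h =
  (f (z + h) - f z - d1 * h) * g (z + h) + f z * (g (z + h) - g z - d2 * h)
  + d1 * h * (g (z + h) - g z) by ring.
apply: (le_trans (le_normcD _ _)); rewrite !normcM.
have hge := normc_ge0 h.
have gb : normc (g (z + h)) <= M.
  apply: (le_trans (ler_normc_tri _ (g z))).
  have := normc_ge0 (f z); have := normc_ge0 d1; rewrite /M; lra.
have fM : normc (f z) <= M by rewrite /M; have := normc_ge0 (g z); have := normc_ge0 d1; lra.
have dM : normc d1 <= M by rewrite /M; have := normc_ge0 (g z); have := normc_ge0 (f z); lra.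
have hb1 : normc (f (z + h) - f z - d1 * h) * normc (g (z + h)) <= (e' * normc h) * M.
  by apply: ler_pM => //; rewrite normc_ge0.
have hb2 : normc (f z) * normc (g (z + h) - g z - d2 * h) <= M * (e' * normc h).
  by apply: ler_pM => //; rewrite normc_ge0.
have hb3 : normc d1 * normc h * normc (g (z + h) - g z) <= (M * normc h) * e'.
  by apply: ler_pM => //; rewrite ?mulr_ge0 ?normc_ge0 // ler_wpM2r.
have s1 : normc ((f (z + h) - f z - d1 * h) * g (z + h) + f z * (g (z + h) - g z - d2 * h))
   <= (e' * normc h) * M + M * (e' * normc h).
  by apply: (le_trans (le_normcD _ _)); rewrite !normcM lerD.
apply: (le_trans (lerD s1 hb3)).
have -> : e' * normc h * M + M * (e' * normc h) + M * normc h * e' = (e' * (3 * M)) * normc h by ring.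
by rewrite ler_wpM2r.
Qed.

Lemma cdiff_comp f g z d1 d2 : cdiff f z d1 -> cdiff g (f z) d2 ->
  cdiff (fun w => g (f w)) z (d2 * d1).
Proof.
move=> fz gz e e0.
set M := 2 + normc d1 + normc d2.
have M0 : 0 < M by rewrite /M; have := normc_ge0 d1; have := normc_ge0 d2; lra.
have e3 : 0 < Num.min 1 (e / (2 * M)) by rewrite lt_min ltr01 divr_gt0 // mulr_gt0.
set e' := Num.min 1 _ in e3.
have e'1 : e' <= 1 by rewrite ge_min lexx.
have e'M : e' * (2 * M) <= e by rewrite -ler_pdivlMr ?mulr_gt0 // ge_min lexx orbT.
have [D1 D10 H1] := fz _ e3; have [D2 D20 H2] := gz _ e3.
have D2' : 0 < D2 / 2 by rewrite divr_gt0.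
have [D3 D30 H3] := cdiff_ccont fz D2'.
exists (Num.min D1 D3) => [|h]; first by rewrite !lt_min D10.
rewrite !lt_min => /andP[/H1 h1 /H3 h3].
set k := f (z + h) - f z in h1 h3.
have kD : normc k < D2 by apply: (le_lt_trans h3); lra.
have := H2 k kD; have -> : f z + k = f (z + h) by rewrite /k; ring.
move=> h2.
have -> : g (f (z + h)) - g (f z) - d2 * d1 * h =
  (g (f (z + h)) - g (f z) - d2 * k) + d2 * (k - d1 * h) by ring.
apply: (le_trans (le_normcD _ _)); rewrite normcM.
have hge := normc_ge0 h.
have kb : normc k <= M * normc h.
  apply: (le_trans (ler_normc_tri _ (d1 * h))); rewrite normcM.
  have : e' * normc h <= 1 * normc h by rewrite ler_wpM2r.
  have := mulr_ge0 (normc_ge0 d2) hge; rewrite /M; lra.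
have b1 : normc (g (f (z + h)) - g (f z) - d2 * k) <= e' * (M * normc h).
  by apply: (le_trans h2); rewrite ler_wpM2l // ltW.
have b2 : normc d2 * normc (k - d1 * h) <= M * (e' * normc h).
  apply: ler_pM => //; rewrite ?normc_ge0 // /M; have := normc_ge0 d1; lra.
apply: (le_trans (lerD b1 b2)).
have -> : e' * (M * normc h) + M * (e' * normc h) = (e' * (2 * M)) * normc h by ring.
by rewrite ler_wpM2r.
Qed.

Lemma ccont_neq0 f z : ccont f z -> f z != 0 ->
  exists2 D : R, 0 < D & forall w, normc (w - z) < D ->
    normc (f z) / 2 <= normc (f w) /\ f w != 0.
Proof.
move=> fz fz0; have n0 : 0 < normc (f z) / 2 by rewrite divr_gt0 // normc_gt0.
have [D D0 H] := ccont_near fz n0; exists D => // w /H h.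
have h2 : normc (f z) / 2 <= normc (f w).
  have := ler_normc_tri (f z) (f w); rewrite normcBC; lra.
by split => //; rewrite -normc_gt0; apply: lt_le_trans h2.
Qed.

Lemma cdiff_inv z : z != 0 -> cdiff (fun w => w^-1) z (- (z ^+ 2)^-1).
Proof.
move=> z0 e e0.
have nz : 0 < normc z by rewrite normc_gt0.
have d0 : 0 < e * normc z ^+ 3 / 2 by rewrite divr_gt0 // mulr_gt0 // exprn_gt0.
exists (Num.min (normc z / 2) (e * normc z ^+ 3 / 2)) => [|h].
  by rewrite lt_min d0 divr_gt0.
rewrite lt_min => /andP[hz he].
have zh : normc z / 2 <= normc (z + h).
  have := ler_normc_tri z (z + h); rewrite opprD addrA subrr add0r normcN; lra.
have zh0 : z + h != 0 by rewrite -normc_gt0; lra.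
have -> : (z + h)^-1 - z^-1 - - (z ^+ 2)^-1 * h = h ^+ 2 * ((z ^+ 2)^-1 * (z + h)^-1).
  by field; rewrite ?z0 ?zh0.
rewrite !normcM !normcV !normcX.
have -> : normc h ^+ 2 * ((normc z ^+ 2)^-1 * (normc (z + h))^-1) =
  (normc h / (normc z ^+ 2 * normc (z + h))) * normc h by field; rewrite ?normc_eq0 ?zh0 ?z0.
rewrite ler_wpM2r ?normc_ge0 // ler_pdivrMr ?mulr_gt0 ?exprn_gt0 //; last by rewrite normc_gt0.
apply: (le_trans (ltW he)).
have -> : e * normc z ^+ 3 / 2 = e * (normc z ^+ 2 * (normc z / 2)) by field.
by rewrite (ler_wpM2l (ltW e0)) // ler_wpM2l // exprn_ge0 // normc_ge0.
Qed.

Lemma hol_cst c z : hol (fun=> c) z.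
Proof. by exists 0; exact: cdiff_cst. Qed.
Lemma hol_id z : hol (fun w => w) z.
Proof. by exists 1; exact: cdiff_id. Qed.
Lemma holD f g z : hol f z -> hol g z -> hol (fun w => f w + g w) z.
Proof. by move=> [a ha] [b hb]; exists (a + b); exact: cdiffD. Qed.
Lemma holM f g z : hol f z -> hol g z -> hol (fun w => f w * g w) z.
Proof. by move=> [a ha] [b hb]; eexists; exact: (cdiffM ha hb). Qed.
Lemma hol_comp f g z : hol f z -> hol g (f z) -> hol (fun w => g (f w)) z.
Proof. by move=> [a ha] [b hb]; eexists; exact: (cdiff_comp ha hb). Qed.

Lemma hol_ext1 f g z : f =1 g -> hol f z -> hol g z.
Proof. by move=> fg; apply: (@hol_ext _ _ _ 1). Qed.

Lemma holN f z : hol f z -> hol (fun w => - f w) z.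
Proof.
by move=> hf; apply: hol_ext1 (holM (hol_cst (-1) z) hf) => w; rewrite mulN1r.
Qed.
Lemma holB f g z : hol f z -> hol g z -> hol (fun w => f w - g w) z.
Proof. by move=> hf /holN; exact: holD. Qed.
Lemma holV f z : f z != 0 -> hol f z -> hol (fun w => (f w)^-1) z.
Proof. by move=> f0 hf; apply: (hol_comp hf); eexists; exact: cdiff_inv. Qed.
Lemma hol_div f g z : g z != 0 -> hol f z -> hol g z -> hol (fun w => f w / g w) z.
Proof. by move=> g0 hf hg; apply: holM => //; exact: holV. Qed.
Lemma holX f n z : hol f z -> hol (fun w => f w ^+ n) z.
Proof.
move=> hf; elim: n => [|n ih].
  by apply: hol_ext1 (hol_cst 1 z) => w; rewrite expr0.
by apply: hol_ext1 (holM hf ih) => w; rewrite exprS.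
Qed.

Lemma ccontM f g z : ccont f z -> ccont g z -> ccont (fun w => f w * g w) z.
Proof.
move=> fz gz e e0.
set M := 1 + normc (g z) + normc (f z).
have M0 : 0 < M by rewrite /M; have := normc_ge0 (g z); have := normc_ge0 (f z); lra.
have e3 : 0 < Num.min 1 (e / (2 * M)) by rewrite lt_min ltr01 divr_gt0 // mulr_gt0.
set e' := Num.min 1 _ in e3.
have e'1 : e' <= 1 by rewrite ge_min lexx.
have e'M : e' * (2 * M) <= e by rewrite -ler_pdivlMr ?mulr_gt0 // ge_min lexx orbT.
have [D1 D10 H1] := fz _ e3; have [D2 D20 H2] := gz _ e3.
exists (Num.min D1 D2) => [|h]; first by rewrite !lt_min D10.
rewrite !lt_min => /andP[/H1 h1 /H2 h2].
have -> : f (z + h) * g (z + h) - f z * g z =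
  (f (z + h) - f z) * g (z + h) + f z * (g (z + h) - g z) by ring.
apply: (le_trans (le_normcD _ _)); rewrite !normcM.
have gb : normc (g (z + h)) <= M.
  apply: (le_trans (ler_normc_tri _ (g z))).
  have := normc_ge0 (f z); rewrite /M; lra.
have fM : normc (f z) <= M by rewrite /M; have := normc_ge0 (g z); lra.
have b1 : normc (f (z + h) - f z) * normc (g (z + h)) <= e' * M.
  by apply: ler_pM => //; rewrite normc_ge0.
have b2 : normc (f z) * normc (g (z + h) - g z) <= M * e'.
  by apply: ler_pM => //; rewrite normc_ge0.
apply: (le_trans (lerD b1 b2)); lra.
Qed.

Lemma ccontD f g z : ccont f z -> ccont g z -> ccont (fun w => f w + g w) z.
Proof.
move=> fz gz e e0.
have e2 : 0 < e / 2 by rewrite divr_gt0.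
have [D1 D10 H1] := fz _ e2; have [D2 D20 H2] := gz _ e2.
exists (Num.min D1 D2) => [|h]; first by rewrite lt_min D10.
rewrite lt_min => /andP[/H1 h1 /H2 h2].
have -> : f (z + h) + g (z + h) - (f z + g z) =
  (f (z + h) - f z) + (g (z + h) - g z) by ring.
apply: (le_trans (le_normcD _ _)); lra.
Qed.

Lemma ccont_ext f g z (r : R) : 0 < r ->
  (forall w, normc (w - z) < r -> f w = g w) -> ccont f z -> ccont g z.
Proof.
move=> r0 fg fz e e0; have [D D0 H] := fz e e0.
exists (Num.min D r) => [|h]; first by rewrite lt_min D0.
rewrite lt_min => /andP[hD hr]; rewrite -!fg ?subrr ?normc0 //; first exact: H.
by rewrite addrC addKr.
Qed.

Lemma cdiff_uniq f z d1 d2 : cdiff f z d1 -> cdiff f z d2 -> d1 = d2.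
Proof.
move=> h1 h2; apply/eqP; rewrite -subr_eq0; apply/eqP.
apply: normc_le_eps => e e0.
have e2 : 0 < e / 2 by rewrite divr_gt0.
have [D1 D10 H1] := h1 _ e2; have [D2 D20 H2] := h2 _ e2.
set t := Num.min D1 D2 / 2.
have m0 : 0 < Num.min D1 D2 by rewrite lt_min D10.
have t0 : 0 < t by rewrite /t divr_gt0.
have nt : normc t%:C = t by rewrite normc_real gtr0_norm.
have tm : t < Num.min D1 D2 by rewrite /t; lra.
have := H1 t%:C; have := H2 t%:C; rewrite nt.
move: tm; rewrite lt_min => /andP[-> ->] /(_ isT) a /(_ isT) b.
have : normc (d1 - d2) * t <= e * t.
  rewrite -[X in _ * X <= _]nt -normcM.
  have -> : (d1 - d2) * t%:C = (f (z + t%:C) - f z - d2 * t%:C) - (f (z + t%:C) - f z - d1 * t%:C) by ring.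
  apply: (le_trans (ler_normcB _ _)); lra.
by rewrite ler_pM2r.
Qed.

(** The radius of a ball in [R[i]] is itself a complex number; being positive it is real, and its
    real part serves as the radius below. *)
Lemma entire_hol f : entire f -> forall z, hol f z.
Proof.
move=> fe z; have /cvg_ex[d fd] := fe z; exists d => e e0.
have e0' : (0 : R[i]) < e%:C by rewrite ltcR.
have /cvgrPdist_lt /(_ _ e0') := fd.
rewrite /dnbhs => -[/= r r0 H].
have rr : 0 < complex.Re r by move: r0; rewrite ltcE /= => /andP[].
have rE : r = (complex.Re r)%:C.
  by move: r0; rewrite ltcE /= => /andP[/eqP i0 _]; rewrite [LHS]complexE i0 mulr0 addr0.
exists (complex.Re r) => // h hr.
have [->|h0] := eqVneq h 0; first by rewrite addr0 mulr0 subrr sub0r oppr0 normc0 mulr0.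
have : ball_ Num.norm 0 r h.
  by rewrite /ball_ /= sub0r normrN rE normr_normc ltcR.
move=> /H /(_ h0) /=.
have -> : h *: (1 : R[i]) = h by rewrite /GRing.scale /= mulr1.
rewrite [h + z]addrC normr_normc ltcR => /ltW.
set X := d - _ => hX.
have -> : f (z + h) - f z - d * h = - X * h.
  by rewrite /X /GRing.scale /=; field.
by rewrite normcM normcN ler_wpM2r // normc_ge0.
Qed.

End Holomorphy.

(** * Integrals of continuous complex-valued functions over segments *)

Section PathIntegral.
Variable R : realType.
Implicit Types (g : R -> R[i]) (a b c t : R).
Local Notation mu := (@lebesgue_measure R).

Definition pcont g t := forall e : R, 0 < e -> exists2 D : R, 0 < D &
  forall h, `|h| < D -> normc (g (t + h) - g t) <= e.

Definition cint g a b : R[i] :=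
  (\int[mu]_(x in `[a, b]) complex.Re (g x)) +i*
  (\int[mu]_(x in `[a, b]) complex.Im (g x)).

Lemma pcont_Re g t : pcont g t -> {for t, continuous (fun x => complex.Re (g x))}.
Proof.
move=> gt; apply/cvgrPdist_le => /= e e0; have [D D0 H] := gt e e0.
exists D => //= x /=; rewrite distrC => /H; rewrite [t + _]addrC subrK => h.
apply: le_trans h; rewrite distrC; apply: le_trans (Re_le_normc _).
by case: (g x) (g t) => ? ? [? ?].
Qed.

Lemma pcont_Im g t : pcont g t -> {for t, continuous (fun x => complex.Im (g x))}.
Proof.
move=> gt; apply/cvgrPdist_le => /= e e0; have [D D0 H] := gt e e0.
exists D => //= x /=; rewrite distrC => /H; rewrite [t + _]addrC subrK => h.
apply: le_trans h; rewrite distrC; apply: le_trans (Im_le_normc _).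
by case: (g x) (g t) => ? ? [? ?].
Qed.

Lemma within_for (f : R -> R) a b :
  (forall t, a <= t <= b -> {for t, continuous f}) ->
  {within `[a, b], continuous f}.
Proof.
move=> H; apply: continuous_in_subspaceT => x; rewrite inE /= in_itv /=; exact: H.
Qed.

Lemma for_integrable (f : R -> R) a b :
  (forall t, a <= t <= b -> {for t, continuous f}) ->
  mu.-integrable `[a, b] (EFin \o f).
Proof.
move=> H; apply: continuous_compact_integrable; first exact: segment_compact.
exact: within_for.
Qed.

Definition pcont_on g a b := forall t, a <= t <= b -> pcont g t.

Lemma pcont_intRe g a b : pcont_on g a b ->
  mu.-integrable `[a, b] (EFin \o (fun x => complex.Re (g x))).
Proof. by move=> H; apply: for_integrable => t /H /pcont_Re. Qed.

Lemma pcont_intIm g a b : pcont_on g a b ->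
  mu.-integrable `[a, b] (EFin \o (fun x => complex.Im (g x))).
Proof. by move=> H; apply: for_integrable => t /H /pcont_Im. Qed.

Lemma eq_cint g1 g2 a b : (forall t, a <= t <= b -> g1 t = g2 t) ->
  cint g1 a b = cint g2 a b.
Proof.
by move=> H; congr (_ +i* _); apply: eq_Rintegral => x; rewrite inE /= in_itv /= => /H ->.
Qed.

Lemma cintD g1 g2 a b : pcont_on g1 a b -> pcont_on g2 a b ->
  cint (fun t => g1 t + g2 t) a b = cint g1 a b + cint g2 a b.
Proof.
move=> H1 H2; rewrite /cint /=; apply/eqP; rewrite eq_complex /=; apply/andP; split; apply/eqP.
- rewrite -RintegralD //; try exact: pcont_intRe.
  by apply: eq_Rintegral => x _; case: (g1 x) (g2 x) => ? ? [? ?].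
- rewrite -RintegralD //; try exact: pcont_intIm.
  by apply: eq_Rintegral => x _; case: (g1 x) (g2 x) => ? ? [? ?].
Qed.

Lemma cintZ k g a b : pcont_on g a b ->
  cint (fun t => k * g t) a b = k * cint g a b.
Proof.
move=> H; have IR := pcont_intRe H; have II := pcont_intIm H.
have IRZ (r : R) : mu.-integrable `[a, b] (EFin \o (fun x => r * complex.Re (g x))).
  apply: for_integrable => t /H /pcont_Re ct; apply: cvgM => //; exact: cvg_cst.
have IIZ (r : R) : mu.-integrable `[a, b] (EFin \o (fun x => r * complex.Im (g x))).
  apply: for_integrable => t /H /pcont_Im ct; apply: cvgM => //; exact: cvg_cst.
case: k => k l; rewrite /cint; apply/eqP; rewrite eq_complex /=; apply/andP; split; apply/eqP.
- rewrite -!RintegralZl // -RintegralB //.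
  by apply: eq_Rintegral => x _; case: (g x) => ? ?.
- rewrite -!RintegralZl // -RintegralD //.
  by apply: eq_Rintegral => x _; case: (g x) => ? ?.
Qed.

Lemma Rint_itv_cst (k a b : R) : a <= b -> \int[mu]_(x in `[a, b]) k = k * (b - a).
Proof.
move=> ab; rewrite Rintegral_cst //= lebesgue_measure_itv /= lte_fin.
by case: ltgtP ab => // -> _; rewrite subrr.
Qed.

Lemma Rint_norm (f : R -> R) a b M : a <= b ->
  mu.-integrable `[a, b] (EFin \o f) -> (forall t, a <= t <= b -> `|f t| <= M) ->
  `|\int[mu]_(x in `[a, b]) f x| <= M * (b - a).
Proof.
move=> ab fi H; apply: (le_trans (le_normr_Rintegral _ fi)) => //.
rewrite -Rint_itv_cst //; apply: le_Rintegral => //.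
- exact: (integrable_norm fi).
- by apply: for_integrable => t _; exact: cvg_cst.
Qed.

(** The factor 2 comes from estimating real and imaginary part separately. It is harmless, since
    such bounds only enter limits or unspecified constants. *)
Lemma cint_norm g a b M : a <= b -> pcont_on g a b ->
  (forall t, a <= t <= b -> normc (g t) <= M) ->
  normc (cint g a b) <= 2 * M * (b - a).
Proof.
move=> ab H HM; apply: (le_trans (normc_le_ReIm _)) => /=.
have h1 := @Rint_norm _ a b M ab (pcont_intRe H) (fun t ht => le_trans (Re_le_normc _) (HM t ht)).
have h2 := @Rint_norm _ a b M ab (pcont_intIm H) (fun t ht => le_trans (Im_le_normc _) (HM t ht)).
by apply: (le_trans (lerD h1 h2)); lra.
Qed.

Lemma cint_cst k a b : a <= b -> cint (fun=> k) a b = k * (b - a)%:C.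
Proof.
move=> ab; rewrite /cint !Rint_itv_cst //; case: k => k l.
by apply/eqP; rewrite eq_complex /=; apply/andP; split; apply/eqP; ring.
Qed.

Lemma Rint_cat (f : R -> R) a b c : a <= b -> b <= c ->
  mu.-integrable `[a, c] (EFin \o f) ->
  \int[mu]_(x in `[a, c]) f x = \int[mu]_(x in `[a, b]) f x + \int[mu]_(x in `[b, c]) f x.
Proof.
move=> ab bc fi; rewrite -(@Rintegral_itv_obnd_cbnd _ b (BRight c)).
  have := @Rintegral_itvB _ f (BLeft a) (BRight c) b fi.
  by rewrite !bnd_simp => /(_ ab bc) <-; rewrite addrC subrK.
by apply: integrableS fi => //; apply: subset_itvr; rewrite bnd_simp.
Qed.

Lemma cint_cat g a b c : a <= b -> b <= c -> pcont_on g a c ->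
  cint g a c = cint g a b + cint g b c.
Proof.
move=> ab bc H; rewrite /cint (Rint_cat ab bc (pcont_intRe H)).
by rewrite (Rint_cat ab bc (pcont_intIm H)).
Qed.

End PathIntegral.

(** * Contour integrals over boundaries of rectangles *)

Section Rectangles.
Variable R : realType.
Implicit Types (f g : R[i] -> R[i]) (z : R[i]).

Definition rect (x0 x1 y0 y1 : R) : set R[i] :=
  [set z | x0 <= complex.Re z <= x1 /\ y0 <= complex.Im z <= y1].

Definition bdr (x0 x1 y0 y1 : R) : set R[i] :=
  [set z | rect x0 x1 y0 y1 z /\
    [\/ complex.Re z = x0, complex.Re z = x1, complex.Im z = y0 | complex.Im z = y1]].

(** The counter-clockwise contour integral of [f], with [dz] equal to [dx] on horizontal and ['i dy]
    on vertical sides. *)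
Definition rint f x0 x1 y0 y1 : R[i] :=
  (cint (fun x => f (x +i* y0)) x0 x1 - cint (fun x => f (x +i* y1)) x0 x1) +
  'i * (cint (fun y => f (x1 +i* y)) y0 y1 - cint (fun y => f (x0 +i* y)) y0 y1).

Lemma ccont_hor f x y : ccont f (x +i* y) -> pcont (fun t => f (t +i* y)) x.
Proof.
move=> fc e /fc[D D0 H]; exists D => // h hD.
have := H h%:C; rewrite normc_real => /(_ hD).
by congr (normc (f _ - _) <= _); apply/eqP; rewrite eq_complex /= addr0 !eqxx.
Qed.

Lemma ccont_ver f x y : ccont f (x +i* y) -> pcont (fun t => f (x +i* t)) y.
Proof.
move=> fc e /fc[D D0 H]; exists D => // h hD.
have := H ('i * h%:C); rewrite normcM normc_i normc_real mul1r => /(_ hD).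
by congr (normc (f _ - _) <= _); apply/eqP; rewrite eq_complex /=; apply/andP; split; apply/eqP; ring.
Qed.

Definition ccont_on (A : set R[i]) f := forall z, A z -> ccont f z.
Definition hol_on (A : set R[i]) f := forall z, A z -> hol f z.

Lemma hol_ccont_on A f : hol_on A f -> ccont_on A f.
Proof. by move=> H z /H /hol_ccont. Qed.

Lemma bdr_rect x0 x1 y0 y1 : bdr x0 x1 y0 y1 `<=` rect x0 x1 y0 y1.
Proof. by move=> z []. Qed.

Section Boundary.
Variables (x0 x1 y0 y1 : R).
Hypotheses (x01 : x0 <= x1) (y01 : y0 <= y1).
Local Notation B := (bdr x0 x1 y0 y1).

Lemma bdr_bot x : x0 <= x <= x1 -> B (x +i* y0).
Proof. by move=> h; split; [split => //=; rewrite lexx|exact: Or43]. Qed.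
Lemma bdr_top x : x0 <= x <= x1 -> B (x +i* y1).
Proof. by move=> h; split; [split => //=; rewrite lexx andbT|exact: Or44]. Qed.
Lemma bdr_left y : y0 <= y <= y1 -> B (x0 +i* y).
Proof. by move=> h; split; [split => //=; rewrite lexx|exact: Or41]. Qed.
Lemma bdr_right y : y0 <= y <= y1 -> B (x1 +i* y).
Proof. by move=> h; split; [split => //=; rewrite lexx andbT|exact: Or42]. Qed.

Lemma pc_bot f : ccont_on B f -> pcont_on (fun x => f (x +i* y0)) x0 x1.
Proof. by move=> H t /bdr_bot /H; exact: ccont_hor. Qed.
Lemma pc_top f : ccont_on B f -> pcont_on (fun x => f (x +i* y1)) x0 x1.
Proof. by move=> H t /bdr_top /H; exact: ccont_hor. Qed.
Lemma pc_left f : ccont_on B f -> pcont_on (fun y => f (x0 +i* y)) y0 y1.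
Proof. by move=> H t /bdr_left /H; exact: ccont_ver. Qed.
Lemma pc_right f : ccont_on B f -> pcont_on (fun y => f (x1 +i* y)) y0 y1.
Proof. by move=> H t /bdr_right /H; exact: ccont_ver. Qed.

Lemma rintD f g : ccont_on B f -> ccont_on B g ->
  rint (fun z => f z + g z) x0 x1 y0 y1 = rint f x0 x1 y0 y1 + rint g x0 x1 y0 y1.
Proof.
move=> hf hg; rewrite /rint !cintD; first by ring.
all: by [exact: pc_bot|exact: pc_top|exact: pc_left|exact: pc_right].
Qed.

Lemma rintZ k f : ccont_on B f ->
  rint (fun z => k * f z) x0 x1 y0 y1 = k * rint f x0 x1 y0 y1.
Proof.
move=> hf; rewrite /rint !cintZ; first by ring.
all: by [exact: pc_bot|exact: pc_top|exact: pc_left|exact: pc_right].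
Qed.

Lemma eq_rint f g : (forall z, B z -> f z = g z) ->
  rint f x0 x1 y0 y1 = rint g x0 x1 y0 y1.
Proof.
move=> H; rewrite /rint; congr (_ - _ + _ * (_ - _)); apply: eq_cint => t ht; apply: H.
- exact: bdr_bot. - exact: bdr_top. - exact: bdr_right. - exact: bdr_left.
Qed.

Lemma rint_norm f M : ccont_on B f -> (forall z, B z -> normc (f z) <= M) ->
  normc (rint f x0 x1 y0 y1) <= 4 * M * ((x1 - x0) + (y1 - y0)).
Proof.
move=> hf HM.
have h1 := cint_norm x01 (pc_bot hf) (fun t ht => HM _ (bdr_bot ht)).
have h2 := cint_norm x01 (pc_top hf) (fun t ht => HM _ (bdr_top ht)).
have h3 := cint_norm y01 (pc_right hf) (fun t ht => HM _ (bdr_right ht)).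
have h4 := cint_norm y01 (pc_left hf) (fun t ht => HM _ (bdr_left ht)).
rewrite /rint; apply: (le_trans (le_normcD _ _)); rewrite normcM normc_i mul1r.
have := ler_normcB (cint (fun x => f (x +i* y0)) x0 x1) (cint (fun x => f (x +i* y1)) x0 x1).
have := ler_normcB (cint (fun y => f (x1 +i* y)) y0 y1) (cint (fun y => f (x0 +i* y)) y0 y1).
lra.
Qed.

(** On opposite sides the integrand differs by a constant, and the two constants cancel. Thus in
    Goursat's argument only the remainder of the first-order expansion counts. *)
Lemma rint_affine p q : rint (fun z => p + q * z) x0 x1 y0 y1 = 0.
Proof.
have cn (k : R[i]) a b : pcont_on (fun _ : R => k) a b.
  by move=> t _ e e0; exists 1 => // h _; rewrite subrr normc0 ltW.
have ch (y : R) a b : pcont_on (fun x => p + q * (x +i* y)) a b.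
  move=> t _; apply: (@ccont_hor (fun z => p + q * z)).
  by apply: hol_ccont; apply: holD; [exact: hol_cst|apply: holM; [exact: hol_cst|exact: hol_id]].
have cv (x : R) a b : pcont_on (fun y => p + q * (x +i* y)) a b.
  move=> t _; apply: (@ccont_ver (fun z => p + q * z)).
  by apply: hol_ccont; apply: holD; [exact: hol_cst|apply: holM; [exact: hol_cst|exact: hol_id]].
have e1 : cint (fun x => p + q * (x +i* y0)) x0 x1 =
   cint (fun x => p + q * (x +i* y1)) x0 x1 + q * 'i * (y0 - y1)%:C * (x1 - x0)%:C.
  rewrite -cint_cst // -cintD //; apply: eq_cint => t _.
  by rewrite (mkcE t y0) (mkcE t y1) rmorphB; ring.
have e2 : cint (fun y => p + q * (x1 +i* y)) y0 y1 =
   cint (fun y => p + q * (x0 +i* y)) y0 y1 + q * (x1 - x0)%:C * (y1 - y0)%:C.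
  rewrite -cint_cst // -cintD //; apply: eq_cint => t _.
  by rewrite (mkcE x1 t) (mkcE x0 t) rmorphB; ring.
by rewrite /rint e1 e2 !rmorphB; ring.
Qed.

End Boundary.

Lemma rectS a0 a1 b0 b1 x0 x1 y0 y1 : x0 <= a0 -> a1 <= x1 -> y0 <= b0 -> b1 <= y1 ->
  rect a0 a1 b0 b1 `<=` rect x0 x1 y0 y1.
Proof. by move=> ? ? ? ? z [/andP[? ?] /andP[? ?]]; split; apply/andP; split; lra. Qed.

Lemma rint_splitx f x x0 x1 y0 y1 : x0 <= x <= x1 -> y0 <= y1 ->
  ccont_on (bdr x0 x1 y0 y1) f ->
  rint f x0 x1 y0 y1 = rint f x0 x y0 y1 + rint f x x1 y0 y1.
Proof.
move=> /andP[a b] y01 HB; have x01 := le_trans a b.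
rewrite /rint (cint_cat a b (pc_bot y01 HB)) (cint_cat a b (pc_top y01 HB)); ring.
Qed.

Lemma rint_splity f y x0 x1 y0 y1 : x0 <= x1 -> y0 <= y <= y1 ->
  ccont_on (bdr x0 x1 y0 y1) f ->
  rint f x0 x1 y0 y1 = rint f x0 x1 y0 y + rint f x0 x1 y y1.
Proof.
move=> x01 /andP[a b] HB; have y01 := le_trans a b.
rewrite /rint (cint_cat a b (pc_left x01 HB)) (cint_cat a b (pc_right x01 HB)); ring.
Qed.

(** Replace [f] by its first-order remainder at [z0], which is at most [e / 4] times the sum of the
    side lengths; [rint_norm] contributes the factor 4 and that sum once more. *)
Lemma goursat_local f z0 e : 0 < e -> hol f z0 -> exists2 D : R, 0 < D &
  forall x0 x1 y0 y1, x0 <= x1 -> y0 <= y1 -> rect x0 x1 y0 y1 z0 ->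
    (x1 - x0) + (y1 - y0) < D -> ccont_on (rect x0 x1 y0 y1) f ->
    normc (rint f x0 x1 y0 y1) <= e * ((x1 - x0) + (y1 - y0)) ^+ 2.
Proof.
move=> e0 [d fd]; have e4 : 0 < e / 4 by rewrite divr_gt0.
have [D D0 H] := fd _ e4; exists D => // x0 x1 y0 y1 x01 y01 rz dD fc.
have rB := @bdr_rect x0 x1 y0 y1.
pose r z := f z - f z0 - d * (z - z0).
have ac : ccont_on (bdr x0 x1 y0 y1) (fun z => (f z0 - d * z0) + d * z).
  by move=> z _; apply: hol_ccont; apply: holD; [exact: hol_cst|apply: holM; [exact: hol_cst|exact: hol_id]].
have fB : ccont_on (bdr x0 x1 y0 y1) f by move=> z /rB /fc.
have rc : ccont_on (bdr x0 x1 y0 y1) r.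
  move=> z zB; apply: (@ccont_ext _ (fun w => f w + ((d * z0 - f z0) + (- d) * w)) _ _ 1) => //.
    by move=> w _; rewrite /r; ring.
  apply: ccontD; first exact: fB.
  by apply: hol_ccont; apply: holD; [exact: hol_cst|apply: holM; [exact: hol_cst|exact: hol_id]].
have -> : rint f x0 x1 y0 y1 = rint r x0 x1 y0 y1.
  rewrite -[RHS]add0r -(rint_affine x01 y01 (f z0 - d * z0) d) -rintD //.
  by apply: eq_rint => // z _; rewrite /r; ring.
have := rint_norm x01 y01 rc; move=> /(_ (e / 4 * ((x1 - x0) + (y1 - y0)))) h.
apply: le_trans (h _) _; last first.
  by rewrite le_eqVlt; apply/orP; left; apply/eqP; field.
move=> z /rB zr.
have nz : normc (z - z0) <= (x1 - x0) + (y1 - y0).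
  apply: (le_trans (normc_le_ReIm _)); rewrite !raddfB /=.
  case: zr rz => /andP[? ?] /andP[? ?] [/andP[? ?] /andP[? ?]].
  by rewrite lerD // ler_norml; apply/andP; split; lra.
have := H (z - z0) (le_lt_trans nz dD); rewrite [z0 + _]addrC subrK => h1.
by apply: (le_trans h1); rewrite ler_pM2l.
Qed.

End Rectangles.

(** * Bisection of rectangles as an induction principle *)

Section Bisection.
Variable R : realType.
Variables (X Y W H : R).
Hypotheses (W0 : 0 <= W) (H0 : 0 <= H).

Definition subrect (x y w h : R) :=
  [/\ 0 <= w, 0 <= h, X <= x, x + w <= X + W & Y <= y /\ y + h <= Y + H].

(** If [P] fails on the whole it fails on nested quarters, which shrink to a point [(p, q)]; there
    the local hypothesis is contradicted. *)
Lemma bisection (P : R -> R -> R -> R -> Prop) :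
  (forall x y w h, subrect x y w h ->
     P x y (w / 2) (h / 2) -> P (x + w / 2) y (w / 2) (h / 2) ->
     P x (y + h / 2) (w / 2) (h / 2) -> P (x + w / 2) (y + h / 2) (w / 2) (h / 2) ->
     P x y w h) ->
  (forall p q, X <= p <= X + W -> Y <= q <= Y + H -> exists2 D : R, 0 < D &
     forall x y w h, subrect x y w h -> x <= p <= x + w -> y <= q <= y + h ->
       w + h < D -> P x y w h) ->
  P X Y W H.
Proof.
move=> split_P loc_P; apply: contrapT => NP.
(* A state holds the lower left corner and the level [n]; the sides [W / 2 ^+ n] and [H / 2 ^+ n]
   are implied. The premises make the relation total, as [choice] demands. *)
pose nxt (s s' : R * R * nat) :=
  let: (x, y, n) := s in let: (x', y', n') := s' in
  subrect x y (W / 2 ^+ n) (H / 2 ^+ n) -> ~ P x y (W / 2 ^+ n) (H / 2 ^+ n) ->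
  [/\ n' = n.+1, x' = x \/ x' = x + W / 2 ^+ n / 2, y' = y \/ y' = y + H / 2 ^+ n / 2 &
      ~ P x' y' (W / 2 ^+ n / 2) (H / 2 ^+ n / 2)].
have [F HF] : {F : R * R * nat -> R * R * nat & forall s, nxt s (F s)}.
  apply: (@choice _ _ nxt) => -[[x y] n].
  set w := W / 2 ^+ n; set h := H / 2 ^+ n.
  have [hs|hs] := pselect (subrect x y w h /\ ~ P x y w h); last first.
    by exists (x, y, n) => h1 h2; exfalso; apply: hs.
  have [sb np] := hs.
  have [p1|p1] := pselect (P x y (w / 2) (h / 2)); last first.
    by exists (x, y, n.+1) => _ _; split; [|left|left|].
  have [p2|p2] := pselect (P (x + w / 2) y (w / 2) (h / 2)); last first.
    by exists (x + w / 2, y, n.+1) => _ _; split; [|right|left|].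
  have [p3|p3] := pselect (P x (y + h / 2) (w / 2) (h / 2)); last first.
    by exists (x, y + h / 2, n.+1) => _ _; split; [|left|right|].
  have [p4|p4] := pselect (P (x + w / 2) (y + h / 2) (w / 2) (h / 2)); last first.
    by exists (x + w / 2, y + h / 2, n.+1) => _ _; split; [|right|right|].
  by exfalso; apply: np; exact: split_P.
pose s n := iter n F (X, Y, 0%N).
pose x n := (s n).1.1. pose y n := (s n).1.2.
pose w n := W / 2 ^+ n. pose h n := H / 2 ^+ n.
have w0 n : 0 <= w n by rewrite /w divr_ge0 // exprn_ge0.
have h0 n : 0 <= h n by rewrite /h divr_ge0 // exprn_ge0.
have wS n : w n.+1 = w n / 2 by rewrite /w exprS invfM; ring.
have hS n : h n.+1 = h n / 2 by rewrite /h exprS invfM; ring.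
have inv n : [/\ (s n).2 = n, subrect (x n) (y n) (w n) (h n) & ~ P (x n) (y n) (w n) (h n)] /\
   (x n <= x n.+1 /\ x n.+1 + w n.+1 <= x n + w n) /\ (y n <= y n.+1 /\ y n.+1 + h n.+1 <= y n + h n).
  have step m : [/\ (s m).2 = m, subrect (x m) (y m) (w m) (h m) & ~ P (x m) (y m) (w m) (h m)] ->
     [/\ (s m.+1).2 = m.+1, subrect (x m.+1) (y m.+1) (w m.+1) (h m.+1) & ~ P (x m.+1) (y m.+1) (w m.+1) (h m.+1)] /\
   (x m <= x m.+1 /\ x m.+1 + w m.+1 <= x m + w m) /\ (y m <= y m.+1 /\ y m.+1 + h m.+1 <= y m + h m).
    move=> [e sb np]; have := HF (s m).
    rewrite /nxt; move: e sb np; rewrite wS hS /x /y /w /h.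
    have -> : s m.+1 = F (s m) by [].
    case: (s m) => -[a b] k /= -> sb np; case: (F (a, b, m)) => -[a' b'] k' /= /(_ sb np).
    move=> [-> ha hb np'].
    case: sb => s1 s2 s3 s4 [s5 s6].
    have q1 : 0 <= W / 2 ^+ m / 2 by rewrite divr_ge0.
    have q2 : 0 <= H / 2 ^+ m / 2 by rewrite divr_ge0.
    have A : [/\ a <= a', a' + W / 2 ^+ m / 2 <= a + W / 2 ^+ m, b <= b' & b' + H / 2 ^+ m / 2 <= b + H / 2 ^+ m].
      by case: ha => ->; case: hb => ->; split; lra.
    case: A => A1 A2 A3 A4; split; last by [].
    by split => //; split; try lra; split; lra.
  have b0 : [/\ (s 0).2 = 0%N, subrect (x 0%N) (y 0%N) (w 0%N) (h 0%N) & ~ P (x 0%N) (y 0%N) (w 0%N) (h 0%N)].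
    by rewrite /w /h !expr0 !divr1; split => //; split; rewrite ?lexx.
  have all m : [/\ (s m).2 = m, subrect (x m) (y m) (w m) (h m) & ~ P (x m) (y m) (w m) (h m)].
    by elim: m => [//|m /step[]].
  by split; [exact: all|have [] := step n (all n)].
have bnd (u v : nat -> R) : (forall n, u n <= u n.+1) -> (forall n, u n.+1 + v n.+1 <= u n + v n) ->
  (forall n, 0 <= v n) -> exists p, forall n, u n <= p <= u n + v n.
  move=> ui vd v0.
  have mu : forall n k, u n <= u (n + k)%N.
    by move=> n; elim=> [|k ih]; rewrite ?addn0 // addnS (le_trans ih).
  have mv : forall n k, u (n + k)%N + v (n + k)%N <= u n + v n.
    by move=> n; elim=> [|k ih]; rewrite ?addn0 // addnS (le_trans (vd _)).
  have uv n m : u n <= u m + v m.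
    have [nm|mn] := leqP n m.
      have := mu n (m - n)%N; rewrite subnKC // => h1.
      by apply: (le_trans h1); rewrite lerDl.
    have := mv m (n - m)%N; rewrite subnKC ?(ltnW mn) // => h1.
    by apply: le_trans h1; rewrite lerDl.
  exists (sup (range u)) => n; apply/andP; split.
    apply: ub_le_sup; last by exists n.
    by exists (u 0%N + v 0%N) => _ [m _ <-].
  by apply: ge_sup; [exists (u 0%N); exists 0%N|move=> _ [m _ <-]].
have [p Hp] := bnd x w (fun n => (inv n).2.1.1) (fun n => (inv n).2.1.2) w0.
have [q Hq] := bnd y h (fun n => (inv n).2.2.1) (fun n => (inv n).2.2.2) h0.
have Hp0 := Hp 0%N; have Hq0 := Hq 0%N.
have [D D0 HD] : exists2 D : R, 0 < D &
     forall x y w h, subrect x y w h -> x <= p <= x + w -> y <= q <= y + h ->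
       w + h < D -> P x y w h.
  by apply: loc_P; [move: Hp0|move: Hq0]; rewrite /x /y /w /h /s /= expr0 divr1.
(* The level [n] is any integer above [(W + H) / D], because [n < 2 ^ n]. *)
have [n Hn] : exists n, w n + h n < D.
  have A0 : 0 <= (W + H) / D by rewrite divr_ge0 ?addr_ge0 // ltW.
  exists (Num.Def.archi_bound ((W + H) / D)).
  set N := Num.Def.archi_bound _.
  have hN : (W + H) / D < N%:R by exact: archi_boundP.
  have h2 : (N%:R : R) <= 2 ^+ N by rewrite -natrX ler_nat ltnW // ltn_expl.
  rewrite /w /h -mulrDl ltr_pdivrMr ?exprn_gt0 //.
  by move: hN; rewrite ltr_pdivrMr // mulrC => hN; apply: (lt_le_trans hN); rewrite ler_pM2l.
by have [[_ sb np] _] := inv n; apply: np; exact: (HD _ _ _ _ sb (Hp n) (Hq n) Hn).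
Qed.

End Bisection.

Section Goursat.
Variable R : realType.
Implicit Types (f g : R[i] -> R[i]) (z : R[i]).

(** The bound [e * (w + h) ^+ 2] scales like an area: the bounds of the four quarters add up to that
    of the whole, so it is an invariant for bisection. *)
Theorem goursat f x0 x1 y0 y1 : x0 <= x1 -> y0 <= y1 ->
  hol_on (rect x0 x1 y0 y1) f -> rint f x0 x1 y0 y1 = 0.
Proof.
move=> x01 y01 hf; have fc := hol_ccont_on hf.
have xE : x0 + (x1 - x0) = x1 by ring.
have yE : y0 + (y1 - y0) = y1 by ring.
have Wp : 0 <= x1 - x0 by rewrite subr_ge0.
have Hp : 0 <= y1 - y0 by rewrite subr_ge0.
set S := (x1 - x0 + (y1 - y0)) ^+ 2.
suff key e : 0 < e -> normc (rint f x0 x1 y0 y1) <= e * S.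
  apply: normc_le_eps => e e0.
  have S1 : 0 < S + 1 by rewrite ltr_wpDl // sqr_ge0.
  apply: (le_trans (key (e / (S + 1)) _)); first by rewrite divr_gt0.
  rewrite -mulrA ler_piMr ?(ltW e0) // mulrC ler_pdivrMr // mul1r lerDl //.
move=> e0.
pose P x y w h := normc (rint f x (x + w) y (y + h)) <= e * (w + h) ^+ 2.
suff : P x0 y0 (x1 - x0) (y1 - y0) by rewrite /P xE yE.
apply: (@bisection R x0 y0 (x1 - x0) (y1 - y0) _ _ P) => // [x y w h|p q hp hq].
- move=> [w0 h0 s1 s2 [s3 s4]]; rewrite /P.
  have ww : x + w / 2 + w / 2 = x + w by field.
  have hh : y + h / 2 + h / 2 = y + h by field.
  rewrite ww hh => p1 p2 p3 p4.
  have w2 : 0 <= w / 2 by rewrite divr_ge0.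
  have h2 : 0 <= h / 2 by rewrite divr_ge0.
  have sub a0 a1 b0 b1 : x <= a0 -> a1 <= x + w -> y <= b0 -> b1 <= y + h ->
      ccont_on (bdr a0 a1 b0 b1) f.
    move=> ? ? ? ? z /bdr_rect zr; apply: fc; move: z zr; apply: rectS; lra.
  rewrite (@rint_splitx _ f (x + w / 2)); last 3 first.
  + by apply/andP; split; lra.
  + by lra.
  + by apply: sub; lra.
  rewrite (@rint_splity _ f (y + h / 2) x); last 3 first.
  + by lra.
  + by apply/andP; split; lra.
  + by apply: sub; lra.
  rewrite (@rint_splity _ f (y + h / 2) (x + w / 2)); last 3 first.
  + by lra.
  + by apply/andP; split; lra.
  + by apply: sub; lra.
  apply: (le_trans (le_normcD _ _)).
  apply: (le_trans (lerD (le_normcD _ _) (le_normcD _ _))).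
  have -> : e * (w + h) ^+ 2 = 4 * (e * (w / 2 + h / 2) ^+ 2) by field.
  lra.
- have [|D D0 HD] := @goursat_local _ f (p +i* q) e e0.
    by apply: hf; move: hp hq; rewrite xE yE.
  exists D => // x y w h [w0 h0 s1 s2 [s3 s4]] hx hy hD; rewrite /P.
  have e1 : x + w - x = w by ring.
  have e2 : y + h - y = h by ring.
  have := HD x (x + w) y (y + h); rewrite e1 e2; apply => //; try lra.
  by move=> z zr; apply: fc; move: z zr; apply: rectS; lra.
Qed.

End Goursat.

(** * Cauchy's theorem with one exceptional point *)

Section Cauchy.
Variable R : realType.
Implicit Types (f g p : R[i] -> R[i]) (z a : R[i]).

Definition irect (x0 x1 y0 y1 : R) : set R[i] :=
  [set z | x0 < complex.Re z < x1 /\ y0 < complex.Im z < y1].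

Lemma irect_rect x0 x1 y0 y1 : irect x0 x1 y0 y1 `<=` rect x0 x1 y0 y1.
Proof. by move=> z [/andP[a b] /andP[c d]]; split; apply/andP; split; exact: ltW. Qed.

Lemma irect_dist x0 x1 y0 y1 a : irect x0 x1 y0 y1 a -> exists2 d : R, 0 < d &
  (forall z, bdr x0 x1 y0 y1 z -> d <= normc (z - a)) /\
  [/\ x0 <= complex.Re a - d, complex.Re a + d <= x1,
      y0 <= complex.Im a - d & complex.Im a + d <= y1].
Proof.
move=> [/andP[a1 a2] /andP[a3 a4]].
pose d := Num.min (Num.min (complex.Re a - x0) (x1 - complex.Re a))
                  (Num.min (complex.Im a - y0) (y1 - complex.Im a)).
have d1 : d <= complex.Re a - x0 by rewrite !ge_min lexx.
have d2 : d <= x1 - complex.Re a by rewrite !ge_min lexx orbT.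
have d3 : d <= complex.Im a - y0 by rewrite !ge_min lexx !orbT.
have d4 : d <= y1 - complex.Im a by rewrite !ge_min lexx !orbT.
exists d; first by rewrite !lt_min; apply/andP; split; apply/andP; split; lra.
split; last by split; lra.
move=> z [_ zE].
have hr : `|complex.Re z - complex.Re a| <= normc (z - a).
  by rewrite -raddfB; exact: Re_le_normc.
have hi : `|complex.Im z - complex.Im a| <= normc (z - a).
  by rewrite -raddfB; exact: Im_le_normc.
case: zE => e.
- apply: le_trans hr; rewrite e distrC; apply: le_trans (ler_norm _); lra.
- apply: le_trans hr; rewrite e; apply: le_trans (ler_norm _); lra.
- apply: le_trans hi; rewrite e distrC; apply: le_trans (ler_norm _); lra.
- apply: le_trans hi; rewrite e; apply: le_trans (ler_norm _); lra.
Qed.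

Lemma irect_near x0 x1 y0 y1 a : irect x0 x1 y0 y1 a -> exists2 d : R, 0 < d &
  forall z, normc (z - a) < d -> irect x0 x1 y0 y1 z.
Proof.
move=> /irect_dist[d d0 [_ [? ? ? ?]]]; exists d => // z zd.
have := le_lt_trans (Re_le_normc (z - a)) zd.
have := le_lt_trans (Im_le_normc (z - a)) zd.
rewrite !raddfB /= !ltr_norml => /andP[? ?] /andP[? ?].
by split; apply/andP; split; lra.
Qed.

(* The rectangle without a small square around [a] is cut into four rectangles. *)
Lemma rint_shrink f a x0 x1 y0 y1 (r : R) :
  hol_on (rect x0 x1 y0 y1 `\ a) f -> 0 < r ->
  x0 <= complex.Re a - r -> complex.Re a + r <= x1 ->
  y0 <= complex.Im a - r -> complex.Im a + r <= y1 ->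
  rint f x0 x1 y0 y1 = rint f (complex.Re a - r) (complex.Re a + r)
                              (complex.Im a - r) (complex.Im a + r).
Proof.
set u := complex.Re a; set v := complex.Im a => hf r0 h1 h2 h3 h4.
have sub (a0 a1 b0 b1 : R) : x0 <= a0 -> a1 <= x1 -> y0 <= b0 -> b1 <= y1 ->
    ((u < a0 \/ a1 < u) \/ (v < b0 \/ b1 < v)) -> hol_on (rect a0 a1 b0 b1) f.
  move=> ? ? ? ? o z zr; apply: hf; split; first by move: z zr; apply: rectS.
  move=> za; move: zr; rewrite za => -[/andP[? ?] /andP[? ?]].
  by move: o; rewrite /u /v => -[[]|[]]; lra.
have bsub (a0 a1 b0 b1 : R) : x0 <= a0 -> a1 <= x1 -> y0 <= b0 -> b1 <= y1 ->
    a0 != u -> a1 != u -> b0 != v -> b1 != v -> ccont_on (bdr a0 a1 b0 b1) f.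
  move=> ? ? ? ? n1 n2 n3 n4 z [zr zb]; apply: hol_ccont; apply: hf; split.
    by move: z zr zb => z zr _; move: z zr; apply: rectS.
  move=> za; move: zb; rewrite za -/u -/v => -[] /eqP; rewrite eq_sym.
  - by rewrite (negbTE n1). - by rewrite (negbTE n2).
  - by rewrite (negbTE n3). - by rewrite (negbTE n4).
have neq (s t : R) : s < t \/ t < s -> s != t by move=> [/lt_eqF ->|/gt_eqF ->].
rewrite (@rint_splitx _ f (u - r)); last 3 first.
+ by apply/andP; split; lra.
+ by lra.
+ by apply: bsub; try apply: neq; lra.
rewrite goursat ?add0r; last 3 first.
+ by lra.
+ by lra.
+ by apply: sub; lra.
rewrite (@rint_splitx _ f (u + r)); last 3 first.
+ by apply/andP; split; lra.
+ by lra.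
+ by apply: bsub; try apply: neq; lra.
rewrite [X in _ + X]goursat ?addr0; last 3 first.
+ by lra.
+ by lra.
+ by apply: sub; lra.
rewrite (@rint_splity _ f (v - r)); last 3 first.
+ by lra.
+ by apply/andP; split; lra.
+ by apply: bsub; try apply: neq; lra.
rewrite goursat ?add0r; last 3 first.
+ by lra.
+ by lra.
+ by apply: sub; lra.
rewrite (@rint_splity _ f (v + r)); last 3 first.
+ by lra.
+ by apply/andP; split; lra.
+ by apply: bsub; try apply: neq; lra.
rewrite [X in _ + X]goursat ?addr0; last 3 first.
+ by lra.
+ by lra.
+ by apply: sub; lra.
by [].
Qed.

(** The contour shrinks to a square of half-side [r] around [a], whose length tends to 0 while [f]
    stays bounded. *)
Lemma goursat_bounded f a x0 x1 y0 y1 (M r0 : R) : irect x0 x1 y0 y1 a ->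
  hol_on (rect x0 x1 y0 y1 `\ a) f -> 0 < r0 ->
  (forall z, normc (z - a) < r0 -> z != a -> normc (f z) <= M) ->
  rint f x0 x1 y0 y1 = 0.
Proof.
move=> ai hf r00 HM; have [d d0 [_ [d1 d2 d3 d4]]] := irect_dist ai.
set u := complex.Re a in d1 d2; set v := complex.Im a in d3 d4.
apply: normc_le_eps => e e0.
pose M' := `|M| + 1.
have M0 : 0 < M' by rewrite ltr_wpDl.
(* On the small square [rint_norm] gives [4 * M' * (2 * r + 2 * r)], whence the 16. *)
pose r := Num.min d (Num.min (r0 / 3) (e / (16 * M'))).
have r'0 : 0 < r by rewrite !lt_min d0 !divr_gt0 // mulr_gt0.
have rd : r <= d by rewrite ge_min lexx.
have rr0 : r <= r0 / 3 by rewrite !ge_min lexx orbT.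
have re : r <= e / (16 * M') by rewrite !ge_min lexx !orbT.
rewrite (@rint_shrink f a _ _ _ _ r) //; try by rewrite -/u -/v; lra.
rewrite -/u -/v.
have bz z : bdr (u - r) (u + r) (v - r) (v + r) z -> normc (z - a) < r0 /\ z != a.
  move=> [[/andP[z1 z2] /andP[z3 z4]] zb]; split.
    apply: (le_lt_trans (normc_le_ReIm _)); rewrite !raddfB /= -/u -/v.
    have : `|complex.Re z - u| <= r by rewrite ler_norml; apply/andP; split; lra.
    have : `|complex.Im z - v| <= r by rewrite ler_norml; apply/andP; split; lra.
    lra.
  by apply/eqP => za; move: zb; rewrite za -/u -/v => -[]; lra.
have fc : ccont_on (bdr (u - r) (u + r) (v - r) (v + r)) f.
  move=> z zb; have [_ za] := bz z zb; apply: hol_ccont; apply: hf; split; last exact/eqP.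
  by move: z zb {za} => z /bdr_rect; apply: rectS; lra.
have := @rint_norm _ _ _ _ _ _ _ f M' fc.
move=> /(_ _ _ _)/le_trans -> //; try lra.
  by move=> z /bz[za zna]; apply: (le_trans (HM _ za zna)); rewrite /M'; have := ler_norm M; lra.
have : r * (16 * M') <= e by rewrite -ler_pdivlMr // mulr_gt0.
lra.
Qed.

End Cauchy.

(** * Cauchy's formula, differentiation under the integral, maximum principle *)

Section CauchyFormula.
Variable R : realType.
Implicit Types (f g p : R[i] -> R[i]) (z a b : R[i]).
Local Notation mu := (@lebesgue_measure R).

Lemma pcont_normc (g : R -> R[i]) t : pcont g t -> {for t, continuous (fun x => normc (g x))}.
Proof.
move=> gt; apply/cvgrPdist_le => /= e e0; have [D D0 H] := gt e e0.
exists D => //= x /=; rewrite distrC => /H; rewrite [t + _]addrC subrK => h.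
apply: le_trans h; rewrite ler_norml; apply/andP; split.
- by rewrite lerBrDl; have := ler_normc_tri (g x) (g t); lra.
- by rewrite lerBlDl normcBC; have := ler_normc_tri (g t) (g x); lra.
Qed.

Lemma pcont_bounded (g : R -> R[i]) s t : s <= t -> pcont_on g s t ->
  exists M : R, forall x, s <= x <= t -> normc (g x) <= M.
Proof.
move=> st H; have [|c _ Hc] := @EVT_max R (fun x => normc (g x)) _ _ st.
  by apply: within_for => x /H /pcont_normc.
by exists (normc (g c)) => x xst; apply: Hc; rewrite in_itv.
Qed.

Lemma archi_ex (x : R) : exists n : nat, x < n%:R.
Proof.
by exists (Num.Def.archi_bound `|x|); apply: (le_lt_trans (ler_norm x)); exact: archi_boundP.
Qed.

Section Rect.
Variables (x0 x1 y0 y1 : R).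
Hypotheses (x01 : x0 < x1) (y01 : y0 < y1).
Local Notation B := (bdr x0 x1 y0 y1).
Local Notation I := (irect x0 x1 y0 y1).
Local Notation K := (rect x0 x1 y0 y1).
Let x01' := ltW x01.
Let y01' := ltW y01.

Lemma bdr_bounded f : ccont_on B f -> exists2 M : R, 0 < M & forall z, B z -> normc (f z) <= M.
Proof.
move=> hf.
have [M1 H1] := pcont_bounded x01' (pc_bot y01' hf).
have [M2 H2] := pcont_bounded x01' (pc_top y01' hf).
have [M3 H3] := pcont_bounded y01' (pc_left x01' hf).
have [M4 H4] := pcont_bounded y01' (pc_right x01' hf).
exists (1 + `|M1| + `|M2| + `|M3| + `|M4|).
  have := normr_ge0 M1; have := normr_ge0 M2; have := normr_ge0 M3; have := normr_ge0 M4; lra.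
move=> [x y] [[/= hx hy] zE].
have := normr_ge0 M1; have := normr_ge0 M2; have := normr_ge0 M3; have := normr_ge0 M4.
have := ler_norm M1; have := ler_norm M2; have := ler_norm M3; have := ler_norm M4.
case: zE => /= e.
- by rewrite e; have := H3 _ hy; lra.
- by rewrite e; have := H4 _ hy; lra.
- by rewrite e; have := H1 _ hx; lra.
- by rewrite e; have := H2 _ hx; lra.
Qed.

(** The constant 2 pi i of Cauchy's formula. Its value is never computed: it suffices that it is not
    0 and depends holomorphically on [a]. *)
Definition cconst a := rint (fun z => (z - a)^-1) x0 x1 y0 y1.

Lemma hol_subC a z : hol (fun w => w - a) z.
Proof. by apply: holB; [exact: hol_id|exact: hol_cst]. Qed.

Lemma bdr_neq a z : I a -> B z -> z - a != 0.
Proof.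
move=> /irect_dist[d d0 [H _]] /H dz; rewrite -normc_eq0 gt_eqF //.
exact: lt_le_trans dz.
Qed.

Lemma hol_kernel a n z : z - a != 0 -> hol (fun w => ((w - a) ^+ n)^-1) z.
Proof. by move=> za; apply: holV; [rewrite expf_neq0|apply: holX; exact: hol_subC]. Qed.

Lemma ccont_kernel p a n : I a -> ccont_on B p ->
  ccont_on B (fun z => p z / (z - a) ^+ n).
Proof.
move=> ai hp z zB; apply: ccontM; first exact: hp.
by apply: hol_ccont; apply: hol_kernel; exact: bdr_neq zB.
Qed.

(** All four sides contribute to the imaginary part with the same sign, and the bottom side
    strictly. *)
Lemma cconst_neq0 a : I a -> cconst a != 0.
Proof.
move=> ai; have [d d0 [dB _]] := irect_dist ai.
have [/andP[a1 a2] /andP[a3 a4]] := ai.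
set u := complex.Re a in a1 a2; set v := complex.Im a in a3 a4.
have hc : ccont_on B (fun z => (z - a)^-1).
  by move=> z zB; apply: hol_ccont; apply: holV; [exact: bdr_neq zB|exact: hol_subC].
have bb : 0 < normc (x0 +i* y0 - a) by apply: (lt_le_trans d0); apply: dB; apply: bdr_bot; lra.
have ImV z : complex.Im z^-1 = - complex.Im z / normc z ^+ 2.
  by rewrite normc_sqr; case: z => s t; rewrite /= mulNr.
have ReV z : complex.Re z^-1 = complex.Re z / normc z ^+ 2.
  by rewrite normc_sqr; case: z => s t.
have [M M0 HM] : exists2 M : R, 0 < M & forall z, B z -> normc (z - a) <= M.
  by apply: bdr_bounded => z _; apply: hol_ccont; exact: hol_subC.
have i1 : (v - y0) / M ^+ 2 * (x1 - x0) <= \int[mu]_(x in `[x0, x1]) complex.Im ((x +i* y0 - a)^-1).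
  rewrite -Rint_itv_cst //; apply: le_Rintegral => //.
  - by apply: for_integrable => t _; exact: cvg_cst.
  - exact: (pcont_intIm (pc_bot y01' hc)).
  move=> x /=; rewrite in_itv /= => hx.
  rewrite ImV raddfB /= -/v opprB.
  have zB : B (x +i* y0) by exact: bdr_bot.
  have n0 : 0 < normc (x +i* y0 - a) by apply: lt_le_trans (dB _ zB).
  rewrite ler_pM2l ?subr_gt0 // lef_pV2 ?posrE ?exprn_gt0 //.
  by rewrite lerXn2r ?nnegrE ?HM // ltW.
have i2 : \int[mu]_(x in `[x0, x1]) complex.Im ((x +i* y1 - a)^-1) <= 0.
  rewrite -(mul0r (x1 - x0)) -Rint_itv_cst //; apply: le_Rintegral => //.
  - exact: (pcont_intIm (pc_top y01' hc)).
  - by apply: for_integrable => t _; exact: cvg_cst.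
  move=> x /=; rewrite in_itv /= => hx.
  rewrite ImV raddfB /= -/v; rewrite mulr_le0_ge0 ?invr_ge0 ?exprn_ge0 ?normc_ge0 //; lra.
have i3 : 0 <= \int[mu]_(y in `[y0, y1]) complex.Re ((x1 +i* y - a)^-1).
  apply: Rintegral_ge0 => y _; rewrite ReV raddfB /= -/u divr_ge0 ?exprn_ge0 ?normc_ge0 //; lra.
have i4 : \int[mu]_(y in `[y0, y1]) complex.Re ((x0 +i* y - a)^-1) <= 0.
  rewrite -(mul0r (y1 - y0)) -Rint_itv_cst //; apply: le_Rintegral => //.
  - exact: (pcont_intRe (pc_left x01' hc)).
  - by apply: for_integrable => t _; exact: cvg_cst.
  move=> x /=; rewrite in_itv /= => hx.
  rewrite ReV raddfB /= -/u; rewrite mulr_le0_ge0 ?invr_ge0 ?exprn_ge0 ?normc_ge0 //; lra.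
have pos : 0 < (v - y0) / M ^+ 2 * (x1 - x0).
  by rewrite mulr_gt0 ?divr_gt0 ?exprn_gt0 // subr_gt0.
suff : 0 < complex.Im (cconst a) by apply: contraTneq => ->; rewrite ltxx.
have -> : complex.Im (cconst a) =
  \int[mu]_(x in `[x0, x1]) complex.Im ((x +i* y0 - a)^-1) -
  \int[mu]_(x in `[x0, x1]) complex.Im ((x +i* y1 - a)^-1) +
  (\int[mu]_(y in `[y0, y1]) complex.Re ((x1 +i* y - a)^-1) -
   \int[mu]_(y in `[y0, y1]) complex.Re ((x0 +i* y - a)^-1)).
  by rewrite /cconst /rint /cint /= !mul0r add0r mul1r.
apply: ltr_wpDr; first by rewrite subr_ge0; apply: le_trans i4 i3.
by rewrite subr_gt0; apply: le_lt_trans i2 _; apply: lt_le_trans pos i1.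
Qed.

(** Subtracting [f a] from the numerator leaves a difference quotient, which is bounded near [a] and
    therefore has integral 0. *)
Theorem cauchy_formula f a : I a -> hol_on K f ->
  rint (fun z => f z / (z - a)) x0 x1 y0 y1 = f a * cconst a.
Proof.
move=> ai hf; have aK := irect_rect ai.
have fB : ccont_on B f by move=> z /bdr_rect /hf /hol_ccont.
have kB : ccont_on B (fun z => (z - a)^-1).
  by move=> z zB; apply: hol_ccont; apply: holV; [exact: bdr_neq zB|exact: hol_subC].
pose g z := (f z - f a) / (z - a).
have gB : ccont_on B g.
  move=> z zB; apply: ccontM; last exact: kB.
  by apply: ccontD; [exact: fB|apply: hol_ccont; exact: hol_cst].
have -> : rint (fun z => f z / (z - a)) x0 x1 y0 y1 =
   rint (fun z => g z + f a * (z - a)^-1) x0 x1 y0 y1.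
  by apply: eq_rint => // z zB; rewrite /g; ring.
rewrite rintD //; last by move=> z zB; apply: ccontM; [apply: hol_ccont; exact: hol_cst|exact: kB].
rewrite rintZ // -/(cconst a).
suff -> : rint g x0 x1 y0 y1 = 0 by rewrite add0r.
have [d fd] := hf a aK; have [r r0 H] := fd 1 ltr01.
apply: (@goursat_bounded _ _ a _ _ _ _ (normc d + 1) r) => //.
  move=> z [zK za]; apply: hol_div.
  - by rewrite subr_eq0; apply/eqP.
  - by apply: holB; [exact: hf|exact: hol_cst].
  - exact: hol_subC.
move=> z zr za; have := H (z - a) zr; rewrite [a + _]addrC subrK mul1r => h.
rewrite /g normcM normcV ler_pdivrMr ?normc_gt0 ?subr_eq0 // mulrDl mul1r -normcM.
by apply: (le_trans (ler_normc_tri _ (d * (z - a)))); rewrite lerD2l.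
Qed.

Lemma rintB f g : ccont_on B f -> ccont_on B g ->
  rint (fun z => f z - g z) x0 x1 y0 y1 = rint f x0 x1 y0 y1 - rint g x0 x1 y0 y1.
Proof.
move=> hf hg.
have -> : rint (fun z => f z - g z) x0 x1 y0 y1 = rint (fun z => f z + (-1) * g z) x0 x1 y0 y1.
  by apply: eq_rint => // z _; rewrite mulN1r.
rewrite rintD //; last by move=> z zB; apply: ccontM; [apply: hol_ccont; exact: hol_cst|exact: hg].
by rewrite rintZ // mulN1r.
Qed.

(** The second-order remainder of the kernel is at most [C * normc h ^+ 2], uniformly on the
    boundary. The case [n = 1] yields a formula for the derivative, [n = 2] the differentiability of
    that derivative. *)
Lemma cauchy_kernel_diff p a n c : ccont_on B p -> I a -> (0 < n <= 2)%N -> c = n%:R ->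
  cdiff (fun b => rint (fun z => p z / (z - b) ^+ n) x0 x1 y0 y1) a
    (c * rint (fun z => p z / (z - a) ^+ n.+1) x0 x1 y0 y1).
Proof.
move=> hp ai n12 cE e e0; have [d d0 [dB _]] := irect_dist ai.
have [r r0 rI] := irect_near ai.
have [M M0 HM] := bdr_bounded hp.
pose L := x1 - x0 + (y1 - y0).
have L0 : 0 < L by rewrite addr_gt0 // subr_gt0.
(* On the boundary [normc (z - a) >= d] and [normc (z - (a + h)) >= d / 2]; the second summand
   covers [n = 1], the first [n = 2]. *)
pose C := 16 / d ^+ 4 + 2 / d ^+ 3.
have C0 : 0 < C by rewrite addr_gt0 // divr_gt0 // exprn_gt0.
pose E := 4 * (M * C) * L.
have E0 : 0 < E by rewrite !mulr_gt0.
exists (Num.min (Num.min r (d / 2)) (e / E)) => [|h].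
  by rewrite !lt_min r0 !divr_gt0.
rewrite !lt_min => /andP[/andP[hr hd] he].
have ahI : I (a + h) by apply: rI; rewrite addrC addKr.
have bound z : B z -> normc (((z - (a + h)) ^+ n)^-1 - ((z - a) ^+ n)^-1 - c * h / (z - a) ^+ n.+1) <= C * normc h ^+ 2.
  move=> zB; have dz := dB z zB.
  have z0 := bdr_neq ai zB; have z1 := bdr_neq ahI zB.
  set x := z - a in dz z0 *.
  have xE : z - (a + h) = x - h by rewrite /x; ring.
  rewrite xE in z1 *.
  have xh : d / 2 <= normc (x - h).
    by have := ler_normc_tri x (x - h); have -> : x - (x - h) = h by [ring]; lra.
  have nx0 : 0 < normc x by rewrite normc_gt0.
  have nh0 := normc_ge0 h.
  have invle (s t : R) : 0 < s -> s <= t -> t^-1 <= s^-1.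
    by move=> s0 st; rewrite lef_pV2 // posrE // (lt_le_trans s0).
  have d2 : 0 < d / 2 by rewrite divr_gt0.
  have n1 : (normc (x - h))^-1 <= 2 / d by rewrite -[2 / d]invrK invf_div; exact: invle.
  have n2 : (normc x)^-1 <= d^-1 by exact: invle.
  have ie0 (s : R) k : 0 <= s -> 0 <= s^-1 ^+ k by move=> s0; rewrite exprn_ge0 // invr_ge0.
  have p1 k : (normc x)^-1 ^+ k <= d^-1 ^+ k by rewrite lerXn2r ?nnegrE ?invr_ge0 ?normc_ge0 // ltW.
  have p2 k : (normc (x - h))^-1 ^+ k <= (2 / d) ^+ k.
    by rewrite lerXn2r ?nnegrE ?invr_ge0 ?normc_ge0 // divr_ge0 // ltW.
  have [n1'|n2'] : (n = 1 \/ n = 2)%N by move: n12; case: (n) => [|[|[|]]] //; [left|right].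
  - have -> : ((x - h) ^+ n)^-1 - (x ^+ n)^-1 - c * h / x ^+ n.+1 = h ^+ 2 * (x^-1 ^+ 2 * (x - h)^-1).
      by rewrite cE n1'; field; rewrite z0 z1.
    rewrite (normcM (h ^+ 2)) (normcM (x^-1 ^+ 2)) (normcX h) (normcX x^-1) !normcV mulrC.
    rewrite ler_wpM2r ?exprn_ge0 ?normc_ge0 //.
    apply: (@le_trans _ _ (d^-1 ^+ 2 * (2 / d))).
      by apply: ler_pM => //; rewrite ?ie0 ?invr_ge0 ?normc_ge0.
    have -> : d^-1 ^+ 2 * (2 / d) = 2 / d ^+ 3 by field; rewrite gt_eqF.
    by rewrite lerDr divr_ge0 // exprn_ge0 // ltW.
  - have -> : ((x - h) ^+ n)^-1 - (x ^+ n)^-1 - c * h / x ^+ n.+1 =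
       h ^+ 2 * ((x + 2 * (x - h)) * (x^-1 ^+ 3 * (x - h)^-1 ^+ 2)).
      by rewrite cE n2'; field; rewrite z0 z1.
    rewrite (normcM (h ^+ 2)) (normcX h) mulrC ler_wpM2r ?exprn_ge0 ?normc_ge0 //.
    have -> : (x + 2 * (x - h)) * (x^-1 ^+ 3 * (x - h)^-1 ^+ 2) =
      x^-1 ^+ 2 * (x - h)^-1 ^+ 2 + 2 * (x^-1 ^+ 3 * (x - h)^-1).
      by field; rewrite z0 z1.
    apply: (le_trans (le_normcD _ _)).
    rewrite (normcM 2) (normcM (x^-1 ^+ 2)) (normcM (x^-1 ^+ 3)) !(normcX x^-1) (normcX (x - h)^-1) !normcV.
    have -> : normc (2 : R[i]) = 2.
      by rewrite -[2 in LHS](rmorph_nat (real_complex R) 2) normc_real ger0_norm.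
    have q1 : (normc x)^-1 ^+ 2 * (normc (x - h))^-1 ^+ 2 <= d^-1 ^+ 2 * (2 / d) ^+ 2.
      by apply: ler_pM => //; rewrite ?ie0 ?invr_ge0 ?normc_ge0.
    have q2 : (normc x)^-1 ^+ 3 * (normc (x - h))^-1 <= d^-1 ^+ 3 * (2 / d).
      by apply: ler_pM => //; rewrite ?ie0 ?invr_ge0 ?normc_ge0.
    have e1 : d^-1 ^+ 2 * (2 / d) ^+ 2 = 4 / d ^+ 4 by field; rewrite gt_eqF.
    have e2 : d^-1 ^+ 3 * (2 / d) = 2 / d ^+ 4 by field; rewrite gt_eqF.
    rewrite e1 in q1; rewrite e2 in q2.
    have d40 : 0 <= (d ^+ 4)^-1 by rewrite invr_ge0 exprn_ge0 // ltW.
    have d30 : 0 <= 2 / d ^+ 3 by rewrite divr_ge0 // exprn_ge0 // ltW.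
    rewrite /C; lra.
have k1 b k : I b -> ccont_on B (fun z => p z / (z - b) ^+ k) by move=> ?; exact: ccont_kernel.
have k2 : ccont_on B (fun z => c * h * (p z / (z - a) ^+ n.+1)).
  by move=> z zB; apply: ccontM; [apply: hol_ccont; exact: hol_cst|exact: k1].
have -> : c * rint (fun z => p z / (z - a) ^+ n.+1) x0 x1 y0 y1 * h =
  rint (fun z => c * h * (p z / (z - a) ^+ n.+1)) x0 x1 y0 y1.
  by rewrite rintZ //; [ring|exact: k1].
have k3 : ccont_on B (fun z => p z / (z - (a + h)) ^+ n - p z / (z - a) ^+ n).
  move=> z zB; apply: (@ccont_ext _ (fun z => p z / (z - (a + h)) ^+ n + (-1) * (p z / (z - a) ^+ n)) _ _ 1) => //.
    by move=> w _; rewrite mulN1r.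
  by apply: ccontD; [exact: k1|apply: ccontM; [apply: hol_ccont; exact: hol_cst|exact: k1]].
rewrite -rintB; [|exact: k1|exact: k1].
rewrite -rintB //.
have k4 : ccont_on B (fun z => p z / (z - (a + h)) ^+ n - p z / (z - a) ^+ n - c * h * (p z / (z - a) ^+ n.+1)).
  move=> z zB; apply: (@ccont_ext _ (fun z => (p z / (z - (a + h)) ^+ n - p z / (z - a) ^+ n) + (-1) * (c * h * (p z / (z - a) ^+ n.+1))) _ _ 1) => //.
    by move=> w _; rewrite mulN1r.
  by apply: ccontD; [exact: k3|apply: ccontM; [apply: hol_ccont; exact: hol_cst|exact: k2]].
apply: (le_trans (@rint_norm _ _ _ _ _ x01' y01' _ (M * (C * normc h ^+ 2)) k4 _)).
  move=> z zB.
  have -> : p z / (z - (a + h)) ^+ n - p z / (z - a) ^+ n - c * h * (p z / (z - a) ^+ n.+1) =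
    p z * (((z - (a + h)) ^+ n)^-1 - ((z - a) ^+ n)^-1 - c * h / (z - a) ^+ n.+1) by ring.
  by rewrite normcM; apply: ler_pM; rewrite ?normc_ge0 ?HM ?bound.
have -> : 4 * (M * (C * normc h ^+ 2)) * (x1 - x0 + (y1 - y0)) = (normc h * E) * normc h by rewrite /E /L; ring.
by rewrite ler_wpM2r ?normc_ge0 // -ler_pdivlMr // ltW.
Qed.

Lemma hol_cauchy_integral p a n : ccont_on B p -> I a -> (0 < n <= 2)%N ->
  hol (fun b => rint (fun z => p z / (z - b) ^+ n) x0 x1 y0 y1) a.
Proof. by move=> hp ai hn; eexists; exact: (cauchy_kernel_diff hp ai hn erefl). Qed.

Lemma hol_cconst a : I a -> hol cconst a.
Proof.
move=> ai; have c1 : ccont_on B (fun=> 1 : R[i]).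
  by move=> z _; apply: hol_ccont; exact: hol_cst.
apply: hol_ext1 (hol_cauchy_integral c1 ai (isT : (0 < 1 <= 2)%N)) => b.
by apply: eq_rint => // z _; rewrite expr1 mul1r.
Qed.

(** Landau's trick: Cauchy's formula for the powers of [f] loses a constant independent of the
    power, which disappears when the power tends to infinity. *)
Lemma max_principle f M : hol_on K f -> (forall z, B z -> normc (f z) <= M) ->
  forall a, K a -> normc (f a) <= M.
Proof.
move=> hf HM a aK.
have [ai|nai] := pselect (I a); last first.
  apply: HM; split => //; move: aK nai => [/andP[h1 h2] /andP[h3 h4]] nai.
  have [e1|n1] := eqVneq (complex.Re a) x0; first exact: Or41.
  have [e2|n2] := eqVneq (complex.Re a) x1; first exact: Or42.
  have [e3|n3] := eqVneq (complex.Im a) y0; first exact: Or43.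
  have [e4|n4] := eqVneq (complex.Im a) y1; first exact: Or44.
  exfalso; apply: nai; split; apply/andP; split; rewrite lt_neqAle ?h1 ?h2 ?h3 ?h4 andbT //.
  - by rewrite eq_sym. - by rewrite eq_sym.
have [d d0 [dB _]] := irect_dist ai.
rewrite leNgt; apply/negP => lM.
have M0 : 0 <= M.
  apply: le_trans (normc_ge0 (f (x0 +i* y0))) (HM _ _); apply: bdr_bot => //; rewrite lexx /=; exact: x01'.
(* Unlike [M], the midpoint [N] is positive, so one may divide by it. *)
pose N := (M + normc (f a)) / 2.
have N0 : 0 < N by rewrite /N; lra.
have MN : M <= N by rewrite /N; lra.
have Nf : N < normc (f a) by rewrite /N; lra.
pose L := x1 - x0 + (y1 - y0).
have L0 : 0 < L by rewrite addr_gt0 // subr_gt0.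
pose q := normc (f a) / N.
have q1 : 1 < q by rewrite ltr_pdivlMr // mul1r.
have c0 : 0 < normc (cconst a) by rewrite normc_gt0; exact: cconst_neq0.
pose E := 4 * d^-1 * L / normc (cconst a).
have key n : q ^+ n <= E.
  have hfn : hol_on K (fun z => f z ^+ n) by move=> z /hf; exact: holX.
  have gB : ccont_on B (fun z => f z ^+ n / (z - a)).
    move=> z zB; apply: ccontM; first by apply: hol_ccont; apply: hfn; exact: bdr_rect.
    by apply: hol_ccont; apply: holV; [exact: bdr_neq zB|exact: hol_subC].
  have := @rint_norm _ _ _ _ _ x01' y01' _ (N ^+ n / d) gB.
  rewrite (cauchy_formula ai hfn) normcM normcX => h.
  rewrite /q expr_div_n ler_pdivrMr ?exprn_gt0 // -(ler_pM2r c0).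
  apply: le_trans (h _) _; last first.
    by rewrite -/L /E le_eqVlt; apply/orP; left; apply/eqP; field; rewrite !gt_eqF.
  move=> z zB; rewrite normcM normcX normcV; apply: ler_pM.
  - by rewrite exprn_ge0 // normc_ge0. - by rewrite invr_ge0 normc_ge0.
  - by rewrite lerXn2r ?nnegrE ?normc_ge0 ?(ltW N0) //; apply: le_trans MN; exact: HM.
  - by rewrite lef_pV2 ?posrE ?dB // (lt_le_trans d0) // dB.
have bern n : 1 + n%:R * (q - 1) <= q ^+ n.
  elim: n => [|n ih]; first by rewrite mul0r addr0 expr0.
  rewrite exprS -natr1; apply: (@le_trans _ _ (q * (1 + n%:R * (q - 1)))).
    have : 0 <= n%:R * ((q - 1) * (q - 1)) by rewrite mulr_ge0 // -expr2 sqr_ge0.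
    lra.
  by rewrite ler_pM2l // (lt_trans ltr01).
have q10 : 0 < q - 1 by rewrite subr_gt0.
have E0 : 0 <= E by apply: le_trans (key 0%N); rewrite expr0.
have [m hm] := archi_ex (E / (q - 1)).
move: hm; rewrite ltr_pdivrMr // => hm.
have := le_trans (bern m) (key m); rewrite leNgt => /negP; apply.
by rewrite (lt_le_trans hm) // lerDr.
Qed.

End Rect.

End CauchyFormula.

(** * Derivatives, removable singularities, simple poles and Liouville's theorem *)

Section LocalTheory.
Variable R : realType.
Implicit Types (f g p q k : R[i] -> R[i]) (z a b c : R[i]).

(** The derivative by choice, with default 0; [cdiff_uniq] makes the choice irrelevant where a
    derivative exists. *)
Definition cderiv f z : R[i] := xget 0 [set d | cdiff f z d].

Lemma derivP f z : hol f z -> cdiff f z (cderiv f z).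
Proof. by move=> [d fd]; rewrite /cderiv; case: xgetP => [y _ //|/(_ d)]. Qed.

Lemma derivE f z d : cdiff f z d -> cderiv f z = d.
Proof. by move=> fd; apply: (@cdiff_uniq _ f z) => //; apply: derivP; exists d. Qed.

Definition square c (r : R) := rect (complex.Re c - r) (complex.Re c + r) (complex.Im c - r) (complex.Im c + r).

Lemma square_normc c r z : square c r z -> normc (z - c) <= 2 * r.
Proof.
move=> [/andP[z1 z2] /andP[z3 z4]]; apply: (le_trans (normc_le_ReIm _)).
rewrite !raddfB /=.
have : `|complex.Re z - complex.Re c| <= r by rewrite ler_norml; apply/andP; split; lra.
have : `|complex.Im z - complex.Im c| <= r by rewrite ler_norml; apply/andP; split; lra.
lra.
Qed.

Lemma normc_square c r z : normc (z - c) <= r -> square c r z.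
Proof.
move=> h; have := le_trans (Re_le_normc _) h; have := le_trans (Im_le_normc _) h.
rewrite !raddfB /= !ler_norml => /andP[? ?] /andP[? ?].
by split; apply/andP; split; lra.
Qed.

Lemma normc_isquare c r z : normc (z - c) < r ->
  irect (complex.Re c - r) (complex.Re c + r) (complex.Im c - r) (complex.Im c + r) z.
Proof.
move=> h; have := le_lt_trans (Re_le_normc _) h; have := le_lt_trans (Im_le_normc _) h.
rewrite !raddfB /= !ltr_norml => /andP[? ?] /andP[? ?].
by split; apply/andP; split; lra.
Qed.

Lemma bdr_square_normc c r z : 0 <= r ->
  bdr (complex.Re c - r) (complex.Re c + r) (complex.Im c - r) (complex.Im c + r) z ->
  r <= normc (z - c).
Proof.
move=> r0 [_ zb].
have hr := Re_le_normc (z - c); have hi := Im_le_normc (z - c).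
rewrite !raddfB /= in hr hi.
case: zb => e.
- apply: le_trans hr; rewrite e distrC; apply: le_trans (ler_norm _); lra.
- apply: le_trans hr; rewrite e; apply: le_trans (ler_norm _); lra.
- apply: le_trans hi; rewrite e distrC; apply: le_trans (ler_norm _); lra.
- apply: le_trans hi; rewrite e; apply: le_trans (ler_norm _); lra.
Qed.

(** The square of half-side [r] about [c] contains the disc of radius [r], and its boundary lies in
    the annulus; this carries the maximum principle from rectangles to discs. *)
Lemma max_annulus f c (r M : R) : 0 < r ->
  (forall z, normc (z - c) <= 2 * r -> hol f z) ->
  (forall z, r <= normc (z - c) -> normc (z - c) <= 2 * r -> normc (f z) <= M) ->
  forall z, normc (z - c) <= r -> normc (f z) <= M.
Proof.
move=> r0 hf HM z zr.
apply: (@max_principle _ (complex.Re c - r) (complex.Re c + r) (complex.Im c - r) (complex.Im c + r)).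
- by lra. - by lra.
- by move=> w /square_normc; exact: hf.
- move=> w wB; apply: HM; first by apply: bdr_square_normc wB; exact: ltW.
  by apply: square_normc; exact: bdr_rect.
- exact: normc_square.
Qed.

Section Local.
Variables (f : R[i] -> R[i]) (c : R[i]) (r : R).
Hypotheses (r0 : 0 < r) (hf : forall z, normc (z - c) < r -> hol f z).
(** The square of half-side [s] lies in the disc of radius [2 * s], hence inside that of radius
    [r]. *)
Let s := r / 3.
Let s0 : 0 < s. Proof. by rewrite divr_gt0. Qed.
Let x0 := complex.Re c - s.
Let x1 := complex.Re c + s.
Let y0 := complex.Im c - s.
Let y1 := complex.Im c + s.
Let x01 : x0 < x1. Proof. by rewrite /x0 /x1; have := s0; lra. Qed.
Let y01 : y0 < y1. Proof. by rewrite /y0 /y1; have := s0; lra. Qed.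
Let hK : hol_on (rect x0 x1 y0 y1) f.
Proof.
by move=> z /square_normc h; apply: hf; apply: (le_lt_trans h); rewrite /s; have := r0; lra.
Qed.
Let cI : irect x0 x1 y0 y1 c.
Proof. by apply: normc_isquare; rewrite subrr normc0. Qed.
Let near_I z : normc (z - c) < s -> irect x0 x1 y0 y1 z.
Proof. exact: normc_isquare. Qed.
Let fB : ccont_on (bdr x0 x1 y0 y1) f.
Proof. by move=> z /bdr_rect /hK /hol_ccont. Qed.

(** By Cauchy's formula [f] is a quotient of two Cauchy integrals; its derivative by the quotient
    rule consists of such integrals again. *)
Lemma hol_deriv : hol (cderiv f) c.
Proof.
pose Phi n b := rint (fun z => f z / (z - b) ^+ n) x0 x1 y0 y1.
pose CC n b := rint (fun z => 1 / (z - b) ^+ n) x0 x1 y0 y1.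
have c1 : ccont_on (bdr x0 x1 y0 y1) (fun=> 1 : R[i]).
  by move=> z _; apply: hol_ccont; exact: hol_cst.
have CCE b : CC 1%N b = cconst x0 x1 y0 y1 b.
  by rewrite /CC /cconst; apply: (@eq_rint R x0 x1 y0 y1 (ltW x01) (ltW y01)) => z _; rewrite expr1 mul1r.
have CC0 b : irect x0 x1 y0 y1 b -> CC 1%N b != 0 by move=> bI; rewrite CCE cconst_neq0.
have fE b : irect x0 x1 y0 y1 b -> f b = Phi 1%N b * (CC 1%N b)^-1.
  move=> bI; apply: (mulIf (CC0 b bI)); rewrite divfK ?CC0 // CCE -cauchy_formula //.
have dE b : normc (b - c) < s -> cderiv f b =
    (1 * Phi 2%N b) * (CC 1%N b)^-1 + Phi 1%N b * (- ((CC 1%N b) ^+ 2)^-1 * (1 * CC 2%N b)).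
  move=> bs; have bI := near_I bs; apply: derivE.
  have d1 := cauchy_kernel_diff x01 y01 fB bI (isT : (0 < 1 <= 2)%N) erefl.
  have d2 := cauchy_kernel_diff x01 y01 c1 bI (isT : (0 < 1 <= 2)%N) erefl.
  have d3 := cdiffM d1 (cdiff_comp d2 (cdiff_inv (CC0 b bI))).
  have [d d0 dI] := irect_near bI.
  apply: (cdiff_ext d0 _ d3) => w wd.
  by rewrite -/(Phi 1%N w) -/(CC 1%N w) -fE //; exact: dI.
apply: (@hol_ext _ _ _ _ s s0) => [w /dE -> //|].
apply: holD.
- apply: holM.
    by apply: holM; [exact: hol_cst|exact: hol_cauchy_integral].
  by apply: holV; [exact: CC0|exact: hol_cauchy_integral].
- apply: holM; first exact: hol_cauchy_integral.
  apply: holM; last by apply: holM; [exact: hol_cst|exact: hol_cauchy_integral].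
  apply: holN; apply: holV; first by rewrite expf_neq0 // CC0.
  by apply: holX; exact: hol_cauchy_integral.
Qed.

(** The Cauchy integral of [f z / (z - c)] makes sense at [c] too. Subtracting Cauchy's formula at
    [c], where [f c = 0], from that at [b] exhibits [f b] as [(b - c) * G b]. *)
Lemma hol_divide : f c = 0 ->
  hol (fun z => if z == c then cderiv f c else f z / (z - c)) c.
Proof.
move=> fc0.
pose p z := f z / (z - c).
have pB : ccont_on (bdr x0 x1 y0 y1) p.
  move=> z zB; apply: ccontM; first exact: fB.
  by apply: hol_ccont; apply: holV; [exact: bdr_neq zB|exact: hol_subC].
pose G b := rint (fun z => p z / (z - b)) x0 x1 y0 y1 / cconst x0 x1 y0 y1 b.
have hG : hol G c.
  apply: hol_div; [exact: cconst_neq0| |exact: hol_cconst].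
  apply: hol_ext1 (hol_cauchy_integral x01 y01 pB cI (isT : (0 < 1 <= 2)%N)) => b.
  by rewrite ?/Phi; apply: (@eq_rint R x0 x1 y0 y1 (ltW x01) (ltW y01)) => z _; rewrite expr1.
have fG b : irect x0 x1 y0 y1 b -> f b = (b - c) * G b.
  move=> bI; apply: (mulIf (cconst_neq0 x01 y01 bI)).
  rewrite -mulrA divfK ?cconst_neq0 // -cauchy_formula //.
  have := cauchy_formula x01 y01 cI hK; rewrite fc0 mul0r => h0.
  have kb q : ccont_on (bdr x0 x1 y0 y1) q -> ccont_on (bdr x0 x1 y0 y1) (fun z => q z / (z - b)).
    move=> hq z zB; apply: ccontM; first exact: hq.
    by apply: hol_ccont; apply: holV; [exact: bdr_neq zB|exact: hol_subC].
  rewrite -[LHS]subr0 -h0 -(rintB x01 y01 (kb _ fB) pB).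
  rewrite -(rintZ (ltW x01) (ltW y01) (b - c) (kb _ pB)).
  apply: (@eq_rint R x0 x1 y0 y1 (ltW x01) (ltW y01)) => z zB.
  have := bdr_neq bI zB; have := bdr_neq cI zB => n1 n2.
  by rewrite /p; field; rewrite n1 n2.
have dG : cderiv f c = G c.
  apply: derivE.
  have [d hd] := hG.
  have h1 : cdiff (fun w => w - c) c (1 + 0).
    by apply: cdiffD; [exact: cdiff_id|exact: cdiff_cst].
  have := cdiffM h1 hd; rewrite addr0 mul1r subrr mul0r addr0 => h2.
  have [e e0 eI] := irect_near cI.
  by apply: (cdiff_ext e0 _ h2) => w we; rewrite fG //; exact: eI.
apply: (@hol_ext _ G _ _ s s0) => // w ws.
case: eqP => [->|/eqP wc]; first by rewrite dG.
by rewrite (fG w (near_I ws)) mulrC mulKf // subr_eq0.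
Qed.

End Local.

Lemma hol_deriv_near f c (r : R) : 0 < r -> (forall z, normc (z - c) < r -> hol f z) ->
  forall z, normc (z - c) < r -> hol (cderiv f) z.
Proof.
move=> r0 hf z zr; apply: (@hol_deriv _ _ (r - normc (z - c))); first by rewrite subr_gt0.
move=> w wz; apply: hf; have := le_normcD (w - z) (z - c).
by have -> : w - z + (z - c) = w - c by [ring]; lra.
Qed.

Lemma hol_quot f c z : z != c -> hol f z -> forall d, hol (fun w => if w == c then d else f w / (w - c)) z.
Proof.
move=> zc hf d; apply: (@hol_ext _ (fun w => f w / (w - c)) _ _ (normc (z - c))).
- by rewrite normc_gt0 subr_eq0.
- move=> w wz; case: eqP => // wc; move: wz; rewrite wc normcBC ltxx //.
- by apply: hol_div => //; [rewrite subr_eq0|exact: hol_subC].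
Qed.

Lemma entire_divide f b : (forall z, hol f z) -> f b = 0 ->
  exists2 g, (forall z, hol g z) & forall z, f z = (z - b) * g z.
Proof.
move=> hf fb; exists (fun z => if z == b then cderiv f b else f z / (z - b)).
  move=> z; have [->|zb] := eqVneq z b; first exact: (@hol_divide f b 1).
  exact: hol_quot.
move=> z; case: eqP => [->|/eqP zb]; first by rewrite subrr mul0r.
by rewrite mulrC divfK // subr_eq0.
Qed.

(** Since [(z - c) * k z] is bounded, [(z - c) ^+ 3 * k z] is of second order at [c], so extending
    it by 0 makes it differentiable there, with derivative 0. Dividing out the zero twice leaves
    [(z - c) * k z] extended by [d]; subtracting [d] and dividing once more leaves [q]. *)
Lemma simple_pole k c (r C : R) : 0 < r ->
  (forall z, normc (z - c) < r -> z != c -> hol k z) ->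
  (forall z, normc (z - c) < r -> z != c -> normc (k z) * normc (z - c) <= C) ->
  exists (d : R[i]) (q : R[i] -> R[i]),
    (forall z, normc (z - c) < r -> hol q z) /\
    (forall z, normc (z - c) < r -> z != c -> k z = d / (z - c) + q z).
Proof.
move=> r0 hk kC.
pose q3 z := (z - c) ^+ 3 * k z.
pose Q3 z := if z == c then 0 else q3 z.
have off g d z : normc (z - c) < r -> z != c -> hol g z -> hol (fun w => if w == c then d else g w) z.
  move=> zr zc hg; apply: (@hol_ext _ g _ _ (normc (z - c))) => //.
    by rewrite normc_gt0 subr_eq0.
  move=> w wz; case: eqP => // wc; move: wz; rewrite wc normcBC ltxx //.
have h3 z : normc (z - c) < r -> hol Q3 z.
  move=> zr; have [->|zc] := eqVneq z c; last first.
    by apply: off => //; apply: holM; [apply: holX; exact: hol_subC|exact: hk].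
  exists 0 => e e0; exists (Num.min r (Num.min 1 (e / (`|C| + 1)))).
    by rewrite !lt_min r0 ltr01 divr_gt0 // ltr_wpDl.
  move=> h; rewrite !lt_min => /andP[hr /andP[h1 he]].
  rewrite /Q3 eqxx subr0 mul0r subr0.
  case: eqP => [_|/eqP hc]; first by rewrite normc0 mulr_ge0 ?normc_ge0 // ltW.
  rewrite /q3; have hE : c + h - c = h by [ring]; rewrite hE.
  have := kC (c + h); rewrite hE => /(_ hr hc) hb.
  rewrite (normcM (h ^+ 3)) (normcX h).
  have n0 := normc_ge0 h.
  have : normc h * normc h * (normc (k (c + h)) * normc h) <= normc h * normc h * (`|C| + 1).
    by rewrite ler_wpM2l ?mulr_ge0 //; apply: (le_trans hb); have := ler_norm C; lra.
  have : normc h * (normc h * (`|C| + 1)) <= normc h * e.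
    by rewrite ler_wpM2l // -ler_pdivlMr ?ltr_wpDl // ltW.
  rewrite !exprS expr0; lra.
have cr : normc (c - c) < r by rewrite subrr normc0.
have Q3c : Q3 c = 0 by rewrite /Q3 eqxx.
have d3 : cderiv Q3 c = 0.
  apply: derivE; have [d hd] := h3 c cr.
  suff -> : (0 : R[i]) = d by [].
  apply/esym; apply: normc_le_eps => e e0.
  have e2 : 0 < e / 2 by rewrite divr_gt0.
  have [D D0 H] := hd _ e2.
  have C1 : 0 < `|C| + 1 by rewrite ltr_wpDl.
  pose t := Num.min D (Num.min r (e / (2 * (`|C| + 1)))) / 2.
  have m0 : 0 < Num.min D (Num.min r (e / (2 * (`|C| + 1)))).
    by rewrite !lt_min D0 r0 divr_gt0 // mulr_gt0.
  have t0 : 0 < t by rewrite divr_gt0.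
  have tm : t < Num.min D (Num.min r (e / (2 * (`|C| + 1)))) by rewrite /t; lra.
  move: tm; rewrite !lt_min => /andP[tD /andP[tr te]].
  have nt : normc (t%:C) = t by rewrite normc_real gtr0_norm.
  have tE : c + t%:C - c = t%:C by ring.
  have tc : c + t%:C != c.
    by rewrite -subr_eq0 tE -normc_eq0 nt gt_eqF.
  have := H t%:C; rewrite nt => /(_ tD).
  rewrite Q3c subr0 /Q3 (negbTE tc) /q3 tE => h1.
  have := kC (c + t%:C); rewrite tE nt => /(_ tr tc) h2.
  have b1 : normc (t%:C ^+ 3 * k (c + t%:C)) <= t * (e / 2).
    rewrite (normcM (t%:C ^+ 3)) (normcX t%:C) nt.
    have b2 : t * t * (normc (k (c + t%:C)) * t) <= t * t * (`|C| + 1).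
      apply: (ler_wpM2l (mulr_ge0 (ltW t0) (ltW t0))); apply: (le_trans h2); have := ler_norm C; lra.
    have b3 : t * (t * (`|C| + 1)) <= t * (e / 2).
      apply: (ler_wpM2l (ltW t0)); rewrite -ler_pdivlMr //.
      by apply: ltW; move: te; rewrite invfM mulrA.
    rewrite !exprS expr0; lra.
  have : normc (d * t%:C) <= e * t.
    apply: (le_trans (ler_normc_tri _ (t%:C ^+ 3 * k (c + t%:C)))).
    rewrite normcBC in h1; lra.
  by rewrite normcM nt ler_pM2r.
pose q2 z := (z - c) ^+ 2 * k z.
pose Q2 z := if z == c then 0 else q2 z.
have h2 z : normc (z - c) < r -> hol Q2 z.
  move=> zr; have [->|zc] := eqVneq z c; last first.
    by apply: off => //; apply: holM; [apply: holX; exact: hol_subC|exact: hk].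
  have := hol_divide r0 h3 Q3c; rewrite d3; apply: hol_ext1 => w.
  rewrite /Q2 /Q3; case: eqP => // /eqP wc; rewrite /q3 /q2.
  by field; rewrite subr_eq0.
have Q2c : Q2 c = 0 by rewrite /Q2 eqxx.
pose d := cderiv Q2 c.
pose q1 z := (z - c) * k z.
pose Q1 z := if z == c then d else q1 z.
have h1 z : normc (z - c) < r -> hol Q1 z.
  move=> zr; have [->|zc] := eqVneq z c; last first.
    by apply: off => //; apply: holM; [exact: hol_subC|exact: hk].
  have := hol_divide r0 h2 Q2c; rewrite -/d; apply: hol_ext1 => w.
  rewrite /Q1 /Q2; case: eqP => // /eqP wc; rewrite /q1 /q2.
  by field; rewrite subr_eq0.
pose P1 z := Q1 z - d.
have hP z : normc (z - c) < r -> hol P1 z by move=> /h1 h; apply: holB => //; exact: hol_cst.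
have P1c : P1 c = 0 by rewrite /P1 /Q1 eqxx subrr.
exists d, (fun z => if z == c then cderiv P1 c else P1 z / (z - c)); split.
  move=> z zr; have [->|zc] := eqVneq z c; first exact: (hol_divide r0 hP P1c).
  by apply: hol_quot => //; exact: hP.
move=> z zr zc; rewrite (negbTE zc) /P1 /Q1 (negbTE zc) /q1.
by field; rewrite subr_eq0.
Qed.

Theorem liouville f (M : R) : (forall z, hol f z) -> (forall z, normc (f z) <= M) ->
  forall z, f z = f 0.
Proof.
move=> hf HM z.
have hF w : hol (fun w => f w - f 0) w by apply: holB; [exact: hf|exact: hol_cst].
have [|g hg fg] := @entire_divide (fun w => f w - f 0) 0 hF; first by rewrite subrr.
suff g0 : g z = 0 by apply/eqP; rewrite -subr_eq0 fg g0 mulr0.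
have M0 : 0 <= M by apply: le_trans (HM 0); exact: normc_ge0.
apply: normc_le_eps => e e0.
pose r := Num.max (normc z + 1) (2 * M / e).
have r0 : 0 < r by rewrite lt_max; apply/orP; left; have := normc_ge0 z; lra.
have zr : normc (z - 0) <= r by rewrite subr0 le_max; apply/orP; left; lra.
apply: (max_annulus r0 _ _ zr) => [w _ //|w w1 w2].
rewrite subr0 in w1 w2.
have w0 : 0 < normc w by apply: lt_le_trans w1.
have e1 : normc (g w) * normc w = normc (f w - f 0) by rewrite fg subr0 normcM mulrC.
rewrite -(ler_pM2r w0) e1.
apply: (le_trans (ler_normcB _ _)); apply: (le_trans (lerD (HM _) (HM _))).
rewrite mulrC -ler_pdivrMr //; apply: le_trans w1; rewrite le_max; apply/orP; right.
by rewrite mulr_natl mulr2n.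
Qed.

End LocalTheory.

(** * Logarithms, quotients of finite order and the Phragmen-Lindelof principle *)

Section ComplexExponential.
Variable R : realType.
Implicit Types (z w : R[i]) (x y t : R).

Lemma is_derive_eps (f : R -> R) x (d : R) : is_derive x 1 f d ->
  forall e, 0 < e -> exists2 D : R, 0 < D &
    forall h, `|h| < D -> `|f (x + h) - f x - d * h| <= e * `|h|.
Proof.
move=> [fd fE] e e0.
have /cvgrPdist_le /(_ e e0) : h^-1 *: (f (h *: (1 : R) + x) - f x) @[h --> 0^'] --> d.
  by move: fE; rewrite /derive => <-; exact: fd.
rewrite /dnbhs => -[/= D D0 H]; exists D => // h hD.
have [->|h0] := eqVneq h 0; first by rewrite addr0 mulr0 subrr subr0 normr0 mulr0.
have := H h; rewrite /ball_ /= sub0r normrN => /(_ hD h0).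
rewrite /GRing.scale /= mulr1 [h + x]addrC => hb.
have -> : f (x + h) - f x - d * h = - ((d - h^-1 * (f (x + h) - f x)) * h) by field.
by rewrite normrN normrM ler_wpM2r.
Qed.

Lemma eps_is_derive (f : R -> R) x (d : R) :
  (forall e, 0 < e -> exists2 D : R, 0 < D &
    forall h, `|h| < D -> `|f (x + h) - f x - d * h| <= e * `|h|) ->
  is_derive x 1 f d.
Proof.
move=> H.
have c : h^-1 *: (f (h *: (1 : R) + x) - f x) @[h --> 0^'] --> d.
  apply/cvgrPdist_le => /= e e0; have [D D0 HD] := H e e0.
  rewrite /dnbhs; exists D => //= h; rewrite /ball_ /= sub0r normrN => hD h0.
  have := HD h hD; rewrite /GRing.scale /= mulr1 [h + x]addrC => hb.
  have -> : d - h^-1 * (f (x + h) - f x) = - ((f (x + h) - f x - d * h) * h^-1) by field.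
  by rewrite normrN normrM normfV ler_pdivrMr // normr_gt0.
by apply: DeriveDef; [exact: (cvgP d)|exact/cvg_lim].
Qed.

Definition cexp z : R[i] := (expR (complex.Re z) * cos (complex.Im z)) +i*
  (expR (complex.Re z) * sin (complex.Im z)).

Lemma normc_cexp z : normc (cexp z) = expR (complex.Re z).
Proof.
apply/eqP; rewrite -(@eqrXn2 _ 2) ?normc_ge0 ?expR_ge0 // normc_sqr /=.
by rewrite !exprMn -mulrDr cos2Dsin2 mulr1.
Qed.

Lemma cexpD z w : cexp (z + w) = cexp z * cexp w.
Proof.
case: z w => a b [c d]; rewrite /cexp /= expRD cosD sinD.
by apply/eqP; rewrite eq_complex /=; apply/andP; split; apply/eqP; ring.
Qed.

Lemma cexp0 : cexp 0 = 1.
Proof. by rewrite /cexp /= expR0 cos0 sin0 mulr1 mulr0. Qed.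

Lemma cexp_neq0 z : cexp z != 0.
Proof. by rewrite -normc_gt0 normc_cexp expR_gt0. Qed.

Lemma cdiff_cexp0 : cdiff cexp 0 1.
Proof.
move=> e e0.
(* The expansions of [expR], [sin] and [cos] with accuracy [d] leave errors [4 * d * normc h] and
   [5 * d * normc h] in the two components, below [e * normc h] in total. *)
have [d [e8 d1 d8]] : exists d : R, [/\ 0 < d, d <= 1 & d <= e / 16].
  by exists (Num.min 1 (e / 16)); rewrite lt_min ltr01 divr_gt0 // !ge_min !lexx orbT.
have [D1 D10 H1] := is_derive_eps (is_derive_expR 0) e8.
have [D2 D20 H2] := is_derive_eps (is_derive_sin 0) e8.
have [D3 D30 H3] := is_derive_eps (is_derive_cos 0) e8.
exists (Num.min (Num.min D1 D2) (Num.min D3 d)) => [|h]; first by rewrite !lt_min D10 D20 D30 e8.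
rewrite !lt_min => /andP[/andP[h1 h2] /andP[h3 h4]].
have hR := Re_le_normc h; have hI := Im_le_normc h.
set a := complex.Re h in hR; set b := complex.Im h in hI.
have := H1 a (le_lt_trans hR h1); rewrite add0r expR0 mul1r => k1.
have := H2 b (le_lt_trans hI h2); rewrite add0r sin0 cos0 subr0 mul1r => k2.
have := H3 b (le_lt_trans hI h3); rewrite add0r sin0 cos0 oppr0 mul0r subr0 => k3.
have n0 := normc_ge0 h.
have da0 : d * `|a| <= d * normc h by rewrite ler_wpM2l // ltW.
have db0 : d * `|b| <= d * normc h by rewrite ler_wpM2l // ltW.
have dh1 : normc h <= 1 by lra.
have dh : d * normc h <= normc h by rewrite ler_piMl.
apply: (le_trans (normc_le_ReIm _)).
rewrite add0r mul1r cexp0 !raddfB /= -/a -/b.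
have ea1 : `|expR a - 1| <= 2 * normc h.
  have -> : expR a - 1 = (expR a - 1 - a) + a by ring.
  apply: (le_trans (ler_normD _ _)); lra.
have ea : `|expR a| <= 3.
  have -> : expR a = (expR a - 1) + 1 by ring.
  apply: (le_trans (ler_normD _ _)); rewrite normr1; lra.
have r1 : `|expR a * cos b - 1 - a| <= 4 * (d * normc h).
  have -> : expR a * cos b - 1 - a = (expR a - 1 - a) + expR a * (cos b - 1) by ring.
  apply: (le_trans (ler_normD _ _)); rewrite normrM.
  have : `|expR a| * `|cos b - 1| <= 3 * (d * normc h).
    by apply: ler_pM => //; apply: (le_trans k3).
  lra.
have r2 : `|expR a * sin b - 0 - b| <= 5 * (d * normc h).
  have -> : expR a * sin b - 0 - b = expR a * (sin b - b) + (expR a - 1) * b by ring.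
  apply: (le_trans (ler_normD _ _)); rewrite !normrM.
  have j1 : `|expR a| * `|sin b - b| <= 3 * (d * normc h).
    by apply: ler_pM => //; apply: (le_trans k2).
  have j2 : `|expR a - 1| * `|b| <= (2 * normc h) * d.
    by apply: ler_pM => //; apply: (le_trans hI); exact: ltW.
  lra.
have : 9 * d * normc h <= e * normc h by rewrite ler_wpM2r //; lra.
lra.
Qed.

Lemma cdiff_cexp z : cdiff cexp z (cexp z).
Proof.
move=> e e0.
have n0 : 0 < normc (cexp z) by rewrite normc_gt0 cexp_neq0.
have e1 : 0 < e / normc (cexp z) by rewrite divr_gt0.
have [D D0 H] := cdiff_cexp0 e1; exists D => // h /H.
rewrite add0r cexp0 mul1r => h1.
have -> : cexp (z + h) - cexp z - cexp z * h = cexp z * (cexp h - 1 - h) by rewrite cexpD; ring.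
by rewrite normcM mulrC -ler_pdivlMr // mulrAC.
Qed.

Lemma hol_cexp z : hol cexp z.
Proof. by exists (cexp z); exact: cdiff_cexp. Qed.

(** The mean value theorem is applied to both components along the segment from [c] to [z]. *)
Lemma cdiff0_const (u : R[i] -> R[i]) c r : (forall z, normc (z - c) < r -> cdiff u z 0) ->
  forall z, normc (z - c) < r -> u z = u c.
Proof.
move=> hu z zr.
have n1 : 0 < normc (z - c) + 1 by rewrite ltr_wpDl // normc_ge0.
pose g t := u (c + t%:C * (z - c)).
have gd t : 0 <= t <= 1 -> forall e, 0 < e -> exists2 D : R, 0 < D &
    forall h, `|h| < D -> normc (g (t + h) - g t) <= e * `|h|.
  move=> /andP[t0 t1] e e0.
  have i1 : normc (c + t%:C * (z - c) - c) < r.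
    rewrite addrC addKr normcM normc_real ger0_norm //; apply: le_lt_trans zr.
    by rewrite ler_piMl // normc_ge0.
  have i2 : 0 < e / (normc (z - c) + 1) by rewrite divr_gt0.
  have [D D0 H] := hu _ i1 _ i2.
  exists (D / (normc (z - c) + 1)); first by rewrite divr_gt0.
  move=> h; rewrite ltr_pdivlMr // => hD.
  have hn : normc (h%:C * (z - c)) <= `|h| * (normc (z - c) + 1).
    by rewrite normcM normc_real ler_wpM2l // lerDl.
  have := H (h%:C * (z - c)) (le_lt_trans hn hD).
  rewrite mul0r subr0 /g rmorphD mulrDl addrA => h1.
  apply: (le_trans h1).
  have -> : e * `|h| = e / (normc (z - c) + 1) * (`|h| * (normc (z - c) + 1)).
    by field; rewrite gt_eqF.
  by rewrite ler_wpM2l // divr_ge0 // ltW.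
have mvt (p : R[i] -> R) : (forall v w, p (v - w) = p v - p w) -> (forall w, `|p w| <= normc w) ->
    p (u z) = p (u c).
  move=> pB pn.
  have pd t : 0 <= t <= 1 -> is_derive t 1 (fun t => p (g t)) 0.
    move=> ht; apply: eps_is_derive => e e0; have [D D0 H] := gd t ht e e0.
    by exists D => // h /H; rewrite mul0r subr0 -pB; apply: le_trans; exact: pn.
  have [||x _] := @MVT R (fun t => p (g t)) (fun=> 0) 0 1 ltr01.
  - by move=> t; rewrite in_itv /= => /andP[/ltW t0 /ltW t1]; apply: pd; rewrite t0.
  - apply: within_for => t /pd[dt _].
    by apply: differentiable_continuous; apply/derivable1_diffP.
  have e1 : c + 1%:C * (z - c) = z by rewrite rmorph1; ring.
  have e2 : c + 0%:C * (z - c) = c by rewrite rmorph0; ring.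
  by rewrite mul0r /g e1 e2 => /eqP; rewrite subr_eq0 => /eqP.
apply/eqP; rewrite eq_complex; apply/andP; split; apply/eqP.
- apply: (mvt (@complex.Re R)); [exact: raddfB|exact: Re_le_normc].
- apply: (mvt (@complex.Im R)); [exact: raddfB|exact: Im_le_normc].
Qed.

End ComplexExponential.

(** * Primitives on a rectangle *)

Section Primitive.
Variable R : realType.
Implicit Types (q : R[i] -> R[i]) (z : R[i]).
Variables (x0 x1 y0 y1 : R) (q : R[i] -> R[i]).
Hypotheses (hq : hol_on (rect x0 x1 y0 y1) q).
Local Notation K := (rect x0 x1 y0 y1).

(** Integration first along the bottom side, then upwards. By Goursat the other order gives the same
    ([prim_alt]), so horizontal and vertical increments are both plain segment integrals. *)
Let prim (p : R[i] -> R[i]) z := cint (fun t => p (t +i* y0)) x0 (complex.Re z) +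
  'i * cint (fun t => p (complex.Re z +i* t)) y0 (complex.Im z).

Let prim_def (p : R[i] -> R[i]) x y : prim p (x +i* y) =
  cint (fun t => p (t +i* y0)) x0 x + 'i * cint (fun t => p (x +i* t)) y0 y.
Proof. by []. Qed.

Let prim_alt (p : R[i] -> R[i]) x y : hol_on K p -> K (x +i* y) ->
  prim p (x +i* y) = 'i * cint (fun t => p (x0 +i* t)) y0 y + cint (fun t => p (t +i* y)) x0 x.
Proof.
move=> hp [/= /andP[hx0 hx1] /andP[hy0 hy1]].
have := @goursat _ p x0 x y0 y hx0 hy0; rewrite /rint => H.
apply/eqP; rewrite -subr_eq0; apply/eqP; rewrite prim_def -[RHS]H; first by ring.
by move=> z zr; apply: hp; move: z zr; apply: rectS.
Qed.

Let pc_h (p : R[i] -> R[i]) y a b : hol_on K p -> y0 <= y <= y1 -> x0 <= a -> b <= x1 ->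
  pcont_on (fun t => p (t +i* y)) a b.
Proof.
move=> hp hy ha hb t /andP[t1 t2]; apply: ccont_hor; apply: hol_ccont; apply: hp.
by split => //=; rewrite (le_trans ha t1) (le_trans t2 hb).
Qed.

Let pc_v (p : R[i] -> R[i]) x a b : hol_on K p -> x0 <= x <= x1 -> y0 <= a -> b <= y1 ->
  pcont_on (fun t => p (x +i* t)) a b.
Proof.
move=> hp hx ha hb t /andP[t1 t2]; apply: ccont_ver; apply: hol_ccont; apply: hp.
by split => //=; rewrite (le_trans ha t1) (le_trans t2 hb).
Qed.

Let step_h (p : R[i] -> R[i]) x x' y e : hol_on K p -> x0 <= x -> x <= x' -> x' <= x1 -> y0 <= y <= y1 ->
  (forall t, x <= t <= x' -> normc (p (t +i* y)) <= e) ->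
  normc (prim p (x' +i* y) - prim p (x +i* y)) <= 2 * e * (x' - x).
Proof.
move=> hp h1 h2 h3 hy He.
rewrite !prim_alt //; last 2 first.
- by split => //=; rewrite h1 (le_trans h2).
- by split => //=; rewrite h3 (le_trans h1).
rewrite (cint_cat h1 h2); last exact: pc_h.
have -> : forall A B C : R[i], A + (B + C) - (A + B) = C by move=> A B C; ring.
by apply: cint_norm => //; apply: pc_h.
Qed.

Let step_v (p : R[i] -> R[i]) x y y' e : hol_on K p -> x0 <= x <= x1 -> y0 <= y -> y <= y' -> y' <= y1 ->
  (forall t, y <= t <= y' -> normc (p (x +i* t)) <= e) ->
  normc (prim p (x +i* y') - prim p (x +i* y)) <= 2 * e * (y' - y).
Proof.
move=> hp hx h1 h2 h3 He.
rewrite !prim_def (cint_cat h1 h2); last exact: pc_v.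
have -> : forall A B C : R[i], A + 'i * (B + C) - (A + 'i * B) = 'i * C by move=> A B C; ring.
by rewrite normcM normc_i mul1r; apply: cint_norm => //; apply: pc_v.
Qed.

Lemma primitive : exists L : R[i] -> R[i], forall z, irect x0 x1 y0 y1 z -> cdiff L z (q z).
Proof.
exists (prim q) => z zI e e0.
have [d d0 dI] := irect_near zI.
have e4 : 0 < e / 4 by rewrite divr_gt0.
have [D D0 HD] := ccont_near (hol_ccont (hq (irect_rect zI))) e4.
have m0 : 0 < Num.min d D / 2 by rewrite divr_gt0 // lt_min d0.
exists (Num.min d D / 2) => // h hD.
have [hd hD'] : 2 * normc h < d /\ 2 * normc h < D.
  have : 2 * normc h < Num.min d D by lra.
  by rewrite lt_min => /andP.
(* The constant [q z] has an explicit primitive and yields the linear term; what is left is at most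
   [e / 4] near [z]. *)
pose p w := q w - q z.
have hp : hol_on K p by move=> w /hq hw; apply: holB => //; exact: hol_cst.
have primE w : K w -> prim q w = prim p w + q z * (w - (x0 +i* y0)).
  move=> wK; have [/andP[w1 w2] /andP[w3 w4]] := wK.
  have c1 : pcont_on (fun=> q z) x0 (complex.Re w).
    by move=> t _ e' e'0; exists 1 => // k _; rewrite subrr normc0 ltW.
  have c2 : pcont_on (fun=> q z) y0 (complex.Im w).
    by move=> t _ e' e'0; exists 1 => // k _; rewrite subrr normc0 ltW.
  rewrite /prim.
  have -> : cint (fun t => q (t +i* y0)) x0 (complex.Re w) =
     cint (fun t => p (t +i* y0)) x0 (complex.Re w) + q z * (complex.Re w - x0)%:C.
    rewrite -cint_cst // -cintD //; first by apply: eq_cint => t _; rewrite /p subrK.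
    by apply: pc_h => //; rewrite lexx (le_trans w3).
  have -> : cint (fun t => q (complex.Re w +i* t)) y0 (complex.Im w) =
     cint (fun t => p (complex.Re w +i* t)) y0 (complex.Im w) + q z * (complex.Im w - y0)%:C.
    rewrite -cint_cst // -cintD //; first by apply: eq_cint => t _; rewrite /p subrK.
    by apply: pc_v => //; rewrite w1.
  have -> : w - (x0 +i* y0) = (complex.Re w - x0)%:C + 'i * (complex.Im w - y0)%:C.
    by case: (w) => a b; apply/eqP; rewrite eq_complex /=; apply/andP; split; apply/eqP; ring.
  ring.
have nn := normc_ge0 h.
have hR := Re_le_normc h; have hI := Im_le_normc h.
have zhI : irect x0 x1 y0 y1 (z + h) by apply: dI; rewrite addrC addKr; lra.
have zh'I : irect x0 x1 y0 y1 ((complex.Re z + complex.Re h) +i* complex.Im z).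
  apply: dI; apply: (le_lt_trans (normc_le_ReIm _)); case: (z) => a b /=.
  have -> : a + complex.Re h - a = complex.Re h by [ring].
  by rewrite subrr normr0 addr0; lra.
rewrite !primE; try exact: irect_rect.
(* The way from [z] to [z + h] goes through the corner below or above [z + h] at the height of
   [z]. *)
have -> : prim p (z + h) + q z * (z + h - (x0 +i* y0)) - (prim p z + q z * (z - (x0 +i* y0))) - q z * h =
   (prim p (z + h) - prim p ((complex.Re z + complex.Re h) +i* complex.Im z)) +
   (prim p ((complex.Re z + complex.Re h) +i* complex.Im z) - prim p z) by ring.
have [/andP[z1 z2] /andP[z3 z4]] := zI.
have [/andP[w1 w2] /andP[w3 w4]] := zhI.
rewrite !raddfD /= in w1 w2 w3 w4.
have small s t : `|s| <= normc h -> `|t| <= normc h ->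
    normc (p ((complex.Re z + s) +i* (complex.Im z + t))) <= e / 4.
  move=> hs ht; apply: HD; apply: (le_lt_trans (normc_le_ReIm _)); case: (z) => a b /=.
  have -> : a + s - a = s by [ring].
  have -> : b + t - b = t by [ring].
  lra.
have sv : normc (prim p (z + h) - prim p ((complex.Re z + complex.Re h) +i* complex.Im z)) <= 2 * (e / 4) * normc h.
  have -> : z + h = (complex.Re z + complex.Re h) +i* (complex.Im z + complex.Im h) by case: (z) (h) => ? ? [].
  have [i0|i0] := leP 0 (complex.Im h).
    apply: (@le_trans _ _ (2 * (e / 4) * (complex.Im z + complex.Im h - complex.Im z))).
      apply: step_v => //; try lra; try (apply/andP; split; lra).
      move=> t /andP[t1 t2]; rewrite -[t](subrK (complex.Im z)) [_ + complex.Im z]addrC; apply: small => //.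
      by apply: le_trans hI; rewrite !ger0_norm //; lra.
    rewrite ler_wpM2l //; first by lra.
    by apply: le_trans hI; rewrite ger0_norm //; lra.
  rewrite normcBC.
  apply: (@le_trans _ _ (2 * (e / 4) * (complex.Im z - (complex.Im z + complex.Im h)))).
    apply: step_v => //; try lra; try (apply/andP; split; lra).
    move=> t /andP[t1 t2]; rewrite -[t](subrK (complex.Im z)) [_ + complex.Im z]addrC; apply: small => //.
    by apply: le_trans hI; rewrite (ltr0_norm i0) ler0_norm //; lra.
  rewrite ler_wpM2l //; first by lra.
  by apply: le_trans hI; rewrite ltr0_norm //; lra.
have sh : normc (prim p ((complex.Re z + complex.Re h) +i* complex.Im z) - prim p z) <= 2 * (e / 4) * normc h.
  have -> : prim p z = prim p (complex.Re z +i* complex.Im z) by case: (z).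
  have sm t : `|t - complex.Re z| <= normc h -> normc (p (t +i* complex.Im z)) <= e / 4.
    move=> ht; have := small (t - complex.Re z) 0 ht; rewrite normr0 addr0 addrC subrK.
    by apply.
  have [i0|i0] := leP 0 (complex.Re h).
    apply: (@le_trans _ _ (2 * (e / 4) * (complex.Re z + complex.Re h - complex.Re z))).
      apply: step_h => //; try lra; try (apply/andP; split; lra).
      move=> t /andP[t1 t2]; apply: sm.
      by apply: le_trans hR; rewrite !ger0_norm //; lra.
    rewrite ler_wpM2l //; first by lra.
    by apply: le_trans hR; rewrite ger0_norm //; lra.
  rewrite normcBC.
  apply: (@le_trans _ _ (2 * (e / 4) * (complex.Re z - (complex.Re z + complex.Re h)))).
    apply: step_h => //; try lra; try (apply/andP; split; lra).
    move=> t /andP[t1 t2]; apply: sm.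
    by apply: le_trans hR; rewrite (ltr0_norm i0) ler0_norm //; lra.
  rewrite ler_wpM2l //; first by lra.
  by apply: le_trans hR; rewrite ltr0_norm //; lra.
apply: (le_trans (le_normcD _ _)); lra.
Qed.

End Primitive.

(** * Logarithms of zero-free functions *)

Section Logarithm.
Variable R : realType.
Implicit Types (f L : R[i] -> R[i]) (z c : R[i]).

(** [L] is a primitive of the logarithmic derivative, normalised at [c]; then [f z * cexp (- L z)]
    has derivative 0. *)
Lemma logarithm f c (r : R) : 0 < r ->
  (forall z, normc (z - c) < r -> hol f z) ->
  (forall z, normc (z - c) < r -> f z != 0) ->
  exists L : R[i] -> R[i], [/\ L c = 0,
    forall z, normc (z - c) < r / 3 -> hol L z &
    forall z, normc (z - c) < r / 3 -> f z = f c * cexp (L z)].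
Proof.
move=> r0 hf f0.
set s := r / 3; have s0 : 0 < s by rewrite divr_gt0.
pose q z := cderiv f z / f z.
have hq : hol_on (rect (complex.Re c - s) (complex.Re c + s) (complex.Im c - s) (complex.Im c + s)) q.
  move=> z /square_normc zs; have zr : normc (z - c) < r by apply: (le_lt_trans zs); rewrite /s; lra.
  by apply: hol_div; [exact: f0|exact: (hol_deriv_near r0 hf)|exact: hf].
have [L0 HL0] := primitive hq.
have HL z : normc (z - c) < s -> cdiff L0 z (q z) by move=> zs; apply: HL0; exact: normc_isquare.
pose L z := L0 z - L0 c.
have dL z : normc (z - c) < s -> cdiff L z (q z).
  move=> zs; have := cdiffD (HL z zs) (cdiff_cst (- L0 c) z); rewrite addr0.
  by apply: (cdiff_ext ltr01).
have Lc : L c = 0 by rewrite /L subrr.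
exists L; split => // [z zs|z zs]; first by exists (q z); exact: dL.
pose u w := f w * cexp (- L w).
have du w : normc (w - c) < s -> cdiff u w 0.
  move=> ws; have wr : normc (w - c) < r by apply: (lt_trans ws); rewrite /s; lra.
  have dN : cdiff (fun w => - L w) w (- q w).
    have := cdiffM (cdiff_cst (-1) w) (dL w ws); rewrite mul0r add0r mulN1r.
    by apply: (cdiff_ext ltr01) => v _; rewrite mulN1r.
  have := cdiffM (derivP (hf w wr)) (cdiff_comp dN (cdiff_cexp (- L w))).
  suff -> : cderiv f w * cexp (- L w) + f w * (cexp (- L w) * - q w) = 0 by [].
  by rewrite /q; field; rewrite f0.
have := cdiff0_const du zs; rewrite /u Lc oppr0 cexp0 mulr1 => <-.
by rewrite -mulrA -cexpD addNr cexp0 mulr1.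
Qed.

End Logarithm.

(** * Growth of an entire quotient of entire functions *)

Section QuotientGrowth.
Variable R : realType.
Implicit Types (f F P Q : R[i] -> R[i]) (z c : R[i]).

(* Borel-Caratheodory: if [f = f c * cexp L] then [L / (2 B - L)] maps the disc
   into the unit disc and vanishes at [c]. *)
Lemma zero_free_lower f c (r B : R) : 0 < r -> 0 < B ->
  (forall z, normc (z - c) < r -> hol f z) ->
  (forall z, normc (z - c) < r -> f z != 0) ->
  (forall z, normc (z - c) < r -> normc (f z) <= normc (f c) * expR B) ->
  forall z, normc (z - c) <= r / 18 -> normc (f c) * expR (- (2 * B)) <= normc (f z).
Proof.
move=> r0 B0 hf f0 fB z zr.
have [L [Lc hL fL]] := logarithm r0 hf f0.
have cr : normc (c - c) < r by rewrite subrr normc0.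
have fc0 : 0 < normc (f c) by rewrite normc_gt0 f0.
pose s := r / 3; have s0 : 0 < s by rewrite divr_gt0.
have LB w : normc (w - c) < s -> complex.Re (L w) <= B.
  move=> ws; have wr : normc (w - c) < r by apply: (lt_trans ws); rewrite /s; lra.
  by have := fB w wr; rewrite (fL w ws) normcM normc_cexp ler_pM2l // ler_expR.
(* [2 B] is the mirror image of 0 in the line Re = B, so [Re (L w) <= B] means that [L w] is at
   least as close to 0 as to [b]. *)
pose b : R[i] := (2 * B)%:C.
have RebL w : normc (w - c) < s -> B <= complex.Re (b - L w).
  by move=> /LB h; rewrite raddfB /=; lra.
have bL w : normc (w - c) < s -> b - L w != 0.
  move=> /RebL h; rewrite -normc_gt0; apply: (lt_le_trans B0); apply: (le_trans h).
  exact: le_trans (ler_norm _) (Re_le_normc _).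
pose g w := L w / (b - L w).
have hg w : normc (w - c) < s -> hol g w.
  move=> ws; apply: hol_div; [exact: bL|exact: hL|].
  by apply: holB; [exact: hol_cst|exact: hL].
have g1 w : normc (w - c) < s -> normc (g w) <= 1.
  move=> ws; rewrite /g normcM normcV ler_pdivrMr ?normc_gt0 ?bL // mul1r.
  rewrite -(@ler_pXn2r _ 2) ?nnegrE ?normc_ge0 // !normc_sqr !raddfB /= sub0r sqrrN.
  have := LB w ws; set x := complex.Re (L w); set y := complex.Im (L w) => hx.
  have : 0 <= B * (B - x) by rewrite mulr_ge0 ?subr_ge0 // ltW.
  rewrite !expr2; lra.
have gc : g c = 0 by rewrite /g Lc mul0r.
pose G w := if w == c then cderiv g c else g w / (w - c).
have hG w : normc (w - c) < s -> hol G w.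
  move=> ws; have [->|wc] := eqVneq w c; first exact: (hol_divide s0 hg gc).
  by apply: hol_quot => //; exact: hg.
(* Schwarz's lemma on the disc of radius [q = r / 9]: at distance at most [r / 18] from [c] it gives
   [normc (g z) <= 1 / 2], and hence [normc (L z) <= 2 * B]. *)
pose q := s / 3; have q0 : 0 < q by rewrite divr_gt0.
have GM w : normc (w - c) <= q -> normc (G w) <= q^-1.
  apply: (max_annulus q0) => [v vq|v v1 v2].
    by apply: hG; apply: (le_lt_trans vq); rewrite /q; lra.
  have v0 : 0 < normc (v - c) by apply: lt_le_trans v1.
  have vc : v != c by rewrite -subr_eq0 -normc_gt0.
  rewrite /G (negbTE vc) normcM normcV.
  rewrite -[q^-1]mul1r; apply: ler_pM; rewrite ?invr_ge0 ?normc_ge0 //.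
  - by apply: g1; apply: (le_lt_trans v2); rewrite /q; lra.
  - by rewrite lef_pV2.
have zs : normc (z - c) < s by apply: (le_lt_trans zr); rewrite /s; lra.
have zq : normc (z - c) <= q by apply: (le_trans zr); rewrite /q /s; lra.
have gz : normc (g z) <= 2^-1.
  have [->|zc] := eqVneq z c; first by rewrite gc normc0 invr_ge0.
  have := GM z zq; rewrite /G (negbTE zc) normcM normcV.
  rewrite ler_pdivrMr ?normc_gt0 ?subr_eq0 // => h; apply: (le_trans h).
  by rewrite ler_pdivrMl //; apply: (le_trans zr); rewrite /q /s; lra.
have LE : L z = g z * (b - L z) by rewrite /g divfK // bL.
have nL : normc (L z) <= 2 * B.
  have : normc (L z) <= 2^-1 * (2 * B + normc (L z)).
    rewrite {1}LE normcM; apply: ler_pM; rewrite ?normc_ge0 //.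
    apply: (le_trans (ler_normcB _ _)); rewrite normc_real ger0_norm //.
    by rewrite mulr_ge0 // ltW.
  lra.
rewrite (fL z zs) normcM normc_cexp ler_pM2l // ler_expR.
have := Re_le_normc (L z); rewrite ler_norml => /andP[h _]; lra.
Qed.

Definition lprod (l : seq R[i]) z : R[i] := \prod_(a <- l) (z - a).

Lemma normc_lprod_ge l z (d : R) : 0 <= d -> (forall a, a \in l -> d <= normc (z - a)) ->
  d ^+ size l <= normc (lprod l z).
Proof.
move=> d0; elim: l => [|a l ih] H; first by rewrite /lprod big_nil normc1.
rewrite /lprod big_cons normcM exprS; apply: ler_pM => //; first exact: exprn_ge0.
- by apply: H; rewrite mem_head.
- by apply: ih => b bl; apply: H; rewrite inE bl orbT.
Qed.

Lemma normc_lprod_le l z (d : R) : 0 <= d -> (forall a, a \in l -> normc (z - a) <= d) ->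
  normc (lprod l z) <= d ^+ size l.
Proof.
move=> d0; elim: l => [|a l ih] H; first by rewrite /lprod big_nil normc1.
rewrite /lprod big_cons normcM exprS; apply: ler_pM; rewrite ?normc_ge0 //.
- by apply: H; rewrite mem_head.
- by apply: ih => b bl; apply: H; rewrite inE bl orbT.
Qed.

(** Removing zeros one at a time counts them with multiplicity. The alternative [size l = N] will be
    excluded by a bound on the number of zeros, so the procedure must stop. *)
Lemma factor_zeros Q c (r : R) : (forall z, hol Q z) -> forall N : nat,
  exists (l : seq R[i]) (Q' : R[i] -> R[i]), [/\ forall z, hol Q' z,
    forall z, Q z = lprod l z * Q' z, forall a, a \in l -> normc (c - a) < r &
    size l = N \/ forall z, normc (z - c) < r -> Q' z != 0].
Proof.
move=> hQ; elim=> [|N [l [Q' [hQ' QE lr [sN|nz]]]]].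
- exists [::], Q; split => //; last by left.
  by move=> z; rewrite /lprod big_nil mul1r.
- have [[a ar a0]|nex] := pselect (exists2 a, normc (a - c) < r & Q' a = 0).
    have [g hg gE] := entire_divide hQ' a0.
    exists (a :: l), g; split => //.
    + by move=> z; rewrite QE gE /lprod big_cons; ring.
    + by move=> b; rewrite inE => /orP[/eqP ->|/lr //]; rewrite normcBC.
    + by left; rewrite /= sN.
  exists l, Q'; split => //; right=> z zr; apply/eqP => z0; apply: nex; by exists z.
- by exists l, Q'; split => //; right.
Qed.

(** The zeros of [Q] in the disc of radius [r] are divided out of [P] and [Q] alike. The rest [Q']
    is zero-free there and bounded below by [zero_free_lower], while [F * Q'] is bounded above; all
    losses are measured by [b]. *)
Lemma quotient_bound P Q F c (r B : R) : (forall z, hol P z) -> (forall z, hol Q z) ->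
  (forall z, hol F z) -> (forall z, P z = F z * Q z) -> Q c != 0 -> 0 < r ->
  (forall z, normc (z - c) <= 8 * r -> normc (P z) <= expR B) ->
  (forall z, normc (z - c) <= 8 * r -> normc (Q z) <= expR B) ->
  forall z, normc (z - c) <= r / 18 -> normc (F z) <= expR (3 * (B - ln (normc (Q c))) + 2).
Proof.
move=> hP hQ hF PE Qc r0 PB QB.
set b := B - ln (normc (Q c)).
have Qc0 : 0 < normc (Q c) by rewrite normc_gt0.
have bE : expR b = expR B / normc (Q c) by rewrite expRD expRN lnK.
have b0 : 0 <= b.
  rewrite -ler_expR expR0 bE ler_pdivlMr // mul1r; apply: QB.
  by rewrite subrr normc0 mulr_ge0 // ltW.
have r4 : 0 < 4 * r by rewrite mulr_gt0.
(* Dividing out a zero [a] with [|a - c| < r] gains a factor [3 r]. *)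
have gain l (S S' : R[i] -> R[i]) : (forall z, hol S' z) -> (forall z, S z = lprod l z * S' z) ->
    (forall a, a \in l -> normc (c - a) < r) ->
    (forall z, normc (z - c) <= 8 * r -> normc (S z) <= expR B) ->
    forall z, normc (z - c) <= 4 * r -> normc (S' z) * (3 * r) ^+ size l <= expR B.
  move=> hS' SE lr SB z zr.
  have r3 : 0 < (3 * r) ^+ size l by rewrite exprn_gt0 // mulr_gt0.
  rewrite -ler_pdivlMr //; move: z zr; apply: (max_annulus r4) => [z _ //|z z1 z2].
  rewrite ler_pdivlMr //; apply: le_trans (SB z _); last by apply: (le_trans z2); lra.
  rewrite SE normcM mulrC ler_wpM2r ?normc_ge0 //; apply: normc_lprod_ge.
    by rewrite mulr_ge0 // ltW.
  move=> a /lr ar; have := ler_normc_tri (z - c) (z - a).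
  have -> : z - c - (z - a) = - (c - a) by ring.
  by rewrite normcN; lra.
(* As in Jensen's formula, a zero in the small disc costs a factor 3, so at most [b / ln 3] zeros
   exist; in particular fewer than this [N]. *)
have [N hN] := archi_ex (expR b).
have [l [Q' [hQ' QE lr alt]]] := @factor_zeros Q c r hQ N.
have cc : normc (c - c) <= 4 * r by rewrite subrr normc0 ltW.
have Q'B := gain _ _ _ hQ' QE lr QB.
have Qcl : normc (Q c) <= r ^+ size l * normc (Q' c).
  rewrite QE normcM ler_wpM2r ?normc_ge0 //; apply: normc_lprod_le; first exact: ltW.
  by move=> a /lr /ltW.
have Q'c0 : 0 < normc (Q' c).
  by rewrite normc_gt0; apply: contra_neq Qc => h; rewrite QE h mulr0.
have rl0 : 0 < r ^+ size l by rewrite exprn_gt0.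
have l3 : 3 ^+ size l <= expR b.
  rewrite bE ler_pdivlMr //; apply: le_trans (Q'B c cc).
  rewrite exprMn mulrCA ler_wpM2l ?exprn_ge0 //.
  by rewrite mulrC.
have nz z : normc (z - c) < r -> Q' z != 0.
  case: alt => [sN|]; last exact.
  move: l3; rewrite sN leNgt => /negP[]; apply: (lt_le_trans hN).
  by rewrite -natrX ler_nat ltnW // ltn_expl.
have one3 : 1 <= (3 : R) ^+ size l by rewrite exprn_ege1 // ler1n.
have up z : normc (z - c) < r -> normc (Q' z) <= normc (Q' c) * expR (b + 1).
  move=> zr; have r3 : 0 < (3 * r) ^+ size l by rewrite exprn_gt0 // mulr_gt0.
  rewrite -(ler_pM2r r3); apply: (@le_trans _ _ (expR B)).
    by apply: Q'B; have := normc_ge0 (z - c); lra.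
  rewrite expRD bE exprMn.
  have e1 : 1 <= expR 1 :> R by rewrite -expR0 ler_expR.
  have h1 : expR B <= normc (Q' c) * r ^+ size l * (expR B / normc (Q c)).
    by rewrite mulrA ler_pdivlMr // mulrC ler_wpM2r ?expR_ge0 // mulrC.
  have h2 : normc (Q' c) * r ^+ size l * (expR B / normc (Q c)) <=
     normc (Q' c) * r ^+ size l * (expR B / normc (Q c)) * (expR 1 * 3 ^+ size l).
    rewrite ler_peMr //; last by rewrite mulr_ege1.
    by rewrite !mulr_ge0 ?normc_ge0 ?expR_ge0 ?invr_ge0 ?exprn_ge0 ?normc_ge0 // ltW.
  by apply: (le_trans h1); apply: (le_trans h2); rewrite le_eqVlt; apply/orP; left; apply/eqP; ring.
move=> z zr.
have zr1 : normc (z - c) < r by lra.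
have b1 : 0 < b + 1 by rewrite ltr_wpDl.
have low := zero_free_lower r0 b1 (fun z _ => hQ' z) nz up zr.
have hFQ w : hol (fun w => F w * Q' w) w by exact: holM.
have PE' w : P w = lprod l w * (F w * Q' w) by rewrite PE QE; ring.
have := gain _ _ _ hFQ PE' lr PB z; rewrite normcM => /(_ _) FB.
have Q'z0 : 0 < normc (Q' z) by rewrite normc_gt0 nz.
have {}FB : normc (F z) * normc (Q' z) * (3 * r) ^+ size l <= expR B by apply: FB; lra.
have h1 : normc (F z) * (normc (Q' c) * expR (- (2 * (b + 1)))) * r ^+ size l <= expR B.
  apply: le_trans FB; apply: ler_pM.
  - by rewrite !mulr_ge0 ?normc_ge0 ?expR_ge0.
  - exact: ltW.
  - by rewrite ler_wpM2l ?normc_ge0.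
  - by rewrite exprMn ler_peMl // ltW.
have h2 : normc (F z) * normc (Q c) <= expR B * expR (2 * (b + 1)).
  rewrite -ler_pdivrMr ?expR_gt0 // -expRN.
  apply: le_trans h1.
  have -> : normc (F z) * (normc (Q' c) * expR (- (2 * (b + 1)))) * r ^+ size l =
    normc (F z) * (r ^+ size l * normc (Q' c)) * expR (- (2 * (b + 1))) by ring.
  by rewrite ler_wpM2r ?expR_ge0 // ler_wpM2l ?normc_ge0.
have -> : 3 * b + 2 = b + 2 * (b + 1) by ring.
by rewrite expRD bE mulrAC ler_pdivlMr.
Qed.

(** Order [p] and finite type, required everywhere. Using [1 + normc z] keeps the power at least 1
    when [p >= 0], so additive constants can be absorbed in [C]. *)
Definition exp_bounded (p : R) f := exists2 C : R, 0 <= C &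
  forall z, normc (f z) <= expR (C * (1 + normc z) `^ p).

Lemma powR_ge1 (p x : R) : 0 <= p -> 1 <= x -> 1 <= x `^ p.
Proof.
move=> p0 x1; have e1 : (1 : R) `^ p = 1 by rewrite powR1.
by rewrite -[leLHS]e1; apply: ge0_ler_powR => //; rewrite nnegrE // (le_trans _ x1).
Qed.

(** The centre [c] stays fixed and the radius grows linearly with [normc (z - c)], so the only lower
    bound needed for [Q] is its value at [c]. *)
Lemma quotient_exp_bounded P Q F c (p : R) : 0 <= p -> (forall z, hol P z) -> (forall z, hol Q z) ->
  (forall z, hol F z) -> (forall z, P z = F z * Q z) -> Q c != 0 ->
  exp_bounded p P -> exp_bounded p Q -> exp_bounded p F.
Proof.
move=> p0 hP hQ hF PE Qc [C1 C10 H1] [C2 C20 H2].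
(* For [r = 18 * (normc (z - c) + 1)] a point [w] of the disc of radius [8 * r] satisfies
   [1 + normc w <= K * (1 + normc z)]. *)
pose K := 200 * (1 + normc c).
have nc := normc_ge0 c.
have K0 : 0 <= K by rewrite /K; lra.
pose D := (C1 + C2) * K `^ p.
have D0 : 0 <= D by rewrite mulr_ge0 ?addr_ge0 // powR_ge0.
exists (3 * (D + `|ln (normc (Q c))|) + 2) => [|z].
  by rewrite addr_ge0 // mulr_ge0 // addr_ge0.
have nz := normc_ge0 z.
pose r := 18 * (normc (z - c) + 1).
have r0 : 0 < r by rewrite /r; have := normc_ge0 (z - c); lra.
have zc := ler_normcB z c.
pose B := D * (1 + normc z) `^ p.
have x1 : 1 <= (1 + normc z) `^ p by apply: powR_ge1 => //; lra.
have bnd w : normc (w - c) <= 8 * r -> (1 + normc w) `^ p <= K `^ p * (1 + normc z) `^ p.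
  move=> wr; rewrite -powRM //; last by lra.
  have nw := normc_ge0 w.
  apply: ge0_ler_powR => //; rewrite ?nnegrE; [lra|by rewrite mulr_ge0 //; lra|].
  have := ler_normc_tri w c; have : 0 <= normc c * normc z by rewrite mulr_ge0.
  rewrite /K; rewrite /r in wr; lra.
have PB w : normc (w - c) <= 8 * r -> normc (P w) <= expR B.
  move=> wr; apply: (le_trans (H1 w)); rewrite ler_expR /B /D -mulrA.
  by apply: ler_pM => //; rewrite ?powR_ge0 ?bnd // lerDl.
have QB w : normc (w - c) <= 8 * r -> normc (Q w) <= expR B.
  move=> wr; apply: (le_trans (H2 w)); rewrite ler_expR /B /D -mulrA.
  by apply: ler_pM => //; rewrite ?powR_ge0 ?bnd // lerDr.
have zr : normc (z - c) <= r / 18 by rewrite /r; have := normc_ge0 (z - c); lra.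
apply: (le_trans (quotient_bound hP hQ hF PE Qc r0 PB QB zr)).
rewrite ler_expR /B; set x := (1 + normc z) `^ p in x1 *.
set L := ln _.
have : `|L| * 1 <= `|L| * x by rewrite ler_wpM2l.
have := ler_norm (- L); rewrite normrN; lra.
Qed.

End QuotientGrowth.

(** * Bounds across the real axis and the Phragmen-Lindelof principle *)

Section PhragmenLindelof.
Variable R : realType.
Implicit Types (f F P Q : R[i] -> R[i]) (z c w : R[i]).

(* The factor [(w - a)^2 - d^2] vanishes where the boundary of the square meets
   the real axis and thereby compensates the blow-up of the bound there. *)
Lemma im_bound f (a d A : R) : 0 < d -> 0 <= A ->
  (forall w, square a%:C d w -> hol f w) ->
  (forall w, square a%:C d w -> complex.Im w != 0 -> normc (f w) * `|complex.Im w| <= A) ->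
  forall y, `|y| <= d -> normc (f (a +i* y)) <= 5 * A / d.
Proof.
move=> d0 A0 hf fA y yd.
pose h w := f w * ((w - a%:C) ^+ 2 - (d ^+ 2)%:C).
have hh w : square a%:C d w -> hol h w.
  move=> wd; apply: holM; first exact: hf.
  by apply: holB; [apply: holX; exact: hol_subC|exact: hol_cst].
have E w : (w - a%:C) ^+ 2 - (d ^+ 2)%:C = (w - a%:C - d%:C) * (w - a%:C + d%:C).
  by rewrite rmorphXn; ring.
have hb w : bdr (complex.Re a%:C - d) (complex.Re a%:C + d) (complex.Im a%:C - d) (complex.Im a%:C + d) w ->
    normc (h w) <= 5 * A * d.
  move=> wb; have wsq := bdr_rect wb; have wn := square_normc wsq.
  have [i0|i0] := eqVneq (complex.Im w) 0.
    have -> : h w = 0.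
      rewrite /h E; case: wb => _; rewrite i0 /= => -[].
      - move=> e; have -> : w - a%:C + d%:C = 0.
          by case: (w) e i0 => u v /= -> ->; apply/eqP; rewrite eq_complex /=; apply/andP; split; apply/eqP; ring.
        by rewrite !mulr0.
      - move=> e; have -> : w - a%:C - d%:C = 0.
          by case: (w) e i0 => u v /= -> ->; apply/eqP; rewrite eq_complex /=; apply/andP; split; apply/eqP; ring.
        by rewrite mul0r mulr0.
      - by move=> e; exfalso; lra.
      - by move=> e; exfalso; lra.
    by rewrite normc0; apply: mulr_ge0 (ltW d0); apply: mulr_ge0.
  have fw := fA w wsq i0.
  have im0 : 0 < `|complex.Im w| by rewrite normr_gt0.
  (* On a vertical side one of the two linear factors has modulus [|Im w|] and the other at most
     [3 * d]; on a horizontal side [|Im w| = d] and the quadratic factor is at most [5 * d ^ 2]. *)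
  suff : normc ((w - a%:C) ^+ 2 - (d ^+ 2)%:C) <= 5 * d * `|complex.Im w|.
    move=> hq; rewrite /h normcM.
    apply: (@le_trans _ _ (normc (f w) * (5 * d * `|complex.Im w|))); first by rewrite ler_wpM2l ?normc_ge0.
    have -> : normc (f w) * (5 * d * `|complex.Im w|) = (normc (f w) * `|complex.Im w|) * (5 * d) by ring.
    have -> : 5 * A * d = A * (5 * d) by ring.
    by rewrite ler_wpM2r // mulr_ge0 // ltW.
  have nd : normc (d%:C : R[i]) = d by rewrite normc_real gtr0_norm.
  have ver : complex.Re w = a - d \/ complex.Re w = a + d ->
      normc ((w - a%:C) ^+ 2 - (d ^+ 2)%:C) <= 5 * d * `|complex.Im w|.
    rewrite E => -[e|e].
    - have -> : w - a%:C + d%:C = 'i * (complex.Im w)%:C.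
        by case: (w) e => u v /= ->; apply/eqP; rewrite eq_complex /=; apply/andP; split; apply/eqP; ring.
      rewrite normcM (normcM 'i) normc_i normc_real mul1r ler_wpM2r //.
      by apply: (le_trans (ler_normcB _ _)); rewrite nd; lra.
    - have -> : w - a%:C - d%:C = 'i * (complex.Im w)%:C.
        by case: (w) e => u v /= ->; apply/eqP; rewrite eq_complex /=; apply/andP; split; apply/eqP; ring.
      rewrite mulrC normcM (normcM 'i) normc_i normc_real mul1r ler_wpM2r //.
      by apply: (le_trans (le_normcD _ _)); rewrite nd; lra.
  have hor : `|complex.Im w| = d -> normc ((w - a%:C) ^+ 2 - (d ^+ 2)%:C) <= 5 * d * `|complex.Im w|.
    move=> ->; apply: (le_trans (ler_normcB _ _)); rewrite normcX normc_real ger0_norm ?exprn_ge0 //; last exact: ltW.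
    have : normc (w - a%:C) ^+ 2 <= (2 * d) ^+ 2.
      by rewrite lerXn2r ?nnegrE ?normc_ge0 // mulr_ge0 // ltW.
    rewrite !expr2; lra.
  case: wb => _ /= [] e.
  - by apply: ver; left. - by apply: ver; right.
  - by apply: hor; rewrite e sub0r normrN gtr0_norm.
  - by apply: hor; rewrite e add0r gtr0_norm.
have ysq : square a%:C d (a +i* y).
  move: yd; rewrite ler_norml => /andP[? ?].
  by split => /=; apply/andP; split; lra.
have [X1 X2] : complex.Re a%:C - d < complex.Re a%:C + d /\ complex.Im a%:C - d < complex.Im a%:C + d.
  by split => /=; lra.
have := @max_principle R _ _ _ _ X1 X2 h (5 * A * d) hh hb _ ysq.
have -> : h (a +i* y) = f (a +i* y) * - (y ^+ 2 + d ^+ 2)%:C.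
  by rewrite /h; congr (_ * _); apply/eqP; rewrite eq_complex /=; apply/andP; split; apply/eqP; ring.
rewrite normcM normcN normc_real ger0_norm ?addr_ge0 ?sqr_ge0 // => hE.
rewrite ler_pdivlMr // -(ler_pM2r d0) -mulrA -expr2.
by apply: le_trans hE; rewrite ler_wpM2l ?normc_ge0 // lerDr sqr_ge0.
Qed.

Section ExpBounded.
Variable p : R.
Hypothesis p0 : 0 <= p.

Lemma exp_boundedM f g : exp_bounded p f -> exp_bounded p g -> exp_bounded p (fun z => f z * g z).
Proof.
move=> [C1 C10 H1] [C2 C20 H2]; exists (C1 + C2); first exact: addr_ge0.
move=> z; rewrite normcM mulrDl expRD; apply: ler_pM; rewrite ?normc_ge0 ?H1 ?H2 //.
Qed.

Lemma exp_bounded_le2 f g h : exp_bounded p f -> exp_bounded p g ->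
  (forall z, normc (h z) <= normc (f z) + normc (g z)) -> exp_bounded p h.
Proof.
move=> [C1 C10 H1] [C2 C20 H2] H; exists (C1 + C2 + 1); first by rewrite !addr_ge0.
move=> z; apply: (le_trans (H z)); apply: (le_trans (lerD (H1 z) (H2 z))).
have x1 : 1 <= (1 + normc z) `^ p by apply: powR_ge1 => //; rewrite lerDl normc_ge0.
set x := _ `^ p in x1 *.
have a1 : expR (C1 * x) <= expR ((C1 + C2) * x).
  by rewrite ler_expR mulrDl lerDl mulr_ge0 // (le_trans ler01).
have a2 : expR (C2 * x) <= expR ((C1 + C2) * x).
  by rewrite ler_expR mulrDl lerDr mulr_ge0 // (le_trans ler01).
rewrite mulrDl mul1r expRD.
have : 2 <= expR x by apply: le_trans (expR_ge1Dx x); lra.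
have := expR_gt0 ((C1 + C2) * x) => e0 e2.
have : expR ((C1 + C2) * x) * 2 <= expR ((C1 + C2) * x) * expR x by rewrite ler_pM2l.
lra.
Qed.

Lemma exp_boundedB f g : exp_bounded p f -> exp_bounded p g -> exp_bounded p (fun z => f z - g z).
Proof. by move=> hf hg; apply: (exp_bounded_le2 hf hg) => z; exact: ler_normcB. Qed.

Lemma exp_bounded_cst c : exp_bounded p (fun=> c).
Proof.
exists (normc c) => [|z]; first exact: normc_ge0.
have x1 : 1 <= (1 + normc z) `^ p by apply: powR_ge1 => //; rewrite lerDl normc_ge0.
apply: le_trans (expR_ge1Dx _).
have : normc c * 1 <= normc c * (1 + normc z) `^ p by rewrite ler_wpM2l ?normc_ge0.
by lra.
Qed.

Lemma exp_bounded_ext f g : f =1 g -> exp_bounded p f -> exp_bounded p g.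
Proof. by move=> fg [C C0 H]; exists C => // z; rewrite -fg. Qed.

(** For [|Im z| >= 1] the hypothesis suffices. Inside the strip [im_bound] is used on the square of
    half-side 1 about [Re z], at the price of a factor 10. *)
Lemma exp_bounded_im P f : (forall z, hol P z) -> exp_bounded p f ->
  (forall z, complex.Im z != 0 -> normc (P z) <= normc (f z) * (1 + `|complex.Im z|^-1)) ->
  exp_bounded p P.
Proof.
move=> hP [C C0 HC] PC.
exists (10 + C * 3 `^ p) => [|z]; first by rewrite addr_ge0 // mulr_ge0 // powR_ge0.
have nz := normc_ge0 z.
have x1 : 1 <= (1 + normc z) `^ p by apply: powR_ge1 => //; rewrite lerDl.
set x := _ `^ p in x1 *.
set E := expR (C * (3 `^ p * x)).
have E0 : 0 < E by exact: expR_gt0.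
have fE w : normc w <= normc z + 2 -> normc (f w) <= E.
  move=> wz; apply: (le_trans (HC w)); rewrite ler_expR ler_wpM2l // /x -powRM //; last by lra.
  by apply: ge0_ler_powR => //; rewrite ?nnegrE; have := normc_ge0 w; lra.
suff : normc (P z) <= 10 * E.
  move=> h; apply: (le_trans h); rewrite [in leRHS]mulrDl expRD -mulrA -/E ler_wpM2r ?(ltW E0) //.
  apply: le_trans (expR_ge1Dx _); lra.
have [i1|i1] := leP 1 `|complex.Im z|.
  have i0 : complex.Im z != 0 by rewrite -normr_gt0 (lt_le_trans ltr01).
  apply: (le_trans (PC z i0)).
  have : normc (f z) * (1 + `|complex.Im z|^-1) <= E * 2.
    apply: ler_pM; rewrite ?normc_ge0 ?addr_ge0 ?invr_ge0 //; first by apply: fE; lra.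
    have : `|complex.Im z|^-1 <= 1 by rewrite invf_le1 // (lt_le_trans ltr01).
    by lra.
  by lra.
have sq w : square (complex.Re z)%:C 1 w -> normc w <= normc z + 2.
  move=> /square_normc h; apply: (le_trans (ler_normc_tri _ (complex.Re z)%:C)).
  by rewrite normc_real; have := Re_le_normc z; lra.
have im1 w : square (complex.Re z)%:C 1 w -> `|complex.Im w| <= 1.
  by move=> [_ /andP[/= ? ?]]; rewrite ler_norml; apply/andP; split; lra.
have := @im_bound P (complex.Re z) 1 (2 * E) ltr01 _ (fun w _ => hP w) _ (complex.Im z) (ltW i1).
have -> : complex.Re z +i* complex.Im z = z by case: (z).
move=> H; apply: le_trans (H _ _) _ => //.
- by rewrite mulr_ge0 // ltW.
- move=> w wsq i0; apply: (@le_trans _ _ (normc (f w) * (1 + `|complex.Im w|^-1) * `|complex.Im w|)).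
    by rewrite ler_wpM2r // PC.
  have w0 : 0 < `|complex.Im w| by rewrite normr_gt0.
  rewrite -mulrA mulrDl mul1r mulVf ?gt_eqF // mulrC.
  by apply: ler_pM; rewrite ?addr_ge0 ?normc_ge0 ?fE ?sq //; have := im1 w wsq; lra.
- by rewrite divr1 mulrA; lra.
Qed.

End ExpBounded.

Lemma mul_cexp_real (x y : R) (s : R) : s%:C * (x +i* y) = (s * x) +i* (s * y).
Proof. by rewrite (mkcE x y) (mkcE (s * x)) !rmorphM /=; ring. Qed.

Lemma cos_ge (x b : R) : 0 <= b -> b < pi / 2 -> `|x| <= b -> cos b <= cos x.
Proof.
move=> b0 bp xb; have pi0 := pi_gt0 R.
have -> : cos x = cos `|x|.
  by case: (leP 0 x) => x0; [rewrite ger0_norm|rewrite ltr0_norm // cosN].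
have [->//|ne] := eqVneq `|x| b.
apply: ltW; rewrite ltr_cos ?in_itv /=; first by rewrite lt_neqAle ne.
all: by apply/andP; split; have := normr_ge0 x; lra.
Qed.

(** In the coordinate [w] with [z = cexp w] the sector is a half strip and no branch of a power is
    needed. The factor exp (- e exp (si (w - i c))) has modulus exp (- e exp (si x) cos (si (y -
    c))): the cosine is bounded below as the opening is less than pi / si, and [p < si] makes it win
    against [F]. At the end [e] tends to 0. *)
Lemma sector F (al be si p C X0 : R) : (forall z, hol F z) -> exp_bounded p F -> 0 <= p -> p < si ->
  al < be -> (be - al) * si < pi -> 1 <= C ->
  (forall x, X0 <= x -> normc (F (cexp (x +i* al))) <= C) ->
  (forall x, X0 <= x -> normc (F (cexp (x +i* be))) <= C) ->
  (forall y, normc (F (cexp (X0 +i* y))) <= C) ->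
  forall x y, X0 <= x -> al <= y <= be -> normc (F (cexp (x +i* y))) <= C.
Proof.
move=> hF [K K0 FK] p0 psi ab absi C1 Fa Fb F0 x y xX /andP[ya yb].
have si0 : 0 < si by lra.
pose c := (al + be) / 2.
pose ka := cos (si * (be - al) / 2).
have ka0 : 0 < ka.
  have : 0 <= si * (be - al) by rewrite mulr_ge0 ?subr_ge0 // ltW.
  by move=> h; apply: cos_gt0_pihalf; apply/andP; split; have := pi_gt0 R; lra.
have coska v : al <= v <= be -> ka <= cos (si * (v - c)).
  move=> /andP[v1 v2].
  apply: cos_ge; [by rewrite divr_ge0 // mulr_ge0 ?subr_ge0 // ltW|lra|].
  rewrite normrM (gtr0_norm si0) -mulrA ler_wpM2l ?(ltW si0) //.
  by rewrite ler_norml /c; apply/andP; split; lra.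
suff key e : 0 < e -> normc (F (cexp (x +i* y))) <= C * expR (e * expR (si * x)).
  have lim e : 0 < e -> normc (F (cexp (x +i* y))) <= C + e.
    move=> e0; pose S := expR (si * x).
    have S0 : 0 < S by exact: expR_gt0.
    pose q := 1 + e / C.
    have q1 : 1 < q by rewrite /q ltrDl divr_gt0 // (lt_le_trans ltr01).
    have l0 : 0 < ln q / S by rewrite divr_gt0 // ln_gt0.
    have := key _ l0; rewrite -/S divfK ?gt_eqF // lnK ?posrE; last by lra.
    by rewrite /q mulrDr mulr1 mulrCA divff ?mulr1 // gt_eqF // (lt_le_trans ltr01).
  by apply/ler_addgt0Pr => e /lim.
move=> e0.
pose h w := F (cexp w) * cexp (- (e%:C * cexp (si%:C * (w - 'i * c%:C)))).
have hh w : hol h w.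
  apply: holM; first by apply: (hol_comp (hol_cexp w)).
  apply: (@hol_comp _ (fun w => - (e%:C * cexp (si%:C * (w - 'i * c%:C)))) (@cexp R)); last exact: hol_cexp.
  apply: holN; apply: holM; first exact: hol_cst.
  apply: (@hol_comp _ (fun w => si%:C * (w - 'i * c%:C)) (@cexp R)); last exact: hol_cexp.
  by apply: holM; [exact: hol_cst|exact: hol_subC].
have nh u v : normc (h (u +i* v)) = normc (F (cexp (u +i* v))) * expR (- (e * (expR (si * u) * cos (si * (v - c))))).
  rewrite /h normcM normc_cexp; congr (_ * expR _).
  have -> : (u +i* v) - 'i * c%:C = u +i* (v - c).
    by apply/eqP; rewrite eq_complex /=; apply/andP; split; apply/eqP; ring.
  rewrite mul_cexp_real /cexp /=; ring.
pose A := K * 2 `^ p / (e * ka).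
have A0 : 0 <= A by rewrite divr_ge0 // mulr_ge0 ?powR_ge0 // ltW.
(* The right edge must lie beyond [x] and so far out that [A * expR (p * X1) <= expR (si * X1)]; the
   damping then beats the growth of [F] on it. *)
pose X1 := Num.max (Num.max (x + 1) (X0 + 1)) (Num.max 0 (ln (A + 1) / (si - p))).
have X1x : x + 1 <= X1 by rewrite !le_max lexx.
have X1X0 : X0 + 1 <= X1 by rewrite !le_max lexx orbT.
have X10 : 0 <= X1 by rewrite !le_max lexx !orbT.
have X1l : ln (A + 1) / (si - p) <= X1 by rewrite !le_max lexx !orbT.
have big v : al <= v <= be -> K * (1 + expR X1) `^ p <= e * (expR (si * X1) * cos (si * (v - c))).
  move=> /coska vk.
  have b1 : (1 + expR X1) `^ p <= 2 `^ p * expR (p * X1).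
    have -> : expR (p * X1) = expR X1 `^ p by rewrite [p * X1]mulrC expRM.
    rewrite -powRM // ?expR_ge0 //.
    have e1 : 1 <= expR X1 by rewrite -expR0 ler_expR.
    by apply: ge0_ler_powR => //; rewrite ?nnegrE; lra.
  have b2 : A * expR (p * X1) <= expR (si * X1).
    have -> : si * X1 = (si - p) * X1 + p * X1 by ring.
    rewrite expRD ler_wpM2r ?expR_ge0 //.
    move: X1l; rewrite ler_pdivrMr ?subr_gt0 // mulrC -ler_expR lnK ?posrE; last by lra.
    by lra.
  have -> : e * (expR (si * X1) * cos (si * (v - c))) = expR (si * X1) * (e * cos (si * (v - c))) by ring.
  apply: (@le_trans _ _ (expR (si * X1) * (e * ka))); last first.
    by rewrite ler_wpM2l ?expR_ge0 // ler_wpM2l // ltW.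
  have ek : 0 < e * ka by rewrite mulr_gt0.
  apply: (@le_trans _ _ (A * expR (p * X1) * (e * ka))); last by rewrite ler_wpM2r // ltW.
  apply: (le_trans (ler_wpM2l K0 b1)).
  by rewrite le_eqVlt; apply/orP; left; apply/eqP; rewrite /A; field; rewrite !gt_eqF.
have hb w : bdr X0 X1 al be w -> normc (h w) <= C.
  case: w => u v [[/= /andP[u1 u2] v12] E]; rewrite nh.
  have e1 : expR (- (e * (expR (si * u) * cos (si * (v - c))))) <= 1.
    rewrite -expR0 ler_expR oppr_le0 !mulr_ge0 ?expR_ge0 ?(ltW e0) //.
    by apply: (le_trans (ltW ka0)); exact: coska.
  have red : normc (F (cexp (u +i* v))) <= C ->
     normc (F (cexp (u +i* v))) * expR (- (e * (expR (si * u) * cos (si * (v - c))))) <= C.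
    by move=> hC; rewrite -[C]mulr1; apply: ler_pM; rewrite ?normc_ge0 ?expR_ge0.
  case: E => /= E; try by apply: red; rewrite E; auto.
  rewrite E; apply: le_trans C1.
  apply: (@le_trans _ _ (expR (K * (1 + expR X1) `^ p) * expR (- (e * (expR (si * X1) * cos (si * (v - c))))))).
    rewrite ler_wpM2r ?expR_ge0 //; apply: (le_trans (FK _)); rewrite normc_cexp /= //.
  by rewrite -expRD; have h0 := big v v12; rewrite -subr_le0 -ler_expR expR0 in h0.
have X01 : X0 < X1 by lra.
have := @max_principle R _ _ _ _ X01 ab h C (fun w _ => hh w) hb (x +i* y).
move=> /(_ _) H; have {}H : normc (h (x +i* y)) <= C by apply: H; split => /=; apply/andP; split; lra.
rewrite nh in H.
rewrite -ler_pdivrMr ?expR_gt0 // -expRN; apply: le_trans H.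
rewrite ler_wpM2l ?normc_ge0 // ler_expR lerN2 ler_wpM2l ?(ltW e0) //.
by rewrite ler_piMr ?expR_ge0 // cos_le1.
Qed.

Lemma cexp_2pi (x y : R) (k : int) : cexp (x +i* (y + k%:~R * (2 * pi))) = cexp (x +i* y).
Proof.
have nat_case (n : nat) (v : R) : cexp (x +i* (v + n%:R * (2 * pi))) = cexp (x +i* v).
  elim: n v => [|n ih] v; first by rewrite mul0r addr0.
  rewrite -natr1 mulrDl mul1r addrA /cexp /=.
  have -> : v + n%:R * (2 * pi) + 2 * pi = (v + n%:R * (2 * pi)) + pi *+ 2 by rewrite [pi *+ 2]mulr2n; ring.
  by rewrite cosD2pi sinD2pi; exact: ih.
case: k => n; first by rewrite -pmulrn; exact: nat_case.
rewrite NegzE mulrNz -pmulrn -[in RHS](nat_case n.+1) mulNr.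
by rewrite -(nat_case n.+1 (y - _)) -addrA addNr addr0 nat_case.
Qed.

(** The argument is taken in the period starting at a prescribed [t0], to match rays counted from
    the angle [t 0]. *)
Lemma polar z (t0 : R) : z != 0 -> exists2 y : R, t0 <= y <= t0 + 2 * pi & z = cexp (ln (normc z) +i* y).
Proof.
move=> z0; have n0 : 0 < normc z by rewrite normc_gt0.
have pi0 := pi_gt0 R.
have [v vE] : exists v, z = cexp (ln (normc z) +i* v).
  pose a := complex.Re z / normc z; pose b := complex.Im z / normc z.
  have ab : a ^+ 2 + b ^+ 2 = 1.
    by rewrite /a /b !expr_div_n -mulrDl -normc_sqr divff // expf_neq0 // gt_eqF.
  have a1 : -1 <= a <= 1.
    by rewrite -ler_norml /a normrM normfV (gtr0_norm n0) ler_pdivrMr // mul1r Re_le_normc.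
  have ca : cos (acos a) = a by apply: acosK; rewrite in_itv.
  have sa : sin (acos a) = `|b|.
    have e : 1 - a ^+ 2 = b ^+ 2 by lra.
    by rewrite sin_acos // e sqrtr_sqr.
  have zE : z = (normc z * a) +i* (normc z * b).
    by rewrite /a /b ![normc z * _]mulrC !divfK ?gt_eqF //; case: (z).
  have [b0|b0] := leP 0 b.
    exists (acos a); rewrite /cexp /= lnK // ca sa ger0_norm //.
  exists (- acos a); rewrite /cexp /= lnK // cosN sinN ca sa ltr0_norm // opprK //.
pose k := Num.floor ((v - t0) / (2 * pi)).
have pp : 0 < 2 * pi :> R by rewrite mulr_gt0.
exists (v + (- k)%:~R * (2 * pi)); last by rewrite cexp_2pi.
have k1 : k%:~R * (2 * pi) <= v - t0 by rewrite -ler_pdivlMr // floor_le.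
have k2 : v - t0 <= (k%:~R + 1) * (2 * pi).
  by rewrite -ler_pdivrMr // ltW // -[1]/(1%:~R) -intrD; exact: floorD1_gt.
by rewrite mulrNz mulNr; apply/andP; split; lra.
Qed.

Lemma ray_cexp (t r : R) : 0 < r -> ray t r = cexp (ln r +i* t).
Proof. by move=> r0; rewrite /ray /cexp /= lnK. Qed.

Theorem phragmen_lindelof F (p si : R) (m : nat) (t : nat -> R) :
  (forall z, hol F z) -> exp_bounded p F -> 0 <= p -> p < si ->
  dissecting_rays (pi / si) m t -> (forall k, (k < m)%N -> bounded_along (t k) F) ->
  forall z, F z = F 0.
Proof.
move=> hF Fp p0 psi [m0 tm tk] bt.
have si0 : 0 < si by lra.
have [K K0 FK] := Fp.
have ray2pi r : ray (t m) r = ray (t 0%N) r.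
  by rewrite /ray tm [2 * pi]mulr_natl cosD2pi sinD2pi.
have [C [r0 [C1 r01 HC]]] : exists C r0 : R, [/\ 1 <= C, 1 <= r0 &
    forall k r, (k <= m)%N -> r0 <= r -> normc (F (ray (t k) r)) <= C].
  have aux n : (n <= m)%N -> exists C r0 : R, [/\ 1 <= C, 1 <= r0 &
    forall k r, (k < n)%N -> r0 <= r -> normc (F (ray (t k) r)) <= C].
    elim: n => [|n ih] nm; first by exists 1, 1; split.
    have [C [r0 [C1 r01 H]]] := ih (ltnW nm).
    have [C' [M [_ HM]]] := bt n nm.
    exists (Num.max C C'), (Num.max r0 (M + 1)); split.
    - by rewrite le_max C1. - by rewrite le_max r01.
    move=> k r; rewrite ltnS leq_eqVlt => /orP[/eqP ->|kn]; rewrite ge_max => /andP[h1 h2].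
      by rewrite le_max HM ?orbT //; lra.
    by rewrite le_max H.
  have [C [r0 [C1 r01 H]]] := aux m (leqnn m).
  exists C, r0; split => // k r; rewrite leq_eqVlt => /orP[/eqP ->|kn]; last exact: H.
  by rewrite ray2pi; apply: H.
pose X0 := ln r0.
have r00 : 0 < r0 by lra.
(* Besides the rays, [D] covers the disc of radius [r0], whose boundary arcs close the sectors. *)
pose D := Num.max C (expR (K * (1 + r0) `^ p)).
have D1 : 1 <= D by rewrite le_max C1.
have FD0 z : normc z <= r0 -> normc (F z) <= D.
  move=> zr; rewrite le_max; apply/orP; right; apply: (le_trans (FK z)).
  rewrite ler_expR ler_wpM2l //; apply: ge0_ler_powR => //; rewrite ?nnegrE; have := normc_ge0 z; lra.
have rayD k x : (k <= m)%N -> X0 <= x -> normc (F (cexp (x +i* t k))) <= D.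
  move=> km xX; rewrite -[x]expRK -ray_cexp ?expR_gt0 // le_max HC //.
  by rewrite -(lnK (_ : r0 \in Num.pos)) ?posrE // ler_expR.
apply: (liouville (M := D)) => // z.
have [zr|zr] := leP (normc z) r0; first exact: FD0.
have z0 : z != 0 by rewrite -normc_gt0 (lt_trans r00).
have [y yt zE] := polar (t 0%N) z0.
have lX : X0 <= ln (normc z) by rewrite ler_ln ?posrE ?ltW // (lt_trans r00).
have [k km yk] : exists2 k, (k < m)%N & t k <= y <= t k.+1.
  move: yt; rewrite -tm => /andP[y0 ym].
  (* The alternative [y = t 0] serves the base of the induction; it belongs to the first sector. *)
  have : forall n, (n <= m)%N -> y <= t n -> exists2 k, (k < m)%N & t k <= y <= t k.+1 \/ y = t 0%N.
    elim=> [|n ih] nm yn; first by exists 0%N => //; right; apply/eqP; rewrite eq_le y0 yn.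
    have [yn'|yn'] := leP y (t n); first exact: (ih (ltnW nm)).
    by exists n => //; left; rewrite yn andbT ltW.
  move=> /(_ m (leqnn m) ym)[k km [h|h]]; first by exists k.
  exists 0%N => //; rewrite h lexx /=; by have [/ltW t01 _ _] := tk 0%N m0; rewrite h in y0 *.
rewrite zE; have [ltk gap _] := tk k km.
apply: (@sector F (t k) (t k.+1) si p D X0) => //.
- by rewrite -ltr_pdivlMr.
- by move=> x; apply: rayD; exact: ltnW.
- by move=> x; exact: rayD.
- by move=> v; apply: FD0; rewrite normc_cexp /= lnK.
Qed.

End PhragmenLindelof.

(** * Jacobi operators: Wronskians and Green functions *)

Section Windows.
Variable R : realType.
Implicit Types (f g u : int -> R[i]) (h : int -> R).

(** This moves summability from sums in the extended reals to uniform bounds on finite real sums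
    along an enumeration, the form used from here on. *)
Lemma esum_nat_le (D : set int) (e : nat -> int) h (A : R) : set_bij setT D e ->
  (forall n, 0 <= h n) ->
  (\esum_(n in D) (h n)%:E <= A%:E)%E <-> forall N, \sum_(k < N) h (e k) <= A.
Proof.
move=> eD h0; rewrite (reindex_esum setT D e _ eD) -nneseries_esumT; last by move=> n; rewrite lee_fin.
have nd : {homo (fun n => \sum_(0 <= i < n) (h (e i))%:E)%E : n m / (n <= m)%N >-> (n <= m)%E}.
  by move=> n m nm; apply: lee_sum_nneg_natr => // k _ _; rewrite lee_fin.
split=> [H N|H].
- rewrite -lee_fin; apply: le_trans H.
  rewrite -sumEFin -(big_mkord xpredT (fun k => (h (e k))%:E)).
  by apply: nneseries_lim_ge => k _; rewrite lee_fin.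
- apply: lime_le; first by apply: is_cvg_nneseries => k _ _; rewrite lee_fin.
  by near=> N; rewrite big_mkord sumEFin lee_fin.
Unshelve. all: by end_near. Qed.

Lemma bij_pos : set_bij setT (near_pinfty : set int) (fun k : nat => k%:Z).
Proof.
split.
- by move=> k _ /=; rewrite /near_pinfty /=.
- by move=> k l _ _ [].
- by move=> [k|k] //= _; exists k.
Qed.

Lemma bij_neg : set_bij setT (near_ninfty : set int) (fun k : nat => - k%:Z).
Proof.
split.
- by move=> k _ /=; rewrite /near_ninfty /=; lia.
- by move=> k l _ _; lia.
- move=> k /=; rewrite /near_ninfty /= => k0; exists `|k|%N => //; lia.
Qed.

(** The two half-lines share the point 0, so the whole line is split into the non-negative integers
    and this complement instead. *)
Lemma bij_negS : set_bij setT (~` (near_pinfty : set int)) (fun k : nat => - (k.+1)%:Z).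
Proof.
split.
- by move=> k _ /=; rewrite /near_pinfty /=; lia.
- by move=> k l _ _; lia.
- move=> k /=; rewrite /near_pinfty /= => k0; exists `|k|.-1%N => //; lia.
Qed.

Definition pbounded f := exists A : R, forall N, \sum_(k < N) normc (f k%:Z) ^+ 2 <= A.
Definition nbounded f := exists A : R, forall N, \sum_(k < N) normc (f (- k%:Z)) ^+ 2 <= A.

Lemma lty_le (x : \bar R) : (0 <= x)%E -> (x < +oo)%E <-> exists A : R, (x <= A%:E)%E.
Proof.
move=> x0; split => [h|[A h]]; last by rewrite (le_lt_trans h) // ltry.
by exists (fine x); rewrite fineK // ge0_fin_numE.
Qed.

Lemma normsq_ge0 D f : (0 <= normsq D f)%E.
Proof. by apply: esum_ge0 => n _; rewrite lee_fin exprn_ge0 // normc_ge0. Qed.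

Lemma sq_ge0 f n : 0 <= normc (f n) ^+ 2.
Proof. by rewrite exprn_ge0 // normc_ge0. Qed.

Lemma pboundedP f : square_summable near_pinfty f <-> pbounded f.
Proof.
rewrite /square_summable lty_le ?normsq_ge0 //; split=> -[A H]; exists A.
- by apply/(esum_nat_le A bij_pos (sq_ge0 f)).
- exact/(esum_nat_le A bij_pos (sq_ge0 f)).
Qed.

Lemma nboundedP f : square_summable near_ninfty f <-> nbounded f.
Proof.
rewrite /square_summable lty_le ?normsq_ge0 //; split=> -[A H]; exists A.
- by apply/(esum_nat_le A bij_neg (sq_ge0 f)).
- exact/(esum_nat_le A bij_neg (sq_ge0 f)).
Qed.

(* The sum of [h] over [- N, N). *)
Definition win (V : nmodType) (h : int -> V) (N : nat) : V :=
  \sum_(k < N) h k%:Z + \sum_(k < N) h (- (k.+1)%:Z).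

Lemma winS (V : nmodType) (h : int -> V) N :
  win h N.+1 = win h N + (h N%:Z + h (- (N.+1)%:Z)).
Proof. by rewrite /win !big_ord_recr /= addrACA. Qed.

Definition sqb f (A : R) := forall N, win (fun n => normc (f n) ^+ 2) N <= A.

Lemma win_mono (h : int -> R) N M : (forall n, 0 <= h n) -> (N <= M)%N -> win h N <= win h M.
Proof.
move=> h0 /subnKC <-; elim: (M - N)%N => [|k ih]; first by rewrite addn0.
by rewrite addnS winS (le_trans ih) // lerDl addr_ge0.
Qed.

Lemma win_le (h h' : int -> R) N : (forall n, h n <= h' n) -> win h N <= win h' N.
Proof. by move=> H; rewrite lerD // ler_sum. Qed.

Lemma winD (V : nmodType) (h h' : int -> V) N : win (fun n => h n + h' n) N = win h N + win h' N.
Proof. by rewrite /win !big_split /= addrACA. Qed.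

Lemma winZ (V : pzRingType) (c : V) (h : int -> V) N : win (fun n => c * h n) N = c * win h N.
Proof. by rewrite /win mulrDr !mulr_sumr. Qed.

Lemma win_ext (V : nmodType) (h h' : int -> V) N : h =1 h' -> win h N = win h' N.
Proof. by move=> H; rewrite /win; congr (_ + _); apply: eq_bigr => k _. Qed.

Lemma win_norm (h : int -> R[i]) N : normc (win h N) <= win (fun n => normc (h n)) N.
Proof. by apply: (le_trans (le_normcD _ _)); rewrite lerD // normc_sum. Qed.

Lemma win_ge (h : int -> R) n : (forall n, 0 <= h n) -> h n <= win h (`|n|%N).+1.
Proof.
move=> h0; rewrite winS; case: n => n /=.
- have := win_mono h0 (leq0n n); rewrite {1}/win !big_ord0 addr0 => w0.
  by have := h0 (- (n.+1)%:Z); have := h0 n%:Z; lra.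
- rewrite winS.
  have := win_mono h0 (leq0n n); rewrite {1}/win !big_ord0 addr0 => w0.
  have := h0 (- (n.+2)%:Z); have := h0 n%:Z; have := h0 n.+1%:Z; rewrite NegzE; lra.
Qed.

Lemma win_delta (V : pzRingType) (c : int -> V) n N : (`|n| < N)%N ->
  win (fun k => c k * (k == n)%:R) N = c n.
Proof.
have pick (e : nat -> int) j : injective e -> (j < N)%N -> n = e j ->
    \sum_(k < N) c (e k) * (e k == n)%:R = c n.
  move=> ei jN nE; rewrite (bigD1 (Ordinal jN)) //= -nE eqxx mulr1 big1 ?addr0 // => k kj.
  have -> : (e k == n) = false; last by rewrite mulr0.
  by apply: contra_neqF kj => /eqP; rewrite nE => /ei kE; exact: val_inj.
have skip (e : nat -> int) : (forall j, e j != n) -> \sum_(k < N) c (e k) * (e k == n)%:R = 0.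
  by move=> ne; apply: big1 => k _; rewrite (negbTE (ne k)) mulr0.
case: (intP n) pick skip => [|j|j] pick skip jN.
- rewrite /win (pick (fun k => k%:Z) 0%N) //; last by move=> k l [].
  by rewrite (skip (fun k => - (k.+1)%:Z)) ?addr0 // => k; apply/eqP; lia.
- rewrite /win (pick (fun k => k%:Z) j.+1) //; last by move=> k l [].
  by rewrite (skip (fun k => - (k.+1)%:Z)) ?addr0 // => k; apply/eqP; lia.
- rewrite /win (skip (fun k => k%:Z)); last by move=> k; apply/eqP; lia.
  rewrite (pick (fun k => - (k.+1)%:Z) j) ?add0r //; first by move=> k l; lia.
  by move: jN; lia.
Qed.

Lemma normsq_le f (A : R) : (normsq setT f <= A%:E)%E <-> sqb f A.
Proof.
rewrite /normsq (esumID near_pinfty); last by move=> n _; rewrite lee_fin sq_ge0.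
rewrite !setTI; set P := esum _ _; set Q := esum _ _.
have P0 : (0 <= P)%E by apply: esum_ge0 => n _; rewrite lee_fin sq_ge0.
have Q0 : (0 <= Q)%E by apply: esum_ge0 => n _; rewrite lee_fin sq_ge0.
split=> [H N|H].
- have fP : P \is a fin_num.
    by rewrite ge0_fin_numE // (le_lt_trans _ (ltry A)) // (le_trans _ H) // leeDl.
  have fQ : Q \is a fin_num.
    by rewrite ge0_fin_numE // (le_lt_trans _ (ltry A)) // (le_trans _ H) // leeDr.
  have hP : (P <= (fine P)%:E)%E by rewrite fineK.
  have hQ : (Q <= (fine Q)%:E)%E by rewrite fineK.
  have := (esum_nat_le _ bij_pos (sq_ge0 f)).1 hP N.
  have := (esum_nat_le _ bij_negS (sq_ge0 f)).1 hQ N.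
  move: H; rewrite -(fineK fP) -(fineK fQ) -EFinD lee_fin /win; lra.
(* Independent lengths for the two halves allow one series to be summed while the other is still a
   partial sum. *)
- have bp N M : \sum_(k < N) normc (f k%:Z) ^+ 2 + \sum_(k < M) normc (f (- (k.+1)%:Z)) ^+ 2 <= A.
    apply: le_trans (H (maxn N M)); rewrite /win.
    have mono (e : nat -> int) N' M' : (N' <= M')%N -> \sum_(k < N') normc (f (e k)) ^+ 2 <= \sum_(k < M') normc (f (e k)) ^+ 2.
      move=> NM; rewrite -(subnKC NM) big_split_ord /= lerDl.
      by apply: sumr_ge0 => i _; exact: sq_ge0.
    by rewrite lerD // (mono (fun k => k%:Z), mono (fun k => - (k.+1)%:Z)) // ?leq_maxl ?leq_maxr.
  have A0 : 0 <= A by have := H 0%N; rewrite /win !big_ord0 addr0.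
  have hP : (P <= A%:E)%E.
    apply/(esum_nat_le _ bij_pos (sq_ge0 f)) => N.
    by have := bp N 0%N; rewrite big_ord0 addr0.
  have fP : P \is a fin_num by rewrite ge0_fin_numE // (le_lt_trans hP) // ltry.
  have hQ : (Q <= (A - fine P)%:E)%E.
    apply/(esum_nat_le _ bij_negS (sq_ge0 f)) => M.
    have : (P <= (A - \sum_(k < M) normc (f (- (k.+1)%:Z)) ^+ 2)%:E)%E.
      apply/(esum_nat_le _ bij_pos (sq_ge0 f)) => N.
      by have := bp N M; lra.
    by rewrite -{1}(fineK fP) lee_fin; lra.
  rewrite -(fineK fP); apply: (le_trans (leeD2l _ hQ)).
  by rewrite -EFinD lee_fin; lra.
Qed.

Lemma ell2P f : ell2 f <-> exists A, sqb f A.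
Proof.
rewrite /ell2 /square_summable /= lty_le ?normsq_ge0 //; split=> -[A H]; exists A; exact/normsq_le.
Qed.

Lemma sqb_pbounded f A : sqb f A -> pbounded f.
Proof.
move=> H; exists A => N; apply: le_trans (H N); rewrite lerDl.
by apply: sumr_ge0 => i _; exact: sq_ge0.
Qed.

Lemma sqb_nbounded f A : sqb f A -> nbounded f.
Proof.
move=> H; exists (normc (f 0) ^+ 2 + A) => -[|N].
  rewrite big_ord0; have := H 0%N; rewrite /win !big_ord0 addr0 => A0.
  by rewrite addr_ge0 ?sq_ge0.
rewrite big_ord_recl /= oppr0 lerD2l; apply: le_trans (H N); rewrite lerDr.
by apply: sumr_ge0 => i _; exact: sq_ge0.
Qed.

Lemma bounded_sqb f : pbounded f -> nbounded f -> exists A, sqb f A.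
Proof.
move=> [A HA] [B HB]; exists (A + B) => N; rewrite lerD //.
apply: le_trans (HB N.+1); rewrite big_ord_recl /= lerDr; exact: sq_ge0.
Qed.

Lemma ell2_bounded f : ell2 f <-> pbounded f /\ nbounded f.
Proof.
rewrite ell2P; split => [[A H]|[p n]]; last exact: bounded_sqb.
by split; [exact: sqb_pbounded H|exact: sqb_nbounded H].
Qed.

End Windows.

(** * Null sequences, square-summable sequences and Gronwall's lemma *)

Section NatSequences.
Variable R : realType.
Implicit Types (w f g u F G y : nat -> R[i]) (c e : nat -> R).

Definition clim0 w := forall e : R, 0 < e -> exists N, forall k, (N <= k)%N -> normc (w k) <= e.

Lemma clim0P w : (w @ \oo --> (0 : R[i])) <-> clim0 w.
Proof.
split=> [/cvgrPdist_le H e e0|H].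
- have /H[N _ HN] : (0 : R[i]) < e%:C by rewrite ltcR.
  by exists N => k /HN /=; rewrite sub0r normrN normr_normc lecR.
- apply/cvgrPdist_le => /= e e0.
  have er : 0 < complex.Re e by move: e0; rewrite ltcE /= => /andP[].
  have eE : e = (complex.Re e)%:C.
    by move: e0; rewrite ltcE /= => /andP[/eqP i0 _]; rewrite [LHS]complexE i0 mulr0 addr0.
  have [N HN] := H _ er; exists N => // k /HN h /=.
  by rewrite sub0r normrN normr_normc eE lecR.
Qed.

Lemma clim0M w (M : R) v : clim0 w -> (forall k, normc (v k) <= M) -> clim0 (fun k => v k * w k).
Proof.
move=> hw hv e e0; have M0 : 0 < `|M| + 1 by rewrite ltr_wpDl.
have [|N HN] := hw (e / (`|M| + 1)); first by rewrite divr_gt0.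
exists N => k /HN h; rewrite normcM; apply: (@le_trans _ _ ((`|M| + 1) * (e / (`|M| + 1)))).
  apply: ler_pM; rewrite ?normc_ge0 //; apply: (le_trans (hv k)).
  by have := ler_norm M; lra.
by rewrite mulrC divfK // gt_eqF.
Qed.

Lemma clim0D w v : clim0 w -> clim0 v -> clim0 (fun k => w k + v k).
Proof.
move=> hw hv e e0; have e2 : 0 < e / 2 by rewrite divr_gt0.
have [N1 H1] := hw _ e2; have [N2 H2] := hv _ e2.
exists (maxn N1 N2) => k; rewrite geq_max => /andP[/H1 h1 /H2 h2].
by apply: (le_trans (le_normcD _ _)); lra.
Qed.

Lemma clim0Z (c : R[i]) w : clim0 w -> clim0 (fun k => c * w k).
Proof. by move=> hw; apply: (@clim0M _ (normc c) (fun=> c)). Qed.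

Lemma clim0_eventually w v N : (forall k, (N <= k)%N -> w k = v k) -> clim0 v -> clim0 w.
Proof.
move=> wv hv e /hv[M HM]; exists (maxn N M) => k; rewrite geq_max => /andP[/wv -> /HM].
exact.
Qed.

Lemma clim0_shift w m : clim0 (fun k => w (k + m)%N) <-> clim0 w.
Proof.
split=> H e /H[N HN]; first by exists (N + m)%N => k Nk; have := HN (k - m)%N; rewrite subnK; [apply; lia|lia].
by exists N => k Nk; apply: HN; lia.
Qed.

Lemma clim0_cst (c : R[i]) : clim0 (fun=> c) -> c = 0.
Proof. by move=> H; apply: normc_le_eps => e /H[N /(_ N (leqnn N))]. Qed.

Definition seqb f := exists A : R, forall N, \sum_(k < N) normc (f k) ^+ 2 <= A.

Lemma sum_sq_mono f N M : (N <= M)%N -> \sum_(k < N) normc (f k) ^+ 2 <= \sum_(k < M) normc (f k) ^+ 2.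
Proof.
move=> NM; rewrite -(subnKC NM) big_split_ord /= lerDl.
by apply: sumr_ge0 => i _; rewrite exprn_ge0 // normc_ge0.
Qed.

Lemma seqb_shift f m : seqb (fun k => f (m + k)%N) <-> seqb f.
Proof.
split=> -[A HA].
- exists (\sum_(k < m) normc (f k) ^+ 2 + A) => N.
  apply: (le_trans (sum_sq_mono f (leq_addl m N))).
  by rewrite big_split_ord /= lerD2l; exact: HA.
- exists A => N; apply: le_trans (HA (m + N)%N).
  rewrite big_split_ord /= lerDr; by apply: sumr_ge0 => i _; rewrite exprn_ge0 // normc_ge0.
Qed.

Lemma seqb_le f g h (C : R) : 0 <= C -> seqb f -> seqb g ->
  (forall k, normc (h k) ^+ 2 <= C * (normc (f k) ^+ 2 + normc (g k) ^+ 2)) -> seqb h.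
Proof.
move=> C0 [A HA] [B HB] H; exists (C * (A + B)) => N.
apply: (@le_trans _ _ (\sum_(k < N) (C * (normc (f k) ^+ 2 + normc (g k) ^+ 2)))).
  by apply: ler_sum => k _.
by rewrite -mulr_sumr big_split /=; apply: (ler_wpM2l C0); apply: lerD; [exact: HA|exact: HB].
Qed.

Lemma gronwall (y c : nat -> R) (C : R) : (forall n, 0 <= y n) -> (forall n, 0 <= c n) ->
  (forall n, y n.+1 <= (1 + c n) * y n) -> (forall N, \sum_(k < N) c k <= C) ->
  forall n, y n <= y 0%N * expR C.
Proof.
move=> y0 c0 yS cC n.
apply: (@le_trans _ _ (y 0%N * expR (\sum_(k < n) c k))); last by rewrite ler_wpM2l // ler_expR.
elim: n => [|n ih]; first by rewrite big_ord0 expR0 mulr1.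
apply: (le_trans (yS n)); rewrite big_ord_recr /= expRD mulrA mulrC.
apply: ler_pM => //; first by rewrite addr_ge0.
exact: expR_ge1Dx.
Qed.

(** Variation of constants. In the application [w] is the Wronskian of [f] and [g], [y1] and [y2]
    are those of a solution [u] with [f] and [g], and [F], [G] are [(tau - z) f] and [(tau - z) g].
    Square summability makes the Gronwall coefficients summable, so [y1] and [y2] stay bounded and
    [u] is controlled by [f] and [g]. *)
Lemma gronwall_seqb f g F G u w y1 y2 (d : R) : 0 < d ->
  (forall n, d <= normc (w n)) ->
  (forall n, u n.+1 * w n = y2 n * f n.+1 - y1 n * g n.+1) ->
  (forall n, y1 n.+1 = y1 n + u n.+1 * F n.+1) ->
  (forall n, y2 n.+1 = y2 n + u n.+1 * G n.+1) ->
  seqb f -> seqb g -> seqb F -> seqb G -> seqb u.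
Proof.
move=> d0 wd uE y1S y2S fb gb [A3 FA] [A4 GA].
have [A1 fA] := fb; have [A2 gA] := gb.
pose y n := normc (y1 n) + normc (y2 n).
have y0 n : 0 <= y n by rewrite addr_ge0 // normc_ge0.
have ub n : normc (u n.+1) <= y n * (normc (f n.+1) + normc (g n.+1)) / d.
  rewrite ler_pdivlMr //; apply: (@le_trans _ _ (normc (u n.+1) * normc (w n))).
    by rewrite ler_wpM2l ?normc_ge0.
  rewrite -normcM uE; apply: (le_trans (ler_normcB _ _)); rewrite !normcM /y.
  have := mulr_ge0 (normc_ge0 (y1 n)) (normc_ge0 (f n.+1)).
  have := mulr_ge0 (normc_ge0 (y2 n)) (normc_ge0 (g n.+1)); lra.
(* Each mixed product of an [f] or [g] entry with an [F] or [G] entry is at most half the sum of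
   their squares. *)
pose c n := (normc (f n.+1) ^+ 2 + normc (g n.+1) ^+ 2 + normc (F n.+1) ^+ 2 + normc (G n.+1) ^+ 2) / d.
have c0 n : 0 <= c n by rewrite divr_ge0 ?(ltW d0) // !addr_ge0 // exprn_ge0 // normc_ge0.
have yS n : y n.+1 <= (1 + c n) * y n.
  have h : y n.+1 <= y n + normc (u n.+1) * (normc (F n.+1) + normc (G n.+1)).
    rewrite /y y1S y2S.
    have := le_normcD (y1 n) (u n.+1 * F n.+1); have := le_normcD (y2 n) (u n.+1 * G n.+1).
    rewrite !normcM; lra.
  apply: (le_trans h); rewrite mulrDl mul1r lerD2l.
  set s := normc (f n.+1); set t := normc (g n.+1) in ub *.
  set p := normc (F n.+1); set q := normc (G n.+1).
  have p0 : 0 <= p + q by rewrite addr_ge0 // normc_ge0.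
  apply: (le_trans (ler_wpM2r p0 (ub n))); rewrite -/s -/t.
  have -> : y n * (s + t) / d * (p + q) = ((s + t) * (p + q)) * (y n / d) by ring.
  have -> : c n * y n = (s ^+ 2 + t ^+ 2 + p ^+ 2 + q ^+ 2) * (y n / d) by rewrite /c -/s -/t -/p -/q; ring.
  rewrite ler_wpM2r ?divr_ge0 ?(ltW d0) //.
  have := sqr_ge0 (s - p); have := sqr_ge0 (s - q); have := sqr_ge0 (t - p); have := sqr_ge0 (t - q).
  rewrite !sqrrB; rewrite !mulr2n; lra.
have cC N : \sum_(k < N) c k <= (A1 + A2 + A3 + A4) / d.
  rewrite -mulr_suml ler_pM2r ?invr_gt0 // !big_split /=.
  have sh (h : nat -> R[i]) (A : R) : (forall N, \sum_(k < N) normc (h k) ^+ 2 <= A) -> \sum_(k < N) normc (h k.+1) ^+ 2 <= A.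
    by move=> H; apply: le_trans (H N.+1); rewrite big_ord_recl /= lerDr exprn_ge0 // normc_ge0.
  exact: (lerD (lerD (lerD (sh _ _ fA) (sh _ _ gA)) (sh _ _ FA)) (sh _ _ GA)).
have yb := gronwall y0 c0 yS cC.
set Y := y 0%N * _ in yb.
have Y0 : 0 <= Y by apply: le_trans (yb 0%N).
apply/(seqb_shift u 1).
apply: (@seqb_le (fun k => f (1 + k)%N) (fun k => g (1 + k)%N) _ (2 * (Y / d) ^+ 2)).
- by rewrite mulr_ge0 // sqr_ge0.
- by apply/(seqb_shift f 1).
- by apply/(seqb_shift g 1).
move=> k; rewrite add1n.
have h : normc (u k.+1) <= (Y / d) * (normc (f k.+1) + normc (g k.+1)).
  apply: (le_trans (ub k)); rewrite mulrAC ler_wpM2r ?addr_ge0 ?normc_ge0 // ler_pM2r ?invr_gt0 //.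
have Yd : 0 <= Y / d by rewrite divr_ge0 // ltW.
apply: (@le_trans _ _ (((Y / d) * (normc (f k.+1) + normc (g k.+1))) ^+ 2)).
  by rewrite lerXn2r ?nnegrE ?normc_ge0 // mulr_ge0 // addr_ge0 // normc_ge0.
have -> : 2 * (Y / d) ^+ 2 * (normc (f (1 + k)%N) ^+ 2 + normc (g (1 + k)%N) ^+ 2) =
  (Y / d) ^+ 2 * (2 * (normc (f k.+1) ^+ 2 + normc (g k.+1) ^+ 2)) by rewrite add1n; ring.
rewrite exprMn ler_wpM2l ?sqr_ge0 //.
have := sqr_ge0 (normc (f k.+1) - normc (g k.+1)); rewrite sqrrB sqrrD !mulr2n; lra.
Qed.

Lemma summable_cauchy w e (C : R) : (forall k, normc (w k.+1 - w k) <= e k) ->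
  (forall N, \sum_(k < N) e k <= C) ->
  forall d : R, 0 < d -> exists N, forall k l, (N <= k)%N -> (N <= l)%N -> normc (w k - w l) <= d.
Proof.
move=> we eC d d0.
have e0 k : 0 <= e k by apply: le_trans (we k); exact: normc_ge0.
pose S N := \sum_(k < N) e k.
have hs : has_sup (range S).
  by split; [exists (S 0%N); exists 0%N|exists C => _ [N _ <-]; exact: eC].
have [x [N _ NE] Nx] := sup_adherent d0 hs.
have d2 : 0 < d / 2 by rewrite divr_gt0.
have [x' [M _ ME] Mx] := sup_adherent d2 hs.
exists M.
have step k l : (k <= l)%N -> normc (w l - w k) <= S l - S k.
  move=> /subnKC <-; elim: (l - k)%N => [|j ih]; first by rewrite addn0 !subrr normc0.
  have SE : S (k + j).+1 = S (k + j)%N + e (k + j)%N by rewrite /S big_ord_recr.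
  rewrite addnS SE.
  have -> : w (k + j).+1 - w k = (w (k + j).+1 - w (k + j)%N) + (w (k + j)%N - w k) by ring.
  apply: (le_trans (le_normcD _ _)); have := we (k + j)%N; lra.
have Sl l : S l <= sup (range S) by apply: ub_le_sup; [exact: hs.2|exists l].
have far k : (M <= k)%N -> normc (w k - w M) <= d / 2.
  by move=> Mk; apply: (le_trans (step _ _ Mk)); have := Sl k; rewrite -ME in Mx; lra.
move=> k l /far h1 /far h2; have -> : w k - w l = (w k - w M) - (w l - w M) by ring.
by apply: (le_trans (ler_normcB _ _)); lra.
Qed.

Lemma cauchy_bounded w : (forall d : R, 0 < d -> exists N, forall k l, (N <= k)%N -> (N <= l)%N -> normc (w k - w l) <= d) ->
  exists M : R, forall k, normc (w k) <= M.
Proof.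
move=> /(_ 1 ltr01)[N HN].
exists (\sum_(k < N) normc (w k) + normc (w N) + 1) => k.
have s0 : 0 <= \sum_(k < N) normc (w k) by apply: sumr_ge0 => i _; exact: normc_ge0.
have [Nk|kN] := leqP N k.
  have := HN k N Nk (leqnn N); have := ler_normc_tri (w k) (w N); lra.
have : normc (w k) <= \sum_(k < N) normc (w k).
  rewrite (bigD1 (Ordinal kN)) //= lerDl; by apply: sumr_ge0 => i _; exact: normc_ge0.
by have := normc_ge0 (w N); lra.
Qed.

(** Only this dichotomy is needed, which avoids naming the limit. *)
Lemma cauchy_clim0_or w : (forall d : R, 0 < d -> exists N, forall k l, (N <= k)%N -> (N <= l)%N -> normc (w k - w l) <= d) ->
  clim0 w \/ exists2 d : R, 0 < d & exists N, forall k, (N <= k)%N -> d <= normc (w k).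
Proof.
move=> cw; have [h|h] := pselect (clim0 w); [by left|right].
have [e [e0 He]] : exists e : R, 0 < e /\ forall N, exists2 k, (N <= k)%N & e < normc (w k).
  apply: contrapT => H; apply: h => e e0; apply: contrapT => H'; apply: H.
  exists e; split => // N; apply: contrapT => H''; apply: H'; exists N => k Nk.
  by rewrite leNgt; apply/negP => h; apply: H''; exists k.
have e2 : 0 < e / 2 by rewrite divr_gt0.
have [N HN] := cw _ e2; have [k Nk ek] := He N.
exists (e / 2) => //; exists N => l Nl.
by have := HN k l Nk Nl; have := ler_normc_tri (w k) (w l); lra.
Qed.

Lemma prod_summable f g (A B : R) : (forall N, \sum_(k < N) normc (f k) ^+ 2 <= A) ->
  (forall N, \sum_(k < N) normc (g k) ^+ 2 <= B) ->
  forall N, \sum_(k < N) (normc (f k) * normc (g k)) <= A + B.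
Proof.
move=> fA gB N; apply: (@le_trans _ _ (\sum_(k < N) (normc (f k) ^+ 2 + normc (g k) ^+ 2))).
  apply: ler_sum => k _; have := sqr_ge0 (normc (f k) - normc (g k)).
  have := sqr_ge0 (normc (f k)); have := sqr_ge0 (normc (g k)); rewrite sqrrB mulr2n; lra.
by rewrite big_split /=; apply: lerD; [exact: fA|exact: gB].
Qed.

End NatSequences.

(** * Wronskians and the behaviour of solutions near plus infinity *)

Section HalfLine.
Variable R : realType.
Variables (a b : int -> R).
Hypothesis a0 : forall n, 0 < a n.
Implicit Types (f g u v : int -> R[i]) (z : R[i]) (n : int).

Lemma aC_neq0 n : (a n)%:C != 0 :> R[i].
Proof. by rewrite -normc_gt0 normc_real gtr0_norm. Qed.

(** Lagrange's identity for a single site; every summation by parts below iterates it. *)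
Lemma wronskian_step f g n :
  wronskian a f g n = wronskian a f g (n - 1) + (f n * tau a b g n - g n * tau a b f n).
Proof. by rewrite /wronskian /tau subrK; ring. Qed.

Lemma wronskian_plucker f g u v n :
  wronskian a f g n * wronskian a u v n =
  wronskian a u f n * wronskian a v g n - wronskian a v f n * wronskian a u g n.
Proof. by rewrite /wronskian; ring. Qed.

Lemma wronskian_reconstruct f g u n :
  u (n + 1) * wronskian a f g n = wronskian a u g n * f (n + 1) - wronskian a u f n * g (n + 1).
Proof. by rewrite /wronskian; ring. Qed.

Lemma wronskian_cst z f g : solution a b z f -> solution a b z g ->
  forall n, wronskian a f g n = wronskian a f g 0.
Proof.
move=> hf hg.
have st n : wronskian a f g n = wronskian a f g (n - 1).
  by rewrite [LHS]wronskian_step hf hg; ring.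
have up (k : nat) : wronskian a f g k%:Z = wronskian a f g 0.
  elim: k => [//|k ih]; rewrite st -ih; congr (wronskian _ _ _ _); lia.
have dn (k : nat) : wronskian a f g (- k%:Z) = wronskian a f g 0.
  elim: k => [//|k ih]; rewrite -ih [in RHS]st; congr (wronskian _ _ _ _); lia.
by move=> n; case: (intP n) => [//|k|k]; [exact: up|exact: dn].
Qed.

Lemma tau_solution_next z u : solution a b z u ->
  forall n, u (n + 1) = ((z - (b n)%:C) * u n - (a (n - 1))%:C * u (n - 1)) / (a n)%:C.
Proof.
move=> hu n; have := hu n; rewrite /tau => h; apply: (mulIf (aC_neq0 n)).
by rewrite divfK ?aC_neq0 // mulrBl -h; ring.
Qed.

Lemma tau_solution_prev z u : solution a b z u ->
  forall n, u (n - 1) = ((z - (b n)%:C) * u n - (a n)%:C * u (n + 1)) / (a (n - 1))%:C.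
Proof.
move=> hu n; have := hu n; rewrite /tau => h; apply: (mulIf (aC_neq0 (n - 1))).
by rewrite divfK ?aC_neq0 // mulrBl -h; ring.
Qed.

Lemma solution_zero z u n : solution a b z u -> u n = 0 -> u (n + 1) = 0 -> forall k, u k = 0.
Proof.
move=> hu u0 u1.
have up (k : nat) : u (n + k%:Z) = 0 /\ u (n + k%:Z + 1) = 0.
  elim: k => [|k [h1 h2]]; first by rewrite addr0.
  have e : n + k.+1%:Z = n + k%:Z + 1 by lia.
  rewrite e; split => //; rewrite (tau_solution_next hu).
  have e' : n + k%:Z + 1 - 1 = n + k%:Z by lia.
  by rewrite e' h1 h2 !mulr0 subrr mul0r.
have dn (k : nat) : u (n - k%:Z) = 0 /\ u (n - k%:Z + 1) = 0.
  elim: k => [|k [h1 h2]]; first by rewrite subr0.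
  have e : n - k.+1%:Z = n - k%:Z - 1 by lia.
  rewrite e subrK; split => //; rewrite (tau_solution_prev hu).
  by rewrite h1 h2 !mulr0 subrr mul0r.
move=> k; have [nk|kn] := leP n k.
- have := (up `|k - n|%N).1; have -> : n + `|k - n|%N%:Z = k by lia.
  by [].
- have := (dn `|n - k|%N).1; have -> : n - `|n - k|%N%:Z = k by lia.
  by [].
Qed.

Lemma solution_ex z (c0 c1 : R[i]) : exists u, [/\ solution a b z u, u 0 = c0 & u 1 = c1].
Proof.
(* The second-order recurrence is run on pairs: [up k] holds the values at [k] and [k + 1], [dn k]
   those at [- k] and [- k + 1]. *)
pose up := fix up (k : nat) : R[i] * R[i] := if k is k'.+1 then let: (x, y) := up k' in
  (y, ((z - (b k'.+1%:Z)%:C) * y - (a k'%:Z)%:C * x) / (a k'.+1%:Z)%:C) else (c0, c1).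
pose dn := fix dn (k : nat) : R[i] * R[i] := if k is k'.+1 then let: (x, y) := dn k' in
  (((z - (b (- k'%:Z))%:C) * x - (a (- k'%:Z))%:C * y) / (a (- k'%:Z - 1))%:C, x) else (c0, c1).
pose u n : R[i] := match n with Posz k => (up k).1 | Negz k => (dn k.+1).1 end.
have uup k : u k%:Z = (up k).1 /\ u (k%:Z + 1) = (up k).2.
  split => //; have -> : k%:Z + 1 = k.+1%:Z by lia.
  by rewrite /u /=; case: (up k).
have udn k : u (- k%:Z) = (dn k).1 /\ u (- k%:Z + 1) = (dn k).2.
  case: k => [//|k]; split; first by rewrite -NegzE.
  have -> : - k.+1%:Z + 1 = - k%:Z by lia.
  have -> : u (- k%:Z) = (dn k).1 by case: k => [//|k]; rewrite -NegzE.
  by rewrite /=; case: (dn k).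
exists u; split => //.
have solp (k : nat) : tau a b u (k.+1)%:Z = z * u (k.+1)%:Z.
  have [e1 e2] := uup k.+1; have [e3 _] := uup k.
  rewrite /tau.
  have e5 : k.+1%:Z - 1 = k%:Z by lia.
  rewrite e5 e2 e1 e3 /=.
  case: (up k) => x y /=; rewrite mulrC divfK ?aC_neq0 //; ring.
have soln (k : nat) : tau a b u (- k%:Z) = z * u (- k%:Z).
  have [e1 e2] := udn k; have [e3 _] := udn k.+1.
  have e5 : - k.+1%:Z = - k%:Z - 1 by lia.
  rewrite e5 in e3; rewrite /tau e3 e2 e1 /=.
  case: (dn k) => x y /=; rewrite mulrC [X in _ + X + _]mulrC divfK ?aC_neq0 //; ring.
by move=> n; case: (intP n) => [|k|k]; [exact: (soln 0%N)|exact: solp|exact: soln].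
Qed.

Let pb f := pbounded f.

Lemma wronskian_nat_step f g (k : nat) : wronskian a f g k.+1%:Z =
  wronskian a f g k%:Z + (f k.+1%:Z * tau a b g k.+1%:Z - g k.+1%:Z * tau a b f k.+1%:Z).
Proof. by rewrite wronskian_step; congr (wronskian _ _ _ _ + _); lia. Qed.

Lemma pbounded_le f g h (C : R) : 0 <= C -> pb f -> pb g ->
  (forall k : nat, normc (h k%:Z) ^+ 2 <= C * (normc (f k%:Z) ^+ 2 + normc (g k%:Z) ^+ 2)) -> pb h.
Proof. by move=> C0 hf hg H; exact: (@seqb_le _ (fun k => f k%:Z) (fun k => g k%:Z) (fun k => h k%:Z) C). Qed.

Lemma sq_lin (x y c : R[i]) : normc (y - c * x) ^+ 2 <= 2 * (1 + normc c ^+ 2) * (normc y ^+ 2 + normc x ^+ 2).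
Proof.
have h : normc (y - c * x) ^+ 2 <= (normc y + normc c * normc x) ^+ 2.
  rewrite lerXn2r ?nnegrE ?normc_ge0 ?addr_ge0 ?mulr_ge0 ?normc_ge0 //.
  by rewrite -normcM ler_normcB.
apply: (le_trans h).
have := sqr_ge0 (normc y - normc c * normc x); rewrite sqrrB sqrrD exprMn !mulr2n => q.
have := sqr_ge0 (normc x); have := mulr_ge0 (sqr_ge0 (normc c)) (sqr_ge0 (normc y)); lra.
Qed.

Lemma pbounded_sub f g (c : R[i]) : pb f -> pb g -> pb (fun n => g n - c * f n).
Proof.
move=> hf hg; apply: (pbounded_le (C := 2 * (1 + normc c ^+ 2)) _ hg hf) => [|k]; last exact: sq_lin.
by rewrite mulr_ge0 // addr_ge0 // sqr_ge0.
Qed.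

Lemma pbounded_tau z u : solution a b z u -> pb u -> pb (tau a b u).
Proof.
move=> hu [A HA]; exists (normc z ^+ 2 * A) => N.
apply: (@le_trans _ _ (\sum_(k < N) normc z ^+ 2 * normc (u k%:Z) ^+ 2)).
  by apply: ler_sum => k _; rewrite hu normcM exprMn.
by rewrite -mulr_sumr ler_wpM2l // sqr_ge0.
Qed.

Lemma pbounded_all f g z u (d : R) (M : nat) : pb f -> pb g -> pb (tau a b f) -> pb (tau a b g) ->
  0 < d -> (forall k, (M <= k)%N -> d <= normc (wronskian a f g k%:Z)) ->
  solution a b z u -> pb u.
Proof.
move=> hf hg htf htg d0 wd hu.
apply/(seqb_shift (fun k => u k%:Z) M).
have hF := pbounded_sub z hf htf; have hG := pbounded_sub z hg htg.
apply: (@gronwall_seqb _ (fun k => f (M + k)%N%:Z) (fun k => g (M + k)%N%:Z)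
  (fun k => tau a b f (M + k)%N%:Z - z * f (M + k)%N%:Z)
  (fun k => tau a b g (M + k)%N%:Z - z * g (M + k)%N%:Z) _
  (fun k => wronskian a f g (M + k)%N%:Z)
  (fun k => wronskian a u f (M + k)%N%:Z) (fun k => wronskian a u g (M + k)%N%:Z) d d0).
- by move=> n; apply: wd; rewrite leq_addr.
- move=> n; have := wronskian_reconstruct f g u (M + n)%N%:Z.
  by have -> : (M + n)%N%:Z + 1 = (M + n.+1)%N%:Z by lia.
- by move=> n; rewrite addnS wronskian_nat_step hu; ring.
- by move=> n; rewrite addnS wronskian_nat_step hu; ring.
- by apply/(seqb_shift (fun k => f k%:Z) M).
- by apply/(seqb_shift (fun k => g k%:Z) M).
- by apply/(seqb_shift (fun k => tau a b f k%:Z - z * f k%:Z) M).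
- by apply/(seqb_shift (fun k => tau a b g k%:Z - z * g k%:Z) M).
Qed.

Lemma wronskian_cauchy f g : pb f -> pb g -> pb (tau a b f) -> pb (tau a b g) ->
  forall d : R, 0 < d -> exists N, forall k l, (N <= k)%N -> (N <= l)%N ->
    normc (wronskian a f g k%:Z - wronskian a f g l%:Z) <= d.
Proof.
have sh (h : int -> R[i]) (A : R) : (forall N, \sum_(k < N) normc (h k%:Z) ^+ 2 <= A) ->
    forall N, \sum_(k < N) normc (h k.+1%:Z) ^+ 2 <= A.
  by move=> H N; apply: le_trans (H N.+1); rewrite big_ord_recl /= lerDr exprn_ge0 // normc_ge0.
move=> [A1 H1] [A2 H2] [A3 H3] [A4 H4].
have q1 := @prod_summable R (fun k => f k.+1%:Z) (fun k => tau a b g k.+1%:Z) _ _ (sh _ _ H1) (sh _ _ H4).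
have q2 := @prod_summable R (fun k => g k.+1%:Z) (fun k => tau a b f k.+1%:Z) _ _ (sh _ _ H2) (sh _ _ H3).
apply: (@summable_cauchy _ (fun k => wronskian a f g k%:Z)
  (fun k => normc (f k.+1%:Z) * normc (tau a b g k.+1%:Z) + normc (g k.+1%:Z) * normc (tau a b f k.+1%:Z))
  ((A1 + A4) + (A2 + A3))).
- by move=> k; rewrite wronskian_nat_step addrC addKr -!normcM ler_normcB.
- by move=> N; rewrite big_split /=; exact: lerD (q1 N) (q2 N).
Qed.

Lemma nontrivial01 z u : solution a b z u -> nontrivial u -> u 0 != 0 \/ u 1 != 0.
Proof.
move=> hu [n un]; have [h0|h0] := eqVneq (u 0) 0; last by left.
by right; apply: contra_neq un => h1; apply: (@solution_zero z u 0 hu).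
Qed.

(* The limit exists by summation by parts.  If it is not 0, every solution is
   recovered from [f] and [g] with coefficients bounded by Gronwall's lemma, so
   the endpoint is limit circle, where Pluecker's identity with [v] applies. *)
Theorem wronskian_pinfty v (lam : R[i]) f g : solution a b lam v -> nontrivial v ->
  pb f -> pb g -> pb (tau a b f) -> pb (tau a b g) ->
  (limit_circle near_pinfty a b -> clim0 (fun k => wronskian a v f k%:Z)) ->
  (limit_circle near_pinfty a b -> clim0 (fun k => wronskian a v g k%:Z)) ->
  clim0 (fun k => wronskian a f g k%:Z).
Proof.
move=> hv nv hf hg htf htg bf bg.
have [//|[d d0 [M HM]]] := cauchy_clim0_or (wronskian_cauchy hf hg htf htg).
have LC : limit_circle near_pinfty a b.
  exists 0 => u hu; apply/pboundedP; exact: (pbounded_all hf hg htf htg d0 HM hu).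
have all_sol z u : solution a b z u -> pb u by exact: pbounded_all hf hg htf htg d0 HM.
(* With these initial values the Wronskian of [v] and [v'] is a positive multiple of
   [|v 0|^2 + |v 1|^2], so it cannot vanish. *)
have [v' [hv' v0 v1]] := @solution_ex lam (- (v 1)^*)%C ((v 0)^*)%C.
have pv := all_sol _ _ hv; have pv' := all_sol _ _ hv'.
have W0 : wronskian a v v' 0 != 0.
  rewrite /wronskian v0 add0r v1 mulf_neq0 ?aC_neq0 //.
  have -> : v 0 * (v 0)^*%C - v 1 * - (v 1)^*%C = (normc (v 0) ^+ 2 + normc (v 1) ^+ 2)%:C.
    rewrite !normc_sqr; case: (v 0) (v 1) => x y [x' y'] /=.
    by apply/eqP; rewrite eq_complex /=; apply/andP; split; apply/eqP; ring.
  rewrite -normc_gt0 normc_real ger0_norm ?addr_ge0 ?sqr_ge0 //.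
  have := sqr_ge0 (normc (v 0)); have := sqr_ge0 (normc (v 1)).
  have [h|h] := nontrivial01 hv nv; rewrite -normc_gt0 in h; have := exprn_gt0 2 h; lra.
have W n : wronskian a v v' n = wronskian a v v' 0 by exact: wronskian_cst hv hv' n.
have [M1 b1] := cauchy_bounded (wronskian_cauchy pv' hg (pbounded_tau hv' pv') htg).
have [M2 b2] := cauchy_bounded (wronskian_cauchy pv' hf (pbounded_tau hv' pv') htf).
have c1 := clim0M (bf LC) b1; have c2 := clim0Z (-1) (clim0M (bg LC) b2).
have := clim0Z (wronskian a v v' 0)^-1 (clim0D c1 c2).
apply: clim0_eventually 0%N _ => k _.
have := wronskian_plucker f g v v' k%:Z; rewrite W => h.
by apply: (mulfI W0); rewrite mulrC h mulVKf //; ring.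
Qed.

End HalfLine.

(** * Reflection of the integers exchanges the two endpoints *)

Section Reflection.
Variable R : realType.
Variables (a b : int -> R).
Hypothesis a0 : forall n, 0 < a n.
Implicit Types (f g u v : int -> R[i]) (z : R[i]) (n : int).

Definition refl f : int -> R[i] := fun n => f (- n).
(** The coefficient [a n] belongs to the bond between [n] and [n + 1], hence the shift by one. *)
Definition ra n : R := a (- n - 1).
Definition rb n : R := b (- n).

Lemma refl_tau f n : tau ra rb (refl f) n = tau a b f (- n).
Proof.
rewrite /tau /ra /rb /refl.
have -> : - (n - 1) - 1 = - n by lia.
have -> : - (n + 1) = - n - 1 by lia.
have -> : - (n - 1) = - n + 1 by lia.
ring.
Qed.

Lemma refl_wronskian f g n : wronskian ra (refl f) (refl g) n = - wronskian a f g (- n - 1).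
Proof.
rewrite /wronskian /ra /refl subrK.
have -> : - (n + 1) = - n - 1 by lia.
ring.
Qed.

Lemma refl_solution z u : solution a b z u <-> solution ra rb z (refl u).
Proof.
split=> H n; first by rewrite refl_tau H.
by have := H (- n); rewrite refl_tau /refl opprK.
Qed.

Lemma refl_limit_circle : limit_circle near_pinfty ra rb <-> limit_circle near_ninfty a b.
Proof.
split=> -[z H]; exists z => u hu.
- by apply/nboundedP; have /H/pboundedP := (refl_solution z u).1 hu.
- have e : u = refl (refl u) by apply/funext => n; rewrite /refl opprK.
  have /H/nboundedP nb : solution a b z (refl u) by apply/refl_solution; rewrite -e.
  by rewrite e; apply/pboundedP.
Qed.

Theorem wronskian_ninfty v (lam : R[i]) f g : solution a b lam v -> nontrivial v ->
  nbounded f -> nbounded g -> nbounded (tau a b f) -> nbounded (tau a b g) ->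
  (limit_circle near_ninfty a b -> clim0 (fun k => wronskian a v f (- k%:Z))) ->
  (limit_circle near_ninfty a b -> clim0 (fun k => wronskian a v g (- k%:Z))) ->
  clim0 (fun k => wronskian a f g (- k%:Z)).
Proof.
move=> hv [n0 nv] hf hg htf htg bf bg.
(* Reflection changes the sign of the Wronskian and shifts its index by one; neither affects
   convergence to 0. *)
have shift u w : clim0 (fun k => wronskian ra (refl u) (refl w) k%:Z) <-> clim0 (fun k => wronskian a u w (- k%:Z)).
  rewrite -(clim0_shift (fun k => wronskian a u w (- k%:Z)) 1).
  have E k : wronskian ra (refl u) (refl w) k%:Z = (-1) * wronskian a u w (- (k + 1)%N%:Z).
    by rewrite refl_wronskian mulN1r; congr (- wronskian _ _ _ _); lia.
  split=> H.
  - by apply: clim0_eventually 0%N _ (clim0Z (-1) H) => k _; rewrite E; ring.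
  - by apply: clim0_eventually 0%N _ (clim0Z (-1) H) => k _; rewrite E.
have tb u : nbounded (tau a b u) -> pbounded (tau ra rb (refl u)).
  by move=> [A H]; exists A => N; under eq_bigr do rewrite refl_tau; exact: H.
apply/shift; apply: (@wronskian_pinfty R ra rb _ (refl v) lam) => //.
- by move=> n; exact: a0.
- exact/refl_solution.
- by exists (- n0); rewrite /refl opprK.
- exact: tb. - exact: tb.
- by move=> /refl_limit_circle /bf ?; apply/shift.
- by move=> /refl_limit_circle /bg ?; apply/shift.
Qed.

End Reflection.

(** * Symmetry of the operator and its consequences off the real axis *)

Section JacobiOperator.
Variable R : realType.
Variable J : jacobi R.
Implicit Types (f g u v : int -> R[i]) (z : R[i]) (n : int).
Local Notation a := (ja J).
Local Notation b := (jb J).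
Local Notation W := (wronskian a).
Local Notation T := (tau a b).

(** Summability of [T f] is included because the limit of Wronskians of general sequences requires
    it; for solutions it follows from that of [f], see [solution_pdom]. *)
Definition pdom f := [/\ pbounded f, pbounded (T f) & bc_pinfty J f].
Definition ndom f := [/\ nbounded f, nbounded (T f) & bc_ninfty J f].

Lemma jacobi_domainP f : jacobi_domain J f <-> pdom f /\ ndom f.
Proof.
split=> [[/ell2_bounded[p1 n1] /ell2_bounded[p2 n2] bp bn]|[[p1 p2 bp] [n1 n2 bn]]].
- by split; split.
- by split => //; apply/ell2_bounded.
Qed.

Lemma pdom_wronskian f g : pdom f -> pdom g -> clim0 (fun k => W f g k%:Z).
Proof.
move=> [p1 p2 bp] [q1 q2 bq]; have [lam hv] := jvp_sol J.
apply: (wronskian_pinfty (ja_gt0 J) hv (jvp_neq0 J)) => // LC.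
- by apply/clim0P; exact: bp. - by apply/clim0P; exact: bq.
Qed.

Lemma ndom_wronskian f g : ndom f -> ndom g -> clim0 (fun k => W f g (- k%:Z)).
Proof.
move=> [p1 p2 bp] [q1 q2 bq]; have [lam hv] := jvn_sol J.
apply: (wronskian_ninfty (ja_gt0 J) hv (jvn_neq0 J)) => // LC.
- by apply/clim0P; exact: bp. - by apply/clim0P; exact: bq.
Qed.

Definition cj f : int -> R[i] := fun n => ((f n)^*)%C.

Lemma conj_real (x : R) : ((x%:C)^*)%C = x%:C :> R[i].
Proof. by apply/eqP; rewrite eq_complex /= oppr0 !eqxx. Qed.

Lemma cj_tau f n : T (cj f) n = ((T f n)^*)%C.
Proof.
rewrite /tau /cj; case: (f n) (f (n - 1)) (f (n + 1)) => f1 f2 [f3 f4] [f5 f6].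
by apply/eqP; rewrite eq_complex /=; apply/andP; split; apply/eqP; ring.
Qed.

Lemma cj_wronskian f g n : W (cj f) (cj g) n = ((W f g n)^*)%C.
Proof.
rewrite /wronskian /cj; case: (f n) (g n) (f (n + 1)) (g (n + 1)) => f1 f2 [g1 g2] [f3 f4] [g3 g4].
by apply/eqP; rewrite eq_complex /=; apply/andP; split; apply/eqP; ring.
Qed.

Lemma cj_pbounded f : pbounded f -> pbounded (cj f).
Proof. by move=> [A H]; exists A => N; under eq_bigr do rewrite normc_conj; exact: H. Qed.

Lemma cj_nbounded f : nbounded f -> nbounded (cj f).
Proof. by move=> [A H]; exists A => N; under eq_bigr do rewrite normc_conj; exact: H. Qed.

Lemma tau_cj_fun f : T (cj f) = cj (T f).
Proof. by apply/funext => n; rewrite cj_tau. Qed.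

Lemma cj_real (v : int -> R) : cj (fun n => (v n)%:C) = (fun n => (v n)%:C).
Proof. by apply/funext => n; rewrite /cj conj_real. Qed.

Lemma cj_pdom f : pdom f -> pdom (cj f).
Proof.
move=> [p1 p2 bp]; split; rewrite ?tau_cj_fun; try exact: cj_pbounded.
move=> /bp /clim0P H; apply/clim0P => e /H[N HN]; exists N => k /HN.
by rewrite -{2}(cj_real (jvp J)) cj_wronskian normc_conj.
Qed.

Lemma cj_ndom f : ndom f -> ndom (cj f).
Proof.
move=> [p1 p2 bp]; split; rewrite ?tau_cj_fun; try exact: cj_nbounded.
move=> /bp /clim0P H; apply/clim0P => e /H[N HN]; exists N => k /HN.
by rewrite -{2}(cj_real (jvn J)) cj_wronskian normc_conj.
Qed.

Lemma solution_pdom z u : solution a b z u -> in_domain_near_pinfty J u -> pdom u.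
Proof. by move=> hu [/pboundedP p bc]; split => //; exact: (pbounded_tau hu p). Qed.

Lemma solution_ndom z u : solution a b z u -> in_domain_near_ninfty J u -> ndom u.
Proof.
move=> hu [/nboundedP p bc]; split => //; case: p => A HA; exists (normc z ^+ 2 * A) => N.
apply: (@le_trans _ _ (\sum_(k < N) normc z ^+ 2 * normc (u (- k%:Z)) ^+ 2)).
  by apply: ler_sum => k _; rewrite hu normcM exprMn.
by rewrite -mulr_sumr ler_wpM2l // sqr_ge0.
Qed.

Lemma win_lagrange f g N :
  win (fun k => f k * T g k - g k * T f k) N = W f g (N%:Z - 1) - W f g (- N%:Z - 1).
Proof.
elim: N => [|N ih]; first by rewrite /win !big_ord0 addr0 oppr0 subrr.
rewrite winS ih.
have -> : N.+1%:Z - 1 = N%:Z by lia.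
rewrite [W f g N%:Z](wronskian_step a b f g).
have -> : - N%:Z - 1 = - N.+1%:Z by lia.
by rewrite [W f g (- N.+1%:Z)](wronskian_step a b f g); ring.
Qed.

(** The window sum telescopes to two boundary Wronskians, which vanish in the limit: the operator is
    symmetric for the bilinear pairing. *)
Lemma win_lagrange_clim0 f g : jacobi_domain J f -> jacobi_domain J g ->
  clim0 (win (fun k => f k * T g k - g k * T f k)).
Proof.
move=> /jacobi_domainP[pf nf] /jacobi_domainP[pg ng].
have h1 := pdom_wronskian pf pg; have h2 := ndom_wronskian nf ng.
apply/(clim0_shift _ 1).
have h3 := clim0Z (-1) ((clim0_shift _ 2).2 h2).
apply: clim0_eventually 0%N _ (clim0D h1 h3) => k _.
rewrite win_lagrange mulN1r; congr (W f g _ - W f g _); lia.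
Qed.

Lemma cj_domain f : jacobi_domain J f -> jacobi_domain J (cj f).
Proof. by move=> /jacobi_domainP[? ?]; apply/jacobi_domainP; split; [exact: cj_pdom|exact: cj_ndom]. Qed.

(** The self-adjoint estimate by 1 / |Im z|. Lagrange's identity for the conjugate of [f] and [f]
    isolates [2 * Im z] times the square norm of [f], up to the pairing with [g] and a boundary term
    tending to 0. *)
Lemma resolvent_norm f g z (B : R) : complex.Im z != 0 -> jacobi_domain J f ->
  T f =1 (fun n => z * f n + g n) -> sqb g B -> sqb f (B / complex.Im z ^+ 2).
Proof.
set y := complex.Im z => y0 df Tf gB N.
have ny : 0 < `|y| by rewrite normr_gt0.
have L := win_lagrange_clim0 (cj_domain df) df.
have key M : win (fun n => normc (f n) ^+ 2) M <=
    normc (win (fun k => cj f k * T f k - f k * T (cj f) k) M) / `|y| + B / y ^+ 2.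
  have E : win (fun k => cj f k * T f k - f k * T (cj f) k) M =
     (2 * 'i * y%:C) * win (fun k => (normc (f k) ^+ 2)%:C) M +
     win (fun k => cj f k * g k - f k * cj g k) M.
    rewrite -winZ -winD; apply: win_ext => k; rewrite cj_tau Tf rmorphD rmorphM /cj normc_sqr.
    case: (z) @y y0 ny => z1 z2 /= _ _.
    case: (f k) (g k) => f1 f2 [g1 g2].
    by apply/eqP; rewrite eq_complex /=; apply/andP; split; apply/eqP; ring.
  set S := win (fun n => normc (f n) ^+ 2) M.
  have SE : win (fun k => (normc (f k) ^+ 2)%:C) M = S%:C :> R[i].
    by rewrite /S /win rmorphD !rmorph_sum.
  set w := win _ M in E *.
  have S0 : 0 <= S by rewrite /S /win addr_ge0 // sumr_ge0 // => i _; exact: sq_ge0.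
  have GB : win (fun n => normc (g n) ^+ 2) M <= B by exact: gB.
  have h1 : 2 * `|y| * S <= normc w + (`|y| * S + B / `|y|).
    have e1 : normc ((2 * 'i * y%:C) * S%:C) = 2 * `|y| * S.
      rewrite !normcM normc_i !normc_real (ger0_norm S0) mulr1.
      have -> : normc (2 : R[i]) = 2 by rewrite -[2 in LHS](rmorph_nat (real_complex R) 2) normc_real ger0_norm.
      by [].
    rewrite -e1 -SE.
    have -> : 2 * 'i * y%:C * win (fun k => (normc (f k) ^+ 2)%:C) M = w - win (fun k => cj f k * g k - f k * cj g k) M.
      by rewrite E; ring.
    apply: (le_trans (ler_normcB _ _)); rewrite lerD2l.
    apply: (le_trans (win_norm _ _)).
    (* The inequality between means is weighted so that one half of the left-hand side absorbs the
       [f] term. *)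
    apply: (@le_trans _ _ (win (fun n => `|y| * normc (f n) ^+ 2 + `|y|^-1 * normc (g n) ^+ 2) M)).
      apply: win_le => n; apply: (le_trans (ler_normcB _ _)); rewrite !normcM /cj !normc_conj.
      have := sqr_ge0 (`|y| * normc (f n) - normc (g n)).
      have : 0 <= `|y|^-1 by rewrite invr_ge0.
      move=> i0 q; have := mulr_ge0 i0 q; rewrite sqrrB exprMn.
      have -> : `|y|^-1 * (`|y| ^+ 2 * normc (f n) ^+ 2 - `|y| * normc (f n) * normc (g n) *+ 2 + normc (g n) ^+ 2)
         = `|y| * normc (f n) ^+ 2 - 2 * (normc (f n) * normc (g n)) + `|y|^-1 * normc (g n) ^+ 2.
        by field; rewrite gt_eqF.
      lra.
    rewrite winD !winZ lerD2l mulrC ler_wpM2r // invr_ge0 ltW //.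
  have h2 : `|y| * S <= normc w + B / `|y| by lra.
  have -> : B / y ^+ 2 = (B / `|y|) / `|y|.
    by rewrite -[y ^+ 2]real_normK ?num_real // expr2 invfM mulrA.
  by rewrite -mulrDl ler_pdivlMr // mulrC.
apply/ler_addgt0Pr => e e0.
have [|M HM] := L (e * `|y|); first by rewrite mulr_gt0.
apply: (le_trans (win_mono (fun n => sq_ge0 f n) (leq_maxl N M))).
apply: (le_trans (key _)); rewrite addrC lerD2l.
by rewrite ler_pdivrMr // HM // leq_maxr.
Qed.

Lemma nonreal_eigen f z : complex.Im z != 0 -> jacobi_domain J f ->
  T f =1 (fun n => z * f n) -> forall n, f n = 0.
Proof.
move=> z0 df Tf n.
have g0 : sqb (fun _ : int => 0 : R[i]) 0.
  by move=> N; rewrite /win !big1 ?addr0 // => k _; rewrite normc0 expr0n.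
have := @resolvent_norm f (fun=> 0) z 0 z0 df _ g0; rewrite mul0r => H.
have {}H : sqb f 0 by apply: H => k; rewrite Tf addr0.
have := win_ge n (fun n => sq_ge0 f n); move=> /le_trans /(_ (H _)) h.
have := sq_ge0 f n => h'.
have h0 : normc (f n) ^+ 2 == 0 by rewrite eq_le h h'.
by move: h0; rewrite sqrf_eq0 normc_eq0 => /eqP.
Qed.

Section LeftSolution.
Variables (z : R[i]) (phi : int -> R[i]).
Hypotheses (z0 : complex.Im z != 0) (hphi : solution a b z phi) (nphi : nontrivial phi)
  (dphi : ndom phi).

(* [q n] is the sum of [normc (phi k) ^+ 2] over [k <= n]. *)
Let q n := complex.Im (W (cj phi) phi n) / (2 * complex.Im z).

Let q_step n : q n = q (n - 1) + normc (phi n) ^+ 2.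
Proof.
rewrite /q (wronskian_step a b) cj_tau hphi rmorphM raddfD /= mulrDl; congr (_ + _).
rewrite normc_sqr /cj; case: (z) z0 => z1 z2 /= z20; case: (phi n) => f1 f2 /=.
by field.
Qed.

Let q_mono n (k : nat) : q (n - k%:Z) <= q n.
Proof.
elim: k => [|k ih]; first by rewrite subr0.
apply: le_trans ih; rewrite [leRHS]q_step.
have -> : n - k.+1%:Z = n - k%:Z - 1 by lia.
by rewrite lerDl exprn_ge0 // normc_ge0.
Qed.

(** [q] decreases towards minus infinity and tends to 0 there, because [phi] and its conjugate
    satisfy the same boundary condition. *)
Let q_ge0 n : 0 <= q n.
Proof.
have y0 : 0 < `|2 * complex.Im z| by rewrite normr_gt0 mulf_neq0 // pnatr_eq0.
apply/ler_addgt0Pr => e e0.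
have L := ndom_wronskian (cj_ndom dphi) dphi.
have [|N HN] := L (e * `|2 * complex.Im z|); first by rewrite mulr_gt0.
have [k [Nk kE]] : exists k : nat, (N <= k)%N /\ exists j : nat, - k%:Z = n - j%:Z.
  exists (N + absz n)%N; split; first by rewrite leq_addr.
  by exists (absz (n + (N + absz n)%N%:Z)); lia.
case: kE => j jE; have := HN k Nk; rewrite jE => h.
have h1 := @q_mono n j.
have h2 : `|q (n - j%:Z)| <= e.
  by rewrite /q normrM normfV ler_pdivrMr //; apply: le_trans h; exact: Im_le_normc.
by move: h2; rewrite ler_norml => /andP[h2 _]; lra.
Qed.

(** If [phi n = 0] then [q n = 0], so by monotonicity the mass to the left vanishes; then
    [phi (n - 1) = 0] too, and two adjacent zeros force a trivial solution. *)
Lemma left_neq0 n : phi n != 0.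
Proof.
apply/eqP => p0; case: nphi => k; apply/negP; rewrite negbK; apply/eqP.
have q0 : q n = 0.
  rewrite /q /wronskian /cj p0 conjc0 mul0r mulr0 subrr mulr0 /= mul0r //.
have pm : phi (n - 1) = 0.
  have := q_step n; rewrite q0 p0 normc0 expr0n /= addr0 => /esym q1.
  have := q_step (n - 1); rewrite q1 => h; have := q_ge0 (n - 1 - 1) => h'.
  have h2 := sq_ge0 phi (n - 1).
  have h0 : normc (phi (n - 1)) ^+ 2 == 0 by apply/eqP; lra.
  by move: h0; rewrite sqrf_eq0 normc_eq0 => /eqP.
by apply: (solution_zero (ja_gt0 J) hphi pm); rewrite subrK.
Qed.

(** [normc (phi n) ^+ 2] is one summand of [q n], while the Wronskian defining [q n] contains
    [phi n] and [phi (n + 1)] once each. *)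
Lemma left_growth n : `|complex.Im z| * normc (phi n) <= a n * normc (phi (n + 1)).
Proof.
have y0 : 0 < `|complex.Im z| by rewrite normr_gt0.
have p0 : 0 < normc (phi n) by rewrite normc_gt0 left_neq0.
have h1 : normc (phi n) ^+ 2 <= q n by rewrite q_step lerDr q_ge0.
rewrite -(ler_pM2r p0).
have h2 : q n <= normc (W (cj phi) phi n) / (2 * `|complex.Im z|).
  apply: (le_trans (ler_norm _)); rewrite /q normrM normfV normrM (ger0_norm (ler0n _ 2)).
  by rewrite ler_wpM2r ?invr_ge0 ?mulr_ge0 // Im_le_normc.
have h3 : normc (W (cj phi) phi n) <= a n * (2 * (normc (phi n) * normc (phi (n + 1)))).
  rewrite /wronskian normcM normc_real gtr0_norm ?ja_gt0 // ler_pM2l ?ja_gt0 //.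
  by apply: (le_trans (ler_normcB _ _)); rewrite !normcM /cj !normc_conj; lra.
have := le_trans h1 h2; rewrite ler_pdivlMr ?mulr_gt0 // expr2; lra.
Qed.

End LeftSolution.

End JacobiOperator.

(** * Green functions and the resolvent set *)

Section Green.
Variable R : realType.
Variable J : jacobi R.
Implicit Types (f g v : int -> R[i]) (z w : R[i]) (n k : int).
Local Notation a := (ja J).
Local Notation b := (jb J).
Local Notation W := (wronskian a).
Local Notation T := (tau a b).

Lemma tau_lin (c : R[i]) f g n : T (fun k => f k + c * g k) n = T f n + c * T g n.
Proof. by rewrite /tau; ring. Qed.

Lemma solution_lin z (c : R[i]) f g : solution a b z f -> solution a b z g ->
  solution a b z (fun k => f k + c * g k).
Proof. by move=> hf hg n; rewrite tau_lin hf hg; ring. Qed.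

Lemma proportional z f g : solution a b z f -> solution a b z g -> nontrivial g ->
  W f g 0 = 0 -> exists c : R[i], forall n, f n = c * g n.
Proof.
move=> hf hg ng w0.
have e : f 0 * g 1 = f 1 * g 0.
  move: w0; rewrite /wronskian add0r => /eqP; rewrite mulf_eq0 (negbTE (aC_neq0 (ja_gt0 J) 0)) /=.
  by rewrite subr_eq0 => /eqP.
have key c : f 0 = c * g 0 -> f 1 = c * g 1 -> forall n, f n = c * g n.
  move=> h0 h1 n; apply/eqP; rewrite -subr_eq0 -mulNr; apply/eqP.
  apply: (solution_zero (ja_gt0 J) (solution_lin (- c) hf hg) (n := 0)).
  - by rewrite h0 mulNr subrr.
  - by rewrite add0r h1 mulNr subrr.
have [g0|g1] := nontrivial01 (ja_gt0 J) hg ng.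
- by exists (f 0 / g 0); apply: key; [rewrite divfK|rewrite mulrAC e mulfK].
- by exists (f 1 / g 1); apply: key; [rewrite mulrAC -e mulfK|rewrite divfK].
Qed.

Lemma tau_scale (c : R[i]) f n : T (fun k => c * f k) n = c * T f n.
Proof. by rewrite /tau; ring. Qed.

Lemma pdom_scale (c : R[i]) f : pdom J f -> pdom J (fun n => c * f n).
Proof.
have sc (h : int -> R[i]) : pbounded h -> pbounded (fun n => c * h n).
  move=> [A H]; exists (normc c ^+ 2 * A) => N.
  under eq_bigr do rewrite normcM exprMn.
  by rewrite -mulr_sumr ler_wpM2l // sqr_ge0.
move=> [p1 p2 bp]; split; first exact: sc.
  have -> : T (fun n => c * f n) = (fun n => c * T f n) by apply/funext => n; exact: tau_scale.
  exact: sc.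
move=> /bp /clim0P H; apply/clim0P; apply: clim0_eventually 0%N _ (clim0Z c H) => k _.
by rewrite /wronskian; ring.
Qed.

Lemma ndom_scale (c : R[i]) f : ndom J f -> ndom J (fun n => c * f n).
Proof.
have sc (h : int -> R[i]) : nbounded h -> nbounded (fun n => c * h n).
  move=> [A H]; exists (normc c ^+ 2 * A) => N.
  under eq_bigr do rewrite normcM exprMn.
  by rewrite -mulr_sumr ler_wpM2l // sqr_ge0.
move=> [p1 p2 bp]; split; first exact: sc.
  have -> : T (fun n => c * f n) = (fun n => c * T f n) by apply/funext => n; exact: tau_scale.
  exact: sc.
move=> /bp /clim0P H; apply/clim0P; apply: clim0_eventually 0%N _ (clim0Z c H) => k _.
by rewrite /wronskian; ring.
Qed.

Lemma seqb_eventually (h h' : nat -> R[i]) (m : nat) : (forall k : nat, (m <= k)%N -> h k = h' k) -> seqb h' -> seqb h.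
Proof.
move=> e /(seqb_shift h' m) [A H]; apply/(seqb_shift h m); exists A => N.
by under eq_bigr do rewrite e ?leq_addr //; exact: H.
Qed.

Lemma pdom_eventually f g n : (forall k, n <= k -> f k = g k) -> pdom J g -> pdom J f.
Proof.
move=> e [p1 p2 bp].
have T_eq k : n + 1 <= k -> T f k = T g k by move=> nk; rewrite /tau !e //; lia.
split.
- by refine (@seqb_eventually (fun k : nat => f k%:Z) (fun k : nat => g k%:Z) (absz n) _ p1) => k nk; apply: e; lia.
- by refine (@seqb_eventually (fun k : nat => T f k%:Z) (fun k : nat => T g k%:Z) (absz n).+1 _ p2) => k nk; apply: T_eq; lia.
- move=> /bp /clim0P H; apply/clim0P; apply: (@clim0_eventually _ _ _ (absz n)) H => k nk.
  by rewrite /wronskian !e //; lia.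
Qed.

Lemma ndom_eventually f g n : (forall k, k <= n -> f k = g k) -> ndom J g -> ndom J f.
Proof.
move=> e [p1 p2 bp].
have T_eq k : k <= n - 1 -> T f k = T g k by move=> nk; rewrite /tau !e //; lia.
split.
- by refine (@seqb_eventually (fun k : nat => f (- k%:Z)) (fun k : nat => g (- k%:Z)) (absz n) _ p1) => k nk; apply: e; lia.
- by refine (@seqb_eventually (fun k : nat => T f (- k%:Z)) (fun k : nat => T g (- k%:Z)) (absz n).+1 _ p2) => k nk; apply: T_eq; lia.
- move=> /bp /clim0P H; apply/clim0P; apply: (@clim0_eventually _ _ _ (absz n).+1) H => k nk.
  by rewrite /wronskian !e //; lia.
Qed.

Definition delta n : int -> R[i] := fun k => (k == n)%:R.

Lemma sqb_delta n : sqb (delta n) 1.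
Proof.
move=> N.
apply: (le_trans (win_mono (fun k => sq_ge0 (delta n) k) (leq_maxl N (absz n).+1))).
have -> : win (fun k => normc (delta n k) ^+ 2) (maxn N (absz n).+1) =
    win (fun k => 1 * (k == n)%:R) (maxn N (absz n).+1) :> R.
  apply: win_ext => k; rewrite /delta mul1r; case: eqP => _; by rewrite ?normc1 ?normc0 ?expr1n ?expr0n.
by rewrite (win_delta (fun=> 1)) // leq_maxr.
Qed.

(** The sign fits the normalisation [W psi phi = 1], for which this solves [(T - z) f = delta n]. *)
Definition green (phi psi : int -> R[i]) n : int -> R[i] :=
  fun k => if k <= n then - (phi k * psi n) else - (phi n * psi k).

Lemma green_domain phi psi n : ndom J phi -> pdom J psi -> jacobi_domain J (green phi psi n).
Proof.
move=> hp hs; apply/jacobi_domainP; split.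
- apply: (@pdom_eventually _ (fun k => (- phi n) * psi k) n); last exact: pdom_scale.
  move=> k nk; rewrite /green; case: ifP => [kn|_]; last by rewrite mulNr.
  have -> : k = n by lia.
  by rewrite mulNr.
- apply: (@ndom_eventually _ (fun k => (- psi n) * phi k) n); last exact: ndom_scale.
  by move=> k kn; rewrite /green kn mulNr mulrC.
Qed.

Lemma green_eq z phi psi n : solution a b z phi -> solution a b z psi ->
  (forall k, W psi phi k = 1) -> forall k, T (green phi psi n) k = z * green phi psi n k + delta n k.
Proof.
move=> hp hs hW k.
have [kn|nk|->] := ltgtP k n.
- have -> : delta n k = 0 by rewrite /delta; have -> : (k == n) = false by lia.
  have e j : j <= n -> green phi psi n j = (- psi n) * phi j.
    by move=> jn; rewrite /green jn mulNr mulrC.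
  rewrite /tau !e; try lia.
  have -> : z * (- psi n * phi k) = - psi n * (z * phi k) by ring.
  by have := hp k; rewrite /tau => <-; ring.
- have -> : delta n k = 0 by rewrite /delta; have -> : (k == n) = false by lia.
  have e j : n <= j -> green phi psi n j = (- phi n) * psi j.
    move=> nj; rewrite /green; case: ifP => [jn|_]; last by rewrite mulNr.
    have -> : j = n by lia.
    by rewrite mulNr.
  rewrite /tau !e; try lia.
  have -> : z * (- phi n * psi k) = - phi n * (z * psi k) by ring.
  by have := hs k; rewrite /tau => <-; ring.
- rewrite /delta eqxx /tau /green lexx.
  have -> : (n + 1 <= n) = false by lia.
  have -> : n - 1 <= n by lia.
  have h := hp n; have hw := hW n; rewrite /wronskian in hw; rewrite /tau in h.
  have -> : z * - (phi n * psi n) = - psi n * (z * phi n) by ring.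
  by rewrite -h (_ : true%:R = 1) // -hw; ring.
Qed.

Lemma resolvent_bound1 f z n : complex.Im z != 0 -> jacobi_domain J f ->
  (forall k, T f k = z * f k + delta n k) -> forall k, normc (f k) <= `|complex.Im z|^-1.
Proof.
move=> z0 df Tf k.
have H := resolvent_norm z0 df Tf (sqb_delta n).
have := win_ge k (fun n => sq_ge0 f n); move=> /le_trans /(_ (H _)).
rewrite mul1r -[complex.Im z ^+ 2]real_normK ?num_real // -exprVn.
by rewrite ler_pXn2r // nnegrE ?normc_ge0 // invr_ge0.
Qed.

(** The left-hand side is [T f n], a combination of three entries of [f], each at most
    [1 / |Im z|]. *)
Lemma green_asymptotic f z n : complex.Im z != 0 -> jacobi_domain J f ->
  (forall k, T f k = z * f k + delta n k) ->
  normc (z * f n + 1) <= (a n + a (n - 1) + `|b n|) / `|complex.Im z|.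
Proof.
move=> z0 df Tf; have B := resolvent_bound1 z0 df Tf.
have -> : z * f n + 1 = T f n by rewrite Tf /delta eqxx.
rewrite /tau; apply: (le_trans (le_normcD _ _)); rewrite mulrDl lerD //.
  apply: (le_trans (le_normcD _ _)); rewrite mulrDl lerD //.
    by rewrite normcM normc_real gtr0_norm ?ja_gt0 // ler_pM2l ?ja_gt0.
  by rewrite normcM normc_real gtr0_norm ?ja_gt0 // ler_pM2l ?ja_gt0.
by rewrite normcM normc_real ler_wpM2l.
Qed.

Lemma sqb_add f g (A B : R) : sqb f A -> sqb g B -> sqb (fun n => f n + g n) (2 * A + 2 * B).
Proof.
move=> hf hg N.
apply: (@le_trans _ _ (win (fun n => 2 * normc (f n) ^+ 2 + 2 * normc (g n) ^+ 2) N)).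
  apply: win_le => n.
  have h : normc (f n + g n) ^+ 2 <= (normc (f n) + normc (g n)) ^+ 2.
    by rewrite lerXn2r ?nnegrE ?addr_ge0 ?normc_ge0 // le_normcD.
  apply: (le_trans h); have := sqr_ge0 (normc (f n) - normc (g n)).
  by rewrite sqrrB sqrrD !mulr2n; lra.
by rewrite winD !winZ lerD // ler_pM2l // ?hf ?hg.
Qed.

Lemma sqb_scale f (c : R[i]) (A : R) : sqb f A -> sqb (fun n => c * f n) (normc c ^+ 2 * A).
Proof.
move=> hf N.
have -> : win (fun n => normc (c * f n) ^+ 2) N = win (fun n => normc c ^+ 2 * normc (f n) ^+ 2) N.
  by apply: win_ext => n; rewrite normcM exprMn.
by rewrite winZ ler_wpM2l ?sqr_ge0.
Qed.

Local Notation res := (resolvent_set (jacobi_operator J)).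

Lemma jacobi_operatorP f h : jacobi_operator J (f, h) <-> jacobi_domain J f /\ forall n, h n = T f n.
Proof. by split=> -[df e]; split => //=; [rewrite [h]e|apply/funext]. Qed.

(** Moving [(z - z0) * f] to the right-hand side and absorbing it gives a resolvent estimate uniform
    in [z] near [z0], for solutions that are already known to exist. *)
Lemma res_local z0 : res z0 -> exists (d C : R), [/\ 0 < d, 0 <= C &
  forall f g z (B : R), normc (z - z0) < d -> jacobi_domain J f -> (forall n, T f n = z * f n + g n) ->
    sqb g B -> sqb f (C * B)].
Proof.
move=> [K HK]; pose K' := `|K| + 1.
have K'0 : 0 < K' by rewrite ltr_wpDl.
(* With these values [2 * K' * normc (z - z0) ^+ 2 <= 1 / 2]: half the square norm of [f] is
   absorbed, leaving [4 * K' * B]. *)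
exists (Num.min 1 (1 / (4 * K'))), (4 * K'); split.
- by rewrite lt_min ltr01 divr_gt0 // mulr_gt0.
- by rewrite mulr_ge0 // ltW.
move=> f g z B; rewrite lt_min => /andP[d1 d2] df Tf gB.
have /ell2P[A1 HA1] : ell2 f by case: df.
have ff : normsq setT f \is a fin_num.
  by rewrite ge0_fin_numE ?normsq_ge0 // (le_lt_trans ((normsq_le f A1).2 HA1)) // ltry.
pose A := fine (normsq setT f).
have fA : sqb f A by apply/normsq_le; rewrite /A fineK.
have A0 : 0 <= A by rewrite /A fine_ge0 // normsq_ge0.
pose g' n := g n + (z - z0) * f n.
have g'B : sqb g' (2 * B + 2 * (normc (z - z0) ^+ 2 * A)) by apply: sqb_add => //; exact: sqb_scale.
have g'2 : ell2 g' by apply/ell2P; eexists; exact: g'B.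
have [f' [_ uniq fn]] := HK g' g'2.
have ff' : f = f'.
  apply: uniq; apply/jacobi_operatorP; split => // n.
  by rewrite Tf /g'; ring.
rewrite -ff' in fn.
have B0 : 0 <= 2 * B + 2 * (normc (z - z0) ^+ 2 * A) by have := g'B 0%N; rewrite /win !big_ord0 addr0.
have AB : A <= K' * (2 * B + 2 * (normc (z - z0) ^+ 2 * A)).
  rewrite -lee_fin /A fineK //; apply: (le_trans fn).
  have gn := (normsq_le g' _).2 g'B.
  apply: (@le_trans _ _ (K'%:E * normsq setT g')%E).
    by rewrite lee_wpmul2r ?normsq_ge0 // lee_fin /K'; have := ler_norm K; lra.
  by rewrite EFinM lee_wpmul2l // lee_fin ltW.
have dd : normc (z - z0) ^+ 2 <= 1 / (4 * K').
  rewrite expr2; apply: (@le_trans _ _ (1 * normc (z - z0))); last by rewrite mul1r ltW.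
  by rewrite ler_wpM2r ?normc_ge0 // ltW.
have dA : K' * (2 * (normc (z - z0) ^+ 2 * A)) <= A / 2.
  have -> : A / 2 = K' * (2 * (1 / (4 * K') * A)) by field; rewrite gt_eqF.
  by rewrite ler_wpM2l ?(ltW K'0) // ler_pM2l // ler_wpM2r.
move=> N; apply: (le_trans (fA N)); lra.
Qed.

Lemma sqb0 f : sqb f 0 -> forall n, f n = 0.
Proof.
move=> H n; have := win_ge n (fun n => sq_ge0 f n); move=> /le_trans /(_ (H _)) h.
have h0 : normc (f n) ^+ 2 == 0 by rewrite eq_le h sq_ge0.
by move: h0; rewrite sqrf_eq0 normc_eq0 => /eqP.
Qed.

Hypothesis pd : purely_discrete (jacobi_operator J).

(** Since every spectral point is an eigenvalue, membership in the resolvent set follows from the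
    absence of eigenvectors, without constructing a resolvent. *)
Lemma spectrum_eigen z : ~ res z -> exists2 f, jacobi_domain J f /\ (forall n, T f n = z * f n) & exists n, f n != 0.
Proof.
move=> /pd [_ [f]]; rewrite /eigenspace /= => /jacobi_operatorP[df e] nf _.
by exists f => //; split => // n; rewrite e.
Qed.

Lemma nonreal_res z : complex.Im z != 0 -> res z.
Proof.
move=> z0; apply: contrapT => /spectrum_eigen[f [df e] [n]].
by rewrite (nonreal_eigen z0 df e) eqxx.
Qed.

Lemma res_open z0 : res z0 -> exists2 d : R, 0 < d & forall z, normc (z - z0) < d -> res z.
Proof.
move=> /res_local[d [C [d0 C0 H]]]; exists d => // z zd.
apply: contrapT => /spectrum_eigen[f [df e] [n]]; apply/negP; rewrite negbK; apply/eqP.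
apply: sqb0; have := H f (fun=> 0) z 0 zd df; rewrite mulr0; apply.
- by move=> k; rewrite e addr0.
- by move=> N; rewrite /win !big1 ?addr0 // => i _; rewrite normc0 expr0n.
Qed.

Lemma res_punctured z0 : exists2 d : R, 0 < d & forall z, normc (z - z0) < d -> z != z0 -> res z.
Proof.
have [/res_open[d d0 H]|nr] := pselect (res z0); first by exists d => // z zd _; exact: H.
have [[_ [V nV VE]] _ _] := pd nr.
move: nV; rewrite -nbhs_ballE => -[e /= e0 eV].
have er : 0 < complex.Re e by move: e0; rewrite ltcE /= => /andP[].
have eE : e = (complex.Re e)%:C.
  by move: e0; rewrite ltcE /= => /andP[/eqP i0 _]; rewrite [LHS]complexE i0 mulr0 addr0.
exists (complex.Re e) => // z ze zz; apply: contrapT => nz.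
have zV : V z.
  by apply: eV; rewrite -ball_normE /ball_ /= eE normr_normc ltcR normcBC.
have : (V `&` spectrum (jacobi_operator J)) z by split.
by rewrite VE => /= h; move: zz; rewrite h eqxx.
Qed.

End Green.

(** * The Weyl function *)

Section CauchyLimit.
Variable R : realType.

Lemma cauchy_real (u : nat -> R) : (forall d : R, 0 < d -> exists N, forall k l, (N <= k)%N -> (N <= l)%N -> `|u k - u l| <= d) ->
  exists L : R, forall d : R, 0 < d -> exists N, forall k, (N <= k)%N -> `|u k - L| <= d.
Proof.
move=> cu; pose A := [set x : R | exists N, forall k, (N <= k)%N -> x <= u k].
have ub d N : 0 < d -> (forall k l, (N <= k)%N -> (N <= l)%N -> `|u k - u l| <= d) -> ubound A (u N + d).
  move=> d0 HN x [M HM]; apply: (le_trans (HM (maxn N M) (leq_maxr _ _))).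
  have := HN (maxn N M) N (leq_maxl _ _) (leqnn N); rewrite ler_norml => /andP[_]; lra.
have lb d N : 0 < d -> (forall k l, (N <= k)%N -> (N <= l)%N -> `|u k - u l| <= d) -> A (u N - d).
  move=> d0 HN; exists N => k Nk; have := HN N k (leqnn N) Nk; rewrite ler_norml => /andP[_]; lra.
exists (sup A) => d d0; have d2 : 0 < d / 2 by rewrite divr_gt0.
have [N HN] := cu _ d2; exists N => k Nk.
have h1 : sup A <= u N + d / 2 by apply: ge_sup; [exists (u N - d / 2); exact: lb|exact: ub].
have h2 : u N - d / 2 <= sup A by apply: ub_le_sup; [exists (u N + d / 2); exact: ub|exact: lb].
by have := HN k N Nk (leqnn N); rewrite !ler_norml => /andP[? ?]; apply/andP; split; lra.
Qed.

Lemma cauchy_complex (w : nat -> R[i]) :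
  (forall d : R, 0 < d -> exists N, forall k l, (N <= k)%N -> (N <= l)%N -> normc (w k - w l) <= d) ->
  exists S : R[i], clim0 (fun k => w k - S).
Proof.
move=> cw.
have [x Hx] : exists L : R, forall d : R, 0 < d -> exists N, forall k, (N <= k)%N -> `|complex.Re (w k) - L| <= d.
  apply: cauchy_real => d /cw[N HN]; exists N => k l Nk Nl.
  by rewrite -raddfB; apply: le_trans (Re_le_normc _) (HN k l Nk Nl).
have [y Hy] : exists L : R, forall d : R, 0 < d -> exists N, forall k, (N <= k)%N -> `|complex.Im (w k) - L| <= d.
  apply: cauchy_real => d /cw[N HN]; exists N => k l Nk Nl.
  by rewrite -raddfB; apply: le_trans (Im_le_normc _) (HN k l Nk Nl).
exists (x +i* y) => e e0; have e2 : 0 < e / 2 by rewrite divr_gt0.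
have [N1 H1] := Hx _ e2; have [N2 H2] := Hy _ e2.
exists (maxn N1 N2) => k; rewrite geq_max => /andP[/H1 h1 /H2 h2].
by apply: (le_trans (normc_le_ReIm _)); rewrite !raddfB /=; lra.
Qed.

End CauchyLimit.

(** * Analyticity of the diagonal of the resolvent *)

Section Resolvent.
Variable R : realType.
Variable J : jacobi R.
Implicit Types (f g v : int -> R[i]) (z w : R[i]) (n k : int).
Local Notation a := (ja J).
Local Notation b := (jb J).
Local Notation T := (tau a b).
Local Notation res := (resolvent_set (jacobi_operator J)).
Hypothesis pd : purely_discrete (jacobi_operator J).

Definition rsol z n f := jacobi_domain J f /\ forall k, T f k = z * f k + delta R n k.

Lemma rsol_ex z n : res z -> exists f, rsol z n f.
Proof.
move=> [K HK]; have [|f [/jacobi_operatorP[df e] _ _]] := HK (delta R n).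
  by apply/ell2P; exists 1; exact: sqb_delta.
by exists f; split => // k; rewrite -e.
Qed.

Lemma rsol_uniq z n f g : res z -> rsol z n f -> rsol z n g -> f = g.
Proof.
move=> [K HK] [df e] [dg e']; have [|f' [_ uniq _]] := HK (delta R n).
  by apply/ell2P; exists 1; exact: sqb_delta.
have uq h : rsol z n h -> h = f'.
  by move=> [dh eh]; apply: uniq; apply/jacobi_operatorP; split => // k; rewrite eh.
by transitivity f'; [|symmetry]; apply: uq.
Qed.

(** Column [n] of the resolvent at [z]; the default 0 is only met outside the resolvent set. *)
Definition rk z n : int -> R[i] := xget (fun=> 0) [set f | rsol z n f].

Lemma rkP z n : res z -> rsol z n (rk z n).
Proof. by move=> /(rsol_ex n)[f hf]; rewrite /rk; case: xgetP => [y _ //|/(_ f)]. Qed.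

Lemma rkE z n f : res z -> rsol z n f -> rk z n = f.
Proof. by move=> rz hf; apply: (rsol_uniq rz (rkP n rz) hf). Qed.

Lemma jacobi_domain_sub f g : jacobi_domain J f -> jacobi_domain J g -> jacobi_domain J (fun n => f n - g n).
Proof.
have subb (h h' : int -> R[i]) : ell2 h -> ell2 h' -> ell2 (fun n => h n - h' n).
  move=> /ell2P[A HA] /ell2P[B HB]; apply/ell2P; exists (2 * A + 2 * (normc (-1 : R[i]) ^+ 2 * B)).
  move=> N; have := sqb_add HA (sqb_scale (-1) HB) N.
  by congr (_ <= _); apply: win_ext => n; rewrite mulN1r.
have Tsub : T (fun n => f n - g n) = (fun n => T f n - T g n).
  by apply/funext => n; rewrite /tau; ring.
move=> [e1 t1 bp1 bn1] [e2 t2 bp2 bn2]; split.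
- exact: subb. - by rewrite Tsub; exact: subb.
- move=> LC; have /clim0P h1 := bp1 LC; have /clim0P h2 := bp2 LC.
  apply/clim0P; apply: clim0_eventually 0%N _ (clim0D h1 (clim0Z (-1) h2)) => k _.
  by rewrite /wronskian; ring.
- move=> LC; have /clim0P h1 := bn1 LC; have /clim0P h2 := bn2 LC.
  apply/clim0P; apply: clim0_eventually 0%N _ (clim0D h1 (clim0Z (-1) h2)) => k _.
  by rewrite /wronskian; ring.
Qed.

Lemma win_prod f g (A B t : R) N : 0 < t -> sqb f A -> sqb g B ->
  normc (win (fun k => f k * g k) N) <= t * A + t^-1 * B.
Proof.
move=> t0 fA gB; apply: (le_trans (win_norm _ _)).
apply: (@le_trans _ _ (win (fun k => t * normc (f k) ^+ 2 + t^-1 * normc (g k) ^+ 2) N)).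
  apply: win_le => k; rewrite normcM.
  have := sqr_ge0 (t * normc (f k) - normc (g k)).
  have i0 : 0 < t^-1 by rewrite invr_gt0.
  move=> q; have := mulr_ge0 (ltW i0) q; rewrite sqrrB exprMn.
  have -> : t^-1 * (t ^+ 2 * normc (f k) ^+ 2 - t * normc (f k) * normc (g k) *+ 2 + normc (g k) ^+ 2)
     = t * normc (f k) ^+ 2 - 2 * (normc (f k) * normc (g k)) + t^-1 * normc (g k) ^+ 2.
    by field; rewrite gt_eqF.
  have := mulr_ge0 (normc_ge0 (f k)) (normc_ge0 (g k)).
  lra.
by rewrite winD !winZ; apply: lerD; rewrite ler_pM2l ?invr_gt0 //.
Qed.

Lemma win_sq_cauchy f g (A B : R) : sqb f A -> sqb g B ->
  exists S : R[i], clim0 (fun N => win (fun k => f k * g k) N - S).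
Proof.
move=> fA gB; apply: cauchy_complex.
apply: (@summable_cauchy _ _ (fun N => normc (f N%:Z * g N%:Z) + normc (f (- (N.+1)%:Z) * g (- (N.+1)%:Z))) (A + B)).
  move=> N; have := le_normcD (f N%:Z * g N%:Z) (f (- (N.+1)%:Z) * g (- (N.+1)%:Z)).
  by congr (normc _ <= _); rewrite winS; ring.
move=> N; rewrite big_split /= -/(win (fun k => normc (f k * g k)) N).
apply: (@le_trans _ _ (win (fun k => normc (f k) ^+ 2 + normc (g k) ^+ 2) N)).
  apply: win_le => k; rewrite normcM; have := sqr_ge0 (normc (f k) - normc (g k)).
  have := sqr_ge0 (normc (f k)); have := sqr_ge0 (normc (g k)); rewrite sqrrB mulr2n; lra.
by rewrite winD; apply: lerD; [exact: fA|exact: gB].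
Qed.

(* With the bilinear pairing, the resolvent identity reads
   [rk w n n - rk z n n = (w - z) * <rk z n, rk w n>]. *)
Lemma rk_hol z n : res z -> hol (fun w => rk w n n) z.
Proof.
move=> rz; have [d [C [d0 C0 loc]]] := res_local rz.
have [r r0 ropen] := res_open pd rz.
have [dz ez] := rkP n rz.
have zd : normc (z - z) < d by rewrite subrr normc0.
have fA : sqb (rk z n) C by have := loc _ _ z 1 zd dz ez (sqb_delta R n); rewrite mulr1.
(* The derivative is the bilinear square of the column [rk z n], without conjugation. *)
have [S HS] := win_sq_cauchy fA fA.
exists S => e e0.
pose E := C + C * C + 1.
have E0 : 0 < E by rewrite /E; have := mulr_ge0 C0 C0; lra.
exists (Num.min (Num.min r d) (e / E)) => [|h]; first by rewrite !lt_min r0 d0 divr_gt0.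
rewrite !lt_min => /andP[/andP[hr hd] hE].
have [->|h0] := eqVneq h 0; first by rewrite addr0 mulr0 subrr subr0 normc0 mulr0.
have nh : 0 < normc h by rewrite normc_gt0.
have hE' : z + h - z = h by ring.
have rw : res (z + h) by apply: ropen; rewrite hE'.
set w := z + h in rw *.
have [dw ew] := rkP n rw.
set fz := rk z n in dz ez fA HS *; set fw := rk w n in dw ew *.
have gB : sqb (fun k => fw k - fz k) (C * (normc h ^+ 2 * C)).
  apply: (loc _ (fun k => h * fz k) w) => //; first by rewrite hE'.
  - exact: jacobi_domain_sub.
  - move=> k; have -> : T (fun k => fw k - fz k) k = T fw k - T fz k by rewrite /tau; ring.
    by rewrite ew ez /w; ring.
  - exact: sqb_scale.
(* The resolvent identity on a finite window. The last term is the Lagrange boundary term, the first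
   is of second order in [h]. *)
have key N : (absz n < N)%N -> fw n - fz n - S * h =
    h * win (fun k => fz k * (fw k - fz k)) N + h * (win (fun k => fz k * fz k) N - S)
    - win (fun k => fz k * T fw k - fw k * T fz k) N.
  move=> nN.
  have -> : win (fun k => fz k * T fw k - fw k * T fz k) N =
     h * win (fun k => fz k * (fw k - fz k)) N + h * win (fun k => fz k * fz k) N + (fz n - fw n).
    rewrite -(win_delta (fun k => fz k - fw k) nN) -!winZ -!winD; apply: win_ext => k.
    by rewrite ew ez /delta /w; ring.
  ring.
have L := win_lagrange_clim0 dz dw.
have bound eta : 0 < eta -> normc (fw n - fz n - S * h) <= normc h ^+ 2 * (C + C * C) + eta.
  move=> eta0.
  have [|N1 H1] := HS (eta / 2 / normc h); first by rewrite !divr_gt0.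
  have [|N2 H2] := L (eta / 2); first by rewrite divr_gt0.
  pose N := maxn (absz n).+1 (maxn N1 N2).
  have nN : (absz n < N)%N by rewrite leq_maxl.
  have n1 : (N1 <= N)%N by rewrite /N !leq_max leqnn orbT.
  have n2 : (N2 <= N)%N by rewrite /N !leq_max leqnn !orbT.
  rewrite (key N nN); apply: (le_trans (ler_normcB _ _)).
  have k1 := H1 N n1; have k2 := H2 N n2.
  have k3 := win_prod N nh fA gB.
  have e1 : normc h * C + (normc h)^-1 * (C * (normc h ^+ 2 * C)) = normc h * (C + C * C).
    by field; rewrite gt_eqF.
  rewrite e1 in k3.
  have k4 : normc (h * win (fun k => fz k * (fw k - fz k)) N) <= normc h ^+ 2 * (C + C * C).
    by rewrite normcM expr2 -mulrA ler_pM2l.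
  have k5 : normc (h * (win (fun k => fz k * fz k) N - S)) <= eta / 2.
    by rewrite normcM mulrC -ler_pdivlMr.
  have := le_normcD (h * win (fun k => fz k * (fw k - fz k)) N) (h * (win (fun k => fz k * fz k) N - S)).
  lra.
have b0 : normc (fw n - fz n - S * h) <= normc h ^+ 2 * (C + C * C).
  by apply/ler_addgt0Pr => eta; exact: bound.
apply: (le_trans b0); rewrite expr2 mulrC mulrA ler_wpM2r ?(ltW nh) //.
apply: (@le_trans _ _ (E * normc h)).
  by rewrite mulrC [X in _ <= X]mulrC ler_wpM2l ?(ltW nh) // /E lerDl.
by rewrite mulrC -ler_pdivlMr // ltW.
Qed.

Lemma rk_real (x : R) n k : res x%:C -> complex.Im (rk x%:C n k) = 0.
Proof.
move=> rx; have [df e] := rkP n rx.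
have : rk x%:C n = cj (rk x%:C n).
  apply: (rkE rx); split; first exact: cj_domain.
  move=> j; rewrite cj_tau e /cj /delta; case: (rk x%:C n j) => p q.
  by case: eqP => _; apply/eqP; rewrite eq_complex /=; apply/andP; split; apply/eqP; ring.
move=> /(congr1 (fun f => complex.Im (f k))); rewrite /cj.
by case: (rk x%:C n k) => p q /=; lra.
Qed.

End Resolvent.

(** * The Weyl function off and near the real axis *)

Section WeylFunction.
Variable R : realType.
Variable J : jacobi R.
Implicit Types (z w : R[i]) (n k : int).
Local Notation a := (ja J).
Local Notation b := (jb J).
Local Notation W := (wronskian a).
Local Notation T := (tau a b).
Local Notation res := (resolvent_set (jacobi_operator J)).
Variables (phi theta u : R[i] -> int -> R[i]).
Hypothesis pd : purely_discrete (jacobi_operator J).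
Hypothesis hphi : real_entire_solution J phi.
Hypothesis dphi : forall z, nontrivial (phi z) /\ in_domain_near_ninfty J (phi z).
Hypothesis htheta : real_entire_solution J theta.
Hypothesis hW : forall z n, W (theta z) (phi z) n = 1.
Hypothesis hu : forall z, complex.Im z != 0 ->
  [/\ solution a b z (u z), nontrivial (u z) & in_domain_near_pinfty J (u z)].

Local Notation M := (weyl_M J theta phi u).
Definition weyl_sol z n := theta z n + M z * phi z n.

Lemma phi_ndom z : ndom J (phi z).
Proof. by apply: (solution_ndom (hphi.1 z)); have [] := dphi z. Qed.

Lemma phi_neq0 z n : complex.Im z != 0 -> phi z n != 0.
Proof. by move=> z0; apply: (left_neq0 z0 (hphi.1 z) (dphi z).1 (phi_ndom z)). Qed.

Lemma phi_growth z n : complex.Im z != 0 ->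
  `|complex.Im z| * normc (phi z n) <= a n * normc (phi z (n + 1)).
Proof. by move=> z0; apply: (left_growth z0 (hphi.1 z) (dphi z).1 (phi_ndom z)). Qed.

Lemma u_pdom z : complex.Im z != 0 -> pdom J (u z).
Proof. by move=> /hu[su _ du]; apply: (solution_pdom su). Qed.

(** Otherwise [phi z] would be proportional to [u z], hence in the domain at both ends: an
    eigenfunction for a non-real eigenvalue. *)
Lemma wronskian_phi_u z : complex.Im z != 0 -> W (phi z) (u z) 0 != 0.
Proof.
move=> z0; have [su nu _] := hu z0; apply/eqP => w0.
have [c hc] := proportional (hphi.1 z) su nu w0.
have ph : phi z = (fun n => c * u z n) by apply/funext => n; exact: hc.
have df : jacobi_domain J (phi z).
  by apply/jacobi_domainP; split; [rewrite ph; apply: pdom_scale; exact: u_pdom|exact: phi_ndom].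
by have := nonreal_eigen z0 df (hphi.1 z) 0; apply/eqP; exact: phi_neq0.
Qed.

Lemma weyl_sol_solution z : solution a b z (weyl_sol z).
Proof. exact: (solution_lin (M z) (htheta.1 z) (hphi.1 z)). Qed.

Lemma weyl_sol_wronskian z n : W (weyl_sol z) (phi z) n = 1.
Proof. by rewrite -(hW z n) /wronskian /weyl_sol; ring. Qed.

Lemma weyl_sol_pdom z : complex.Im z != 0 -> pdom J (weyl_sol z).
Proof.
move=> z0; have [su nu _] := hu z0.
have w0 : W (weyl_sol z) (u z) 0 = 0.
  have -> : W (weyl_sol z) (u z) 0 = W (theta z) (u z) 0 + M z * W (phi z) (u z) 0.
    by rewrite /wronskian /weyl_sol; ring.
  by rewrite /weyl_M divfK ?wronskian_phi_u // subrr.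
have [c hc] := proportional (weyl_sol_solution z) su nu w0.
have -> : weyl_sol z = (fun n => c * u z n) by apply/funext => n; exact: hc.
by apply: pdom_scale; exact: u_pdom.
Qed.

Lemma green_rsol z n : complex.Im z != 0 -> rsol J z n (green (phi z) (weyl_sol z) n).
Proof.
move=> z0; split; first exact: (green_domain n (phi_ndom z) (weyl_sol_pdom z0)).
exact: (green_eq n (hphi.1 z) (weyl_sol_solution z) (weyl_sol_wronskian z)).
Qed.

Lemma green_bound z n k : complex.Im z != 0 -> normc (green (phi z) (weyl_sol z) n k) <= `|complex.Im z|^-1.
Proof. by move=> z0; have [df e] := green_rsol n z0; exact: (resolvent_bound1 z0 df e). Qed.

Lemma phi_hol n z : hol (fun z => phi z n) z.
Proof. by have [] := hphi.2 n => /entire_hol. Qed.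

Lemma theta_hol n z : hol (fun z => theta z n) z.
Proof. by have [] := htheta.2 n => /entire_hol. Qed.

(* [- phi * (theta + M * phi)] is the diagonal of the Green function, which also
   makes sense at the real points of the resolvent set. *)
Definition weyl_ext n z := (- rk J z n n - theta z n * phi z n) / phi z n ^+ 2.

Lemma weyl_extE n z : complex.Im z != 0 -> weyl_ext n z = M z.
Proof.
move=> z0; rewrite /weyl_ext (rkE (nonreal_res pd z0) (green_rsol n z0)) /green lexx /weyl_sol.
by have := phi_neq0 n z0 => p0; field.
Qed.

Lemma weyl_ext_hol n z : res z -> phi z n != 0 -> hol (weyl_ext n) z.
Proof.
move=> rz p0; apply: hol_div.
- by rewrite expf_neq0.
- apply: holB; last by apply: holM; [exact: theta_hol|exact: phi_hol].
  by apply: holN; exact: rk_hol.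
- by apply: holX; exact: phi_hol.
Qed.

Lemma weyl_M_hol z : complex.Im z != 0 -> hol M z.
Proof.
move=> z0; apply: (@hol_ext _ (weyl_ext 0) M z `|complex.Im z|).
- by rewrite normr_gt0.
- move=> w wz; apply: weyl_extE; apply: contraTneq wz => w0.
  rewrite -leNgt; apply: le_trans (Im_le_normc _); rewrite raddfB /= w0 sub0r normrN //.
- by apply: weyl_ext_hol; [exact: nonreal_res|exact: phi_neq0].
Qed.

(** With [n] chosen such that [phi x0 n] is not 0, [weyl_ext n] is holomorphic in a punctured disc.
    The Green bound controls it by a multiple of [1 / |Im z|], [im_bound] improves this to
    [1 / |z - x0|], and [simple_pole] applies. *)
Lemma weyl_local (x0 : R) : exists (r c : R) (q : R[i] -> R[i]), [/\ 0 < r,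
  forall z, normc (z - x0%:C) < r -> hol q z &
  forall z, normc (z - x0%:C) < r -> complex.Im z != 0 -> M z = c%:C / (z - x0%:C) + q z].
Proof.
have [n pn] := (dphi x0%:C).1.
have [r1 r10 H1] := res_punctured pd x0%:C.
have [r2 r20 H2] := ccont_neq0 (hol_ccont (phi_hol n x0%:C)) pn.
have tp : hol (fun z => theta z n * phi z n) x0%:C by apply: holM; [exact: theta_hol|exact: phi_hol].
have [r3 r30 H3] := ccont_near (hol_ccont tp) ltr01.
pose r := Num.min (Num.min r1 r2) (Num.min r3 1).
have r0 : 0 < r by rewrite !lt_min r10 r20 r30 ltr01.
have rr1 : r <= r1 by rewrite !ge_min lexx.
have rr2 : r <= r2 by rewrite !ge_min lexx orbT.
have rr3 : r <= r3 by rewrite !ge_min lexx !orbT.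
have rr4 : r <= 1 by rewrite !ge_min lexx !orbT.
set k := weyl_ext n.
have hk z : normc (z - x0%:C) < r -> z != x0%:C -> hol k z.
  move=> zr zx; apply: weyl_ext_hol; first by apply: H1 => //; apply: lt_le_trans rr1.
  by have [] := H2 z (lt_le_trans zr rr2).
pose p2 := (normc (phi x0%:C n) / 2) ^+ 2.
have p20 : 0 < p2 by rewrite exprn_gt0 // divr_gt0 // normc_gt0.
pose C := (1 + (normc (theta x0%:C n * phi x0%:C n) + 1)) / p2.
have C0 : 0 <= C by rewrite divr_ge0 ?(ltW p20) // !addr_ge0 // normc_ge0.
have kIm z : normc (z - x0%:C) < r -> complex.Im z != 0 -> normc (k z) * `|complex.Im z| <= C.
  move=> zr z0; have im0 : 0 < `|complex.Im z| by rewrite normr_gt0.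
  have im1 : `|complex.Im z| <= 1.
    apply: le_trans (ltW (lt_le_trans zr rr4)); apply: le_trans (Im_le_normc _).
    by rewrite raddfB /= subr0.
  have [hp _] := H2 z (lt_le_trans zr rr2); have ht := H3 z (lt_le_trans zr rr3).
  have pz : p2 <= normc (phi z n ^+ 2).
    by rewrite normcX lerXn2r ?nnegrE ?normc_ge0 // divr_ge0 // normc_ge0.
  rewrite /k /weyl_ext normcM normcV mulrAC ler_pdivrMr ?(lt_le_trans p20 pz) //.
  apply: (@le_trans _ _ (C * p2)); last by rewrite ler_wpM2l.
  rewrite /C divfK ?gt_eqF //.
  rewrite (rkE (nonreal_res pd z0) (green_rsol n z0)).
  have gb := green_bound n n z0.
  set G := green _ _ _ _ in gb *.
  have gb1 : normc G * `|complex.Im z| <= 1.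
    by rewrite -ler_pdivlMr // div1r.
  have tz := ler_normc_tri (theta z n * phi z n) (theta x0%:C n * phi x0%:C n).
  have tz1 : normc (theta z n * phi z n) <= normc (theta x0%:C n * phi x0%:C n) + 1 by lra.
  have := ler_normcB (- G) (theta z n * phi z n); rewrite normcN => h.
  apply: (@le_trans _ _ ((normc G + normc (theta z n * phi z n)) * `|complex.Im z|)).
    by rewrite ler_wpM2r.
  rewrite mulrDl lerD //; apply: (@le_trans _ _ (normc (theta z n * phi z n) * 1)); last by rewrite mulr1.
  by rewrite ler_wpM2l ?normc_ge0.
have r2' : 0 < r / 2 by rewrite divr_gt0.
have kpole z : normc (z - x0%:C) < r / 2 -> z != x0%:C -> normc (k z) * normc (z - x0%:C) <= 10 * C.
  move=> zr zx; set d := normc (z - x0%:C) in zr *.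
  have d0 : 0 < d by rewrite normc_gt0 subr_eq0.
  have dz : d <= `|complex.Re z - x0| + `|complex.Im z|.
    by apply: (le_trans (normc_le_ReIm _)); rewrite !raddfB /= subr0.
  have [i2|i2] := leP (d / 2) `|complex.Im z|.
    have z0 : complex.Im z != 0 by rewrite -normr_gt0; lra.
    have := kIm z; rewrite -/d => /(_ _ z0) h.
    have {}h : normc (k z) * `|complex.Im z| <= C by apply: h; lra.
    have : normc (k z) * (d / 2) <= normc (k z) * `|complex.Im z| by rewrite ler_wpM2l ?normc_ge0.
    lra.
  (* Close to the real axis the square of half-side [d / 2] about [Re z] is used; it avoids [x0]
     because [|Re z - x0| > d / 2]. *)
  have sq w : square (complex.Re z)%:C (d / 2) w -> normc (w - x0%:C) < r /\ w != x0%:C.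
    move=> ws; split.
      have -> : w - x0%:C = (w - (complex.Re z)%:C) + ((complex.Re z)%:C - x0%:C) by ring.
      apply: (le_lt_trans (le_normcD _ _)).
      have := square_normc ws; have : normc ((complex.Re z)%:C - x0%:C) <= d.
        rewrite -rmorphB normc_real; have := Re_le_normc (z - x0%:C); rewrite raddfB /= -/d //.
      lra.
    apply/eqP => wx; move: ws; rewrite wx => -[/= /andP[w1 w2] _].
    have : `|complex.Re z - x0| <= d / 2 by rewrite ler_norml; apply/andP; split; lra.
    lra.
  have := @im_bound R k (complex.Re z) (d / 2) C _ C0 _ _ (complex.Im z) (ltW i2).
  have -> : complex.Re z +i* complex.Im z = z by case: (z).
  move=> H; have {}H : normc (k z) <= 5 * C / (d / 2).
    apply: H; first by rewrite divr_gt0.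
    - by move=> w /sq[? ?]; exact: hk.
    - by move=> w /sq[? _]; exact: kIm.
  by rewrite -ler_pdivlMr //; apply: (le_trans H); rewrite le_eqVlt; apply/orP; left; apply/eqP; field; rewrite gt_eqF.
have hk2 z : normc (z - x0%:C) < r / 2 -> z != x0%:C -> hol k z by move=> zr; apply: hk; lra.
have [c [q [hq kE]]] := simple_pole r2' hk2 kpole.
(* On the real axis the resolvent entries, [theta] and [phi] are real, hence so is [k]; the residue
   is the limit of [t * k (x0 + t)] as [t] tends to 0. *)
have c_real : complex.Im c = 0.
  have xx : normc (x0%:C - x0%:C : R[i]) < r / 2 by rewrite subrr normc0.
  have [D D0 HD] := ccont_near (hol_ccont (hq _ xx)) ltr01.
  apply/eqP; rewrite -normr_eq0 eq_le normr_ge0 andbT; apply/ler_addgt0Pr => e e0; rewrite add0r.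
  pose Q := normc (q x0%:C) + 1.
  have Q0 : 0 < Q by rewrite ltr_wpDl // normc_ge0.
  pose t := Num.min (Num.min D (r / 2)) (e / Q) / 2.
  have m0 : 0 < Num.min (Num.min D (r / 2)) (e / Q) by rewrite !lt_min D0 r2' divr_gt0.
  have t0 : 0 < t by rewrite divr_gt0.
  have : t < Num.min (Num.min D (r / 2)) (e / Q) by rewrite /t; lra.
  rewrite !lt_min => /andP[/andP[tD tr] te].
  have xE : (x0 + t)%:C - x0%:C = t%:C :> R[i] by rewrite rmorphD addrC addKr.
  have nt : normc (t%:C : R[i]) = t by rewrite normc_real gtr0_norm.
  have xr : normc ((x0 + t)%:C - x0%:C) < r / 2 by rewrite xE nt.
  have xD : normc ((x0 + t)%:C - x0%:C) < D by rewrite xE nt.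
  have xne : (x0 + t)%:C != x0%:C :> R[i] by rewrite -subr_eq0 xE -normc_eq0 nt gt_eqF.
  have kx := kE _ xr xne; rewrite xE in kx.
  have rx : res (x0 + t)%:C by apply: H1 => //; apply: (lt_le_trans xr); lra.
  have kreal : complex.Im (k (x0 + t)%:C) = 0.
    have i1 := rk_real n n rx; have [_ /(_ (x0 + t)) i2] := htheta.2 n; have [_ /(_ (x0 + t)) i3] := hphi.2 n.
    rewrite /k /weyl_ext.
    case: (rk J (x0 + t)%:C n n) (theta (x0 + t)%:C n) (phi (x0 + t)%:C n) i1 i2 i3 => ? ? [? ?] [p ?] /= -> -> ->.
    by rewrite !(mulr0, mul0r, addr0, subr0, oppr0, add0r).
  have cE : c = t%:C * k (x0 + t)%:C - t%:C * q (x0 + t)%:C.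
    rewrite kx; field; rewrite -normc_eq0 nt gt_eqF //.
  have -> : complex.Im c = - (t * complex.Im (q (x0 + t)%:C)).
    rewrite cE; case: (k (x0 + t)%:C) kreal (q (x0 + t)%:C) => k1 k2 /= -> [q1 q2] /=; ring.
  rewrite normrN normrM gtr0_norm //.
  have qb : `|complex.Im (q (x0 + t)%:C)| <= Q.
    apply: (le_trans (Im_le_normc _)); have := HD _ xD; have := ler_normc_tri (q (x0 + t)%:C) (q x0%:C).
    by rewrite /Q; lra.
  apply: (@le_trans _ _ (t * Q)); first by rewrite ler_pM2l.
  by rewrite -ler_pdivlMr // ltW.
exists (r / 2), (complex.Re c), q; split => // z zr z0.
rewrite -(weyl_extE n z0) -/k kE //; last first.
  by apply: contra_neq z0 => ->.
by congr (_ / _ + _); rewrite [LHS]complexE c_real mulr0 addr0.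
Qed.

End WeylFunction.

(** * Recovering residues from the spectral measure *)

Section Stieltjes.
Variable R : realType.
Implicit Types (x d e : R).
Local Notation mu := (@lebesgue_measure R).

Lemma poisson_integral (x0 d e : R) : 0 < d -> 0 < e ->
  \int[mu]_(x in `[x0 - d, x0 + d]) (e / ((x - x0) ^+ 2 + e ^+ 2)) = 2 * atan (d / e).
Proof.
move=> d0 e0; pose F (x : R) : R := atan ((x - x0) / e).
have dF (x : R) : is_derive x 1 F (e / ((x - x0) ^+ 2 + e ^+ 2)).
  have h : is_derive x (1 : R) (fun y : R => (y - x0) / e) e^-1.
    by apply: is_derive_eq; rewrite /GRing.scale /=; ring.
  have h2 := @is_derive1_comp _ (@atan R) (fun y : R => (y - x0) / e) x _ _ (is_derive1_atan _) h.
  apply: (@is_derive_eq _ _ _ F _ _ _ _ h2); rewrite /GRing.scale /=; field.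
  by rewrite (gt_eqF e0) andbT gt_eqF // ltr_wpDl ?sqr_ge0 // exprn_gt0.
have Fc (x : R) : {for x, continuous F}.
  by apply: differentiable_continuous; apply/derivable1_diffP; case: (dF x).
rewrite /Rintegral (@continuous_FTC2 _ _ F) /=.
- by rewrite /F [x0 + d]addrC addrK addrAC subrr add0r mulNr atanN; ring.
- lra.
- apply: within_for => x _; apply: cvgM; first exact: cvg_cst.
  apply: cvgV; first by rewrite gt_eqF // ltr_wpDl ?sqr_ge0 // exprn_gt0.
  apply: cvgD; last exact: cvg_cst.
  by rewrite expr2; apply: cvgM; apply: cvgB => //; exact: cvg_cst.
- split.
  + by move=> x _; case: (dF x).
  + by apply: cvg_at_right_filter; exact: Fc.
  + by apply: cvg_at_left_filter; exact: Fc.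
- by move=> x _; rewrite derive1E; case: (dF x).
Qed.

Definition vline e x : R[i] := x +i* e.

Lemma Im_pole (c x0 x e : R) :
  complex.Im (c%:C / (vline e x - x0%:C)) = - (c * (e / ((x - x0) ^+ 2 + e ^+ 2))).
Proof. by rewrite /vline /= subr0 mul0r addr0 mulrN mulrA. Qed.

(** The pole contributes a Poisson integral, tending to [- c * pi] as [e] tends to 0, whereas the
    regular part contributes at most a multiple of [d]. *)
Lemma stieltjes_integral (M q : R[i] -> R[i]) (c x0 d e D Q : R) : 0 < d -> 0 < e -> d + e < D ->
  (forall z, normc (z - x0%:C) < D -> hol q z /\ normc (q z) <= Q) ->
  (forall z, normc (z - x0%:C) < D -> complex.Im z != 0 -> M z = c%:C / (z - x0%:C) + q z) ->
  `|\int[mu]_(x in `]x0 - d, x0 + d[) complex.Im (M (x +i* e)) + c * (2 * atan (d / e))| <= 2 * d * Q.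
Proof.
move=> d0 e0 dD Hq HM.
have ImD (v w : R[i]) : complex.Im (v + w) = complex.Im v + complex.Im w by case: v w => ? ? [].
have close (x : R) : x0 - d <= x <= x0 + d -> normc (vline e x - x0%:C) < D.
  move=> /andP[h1 h2]; apply: le_lt_trans dD; apply: (le_trans (normc_le_ReIm _)) => /=.
  by rewrite subr0 (gtr0_norm e0) lerD2r ler_norml; apply/andP; split; lra.
have cq : pcont_on (fun x => q (vline e x)) (x0 - d) (x0 + d).
  move=> x hx eta eta0; have [E E0 HE] := hol_ccont (Hq _ (close x hx)).1 eta0.
  exists E => // h hE; have := HE h%:C; rewrite normc_real => /(_ hE).
  by congr (normc (q _ - _) <= _); rewrite /vline; apply/eqP; rewrite eq_complex /= addr0 !eqxx.
have iq := pcont_intIm cq.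
pose P (x : R) := e / ((x - x0) ^+ 2 + e ^+ 2).
have Pc (x : R) : {for x, continuous P}.
  apply: cvgM; first exact: cvg_cst.
  apply: cvgV; first by rewrite gt_eqF // ltr_wpDl ?sqr_ge0 // exprn_gt0.
  apply: cvgD; last exact: cvg_cst.
  by rewrite expr2; apply: cvgM; apply: cvgB => //; exact: cvg_cst.
have iP : mu.-integrable `[x0 - d, x0 + d] (EFin \o P) by apply: for_integrable => t _; exact: Pc.
have iP' : mu.-integrable `[x0 - d, x0 + d] (EFin \o (fun x => - c * P x)).
  by apply: for_integrable => t _; apply: cvgM; [exact: cvg_cst|exact: Pc].
pose G (x : R) := - c * P x + complex.Im (q (vline e x)).
have iG : mu.-integrable `[x0 - d, x0 + d] (EFin \o G).
  apply: for_integrable => t ht; apply: cvgD; last exact: pcont_Im (cq t ht).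
  by apply: cvgM; [exact: cvg_cst|exact: Pc].
have -> : \int[mu]_(x in `]x0 - d, x0 + d[) complex.Im (M (x +i* e)) = \int[mu]_(x in `[x0 - d, x0 + d]) G x.
  rewrite -Rintegral_itv_obnd_cbnd; last by apply: integrableS iG => //; apply: subset_itvr; rewrite bnd_simp.
  rewrite -Rintegral_itv_bndo_bndc; last by apply: integrableS iG => //; apply: subset_itv; rewrite bnd_simp.
  apply: eq_Rintegral => x; rewrite inE /= in_itv /= => /andP[h1 h2].
  rewrite -/(vline e x) HM; first by rewrite ImD Im_pole /G mulNr.
    by apply: close; rewrite !ltW.
  by rewrite /= gt_eqF.
rewrite /G RintegralD // RintegralZl // poisson_integral //.
rewrite mulNr addrAC addNr add0r.
have -> : 2 * d * Q = Q * ((x0 + d) - (x0 - d)) by ring.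
apply: Rint_norm => // [|x hx]; first lra.
by apply: le_trans (Im_le_normc _) _; exact: (Hq _ (close x hx)).2.
Qed.

(** Both inversion limits agree on an interval of half-length [d] around [x0], so the residues
    differ by a multiple of [d], which is arbitrarily small. *)
Lemma stieltjes_unique (M0 M1 q0 q1 : R[i] -> R[i]) (c0 c1 x0 r : R) (L : R -> R -> \bar R) : 0 < r ->
  (forall z, normc (z - x0%:C) < r -> hol q0 z) ->
  (forall z, normc (z - x0%:C) < r -> complex.Im z != 0 -> M0 z = c0%:C / (z - x0%:C) + q0 z) ->
  (forall z, normc (z - x0%:C) < r -> hol q1 z) ->
  (forall z, normc (z - x0%:C) < r -> complex.Im z != 0 -> M1 z = c1%:C / (z - x0%:C) + q1 z) ->
  (forall x1 x2 : R, x1 < x2 -> (pi^-1 * \int[mu]_(x in `]x1, x2[)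
     complex.Im (M0 ((x : R) +i* (e : R))))%:E @[e --> (0 : R)^'+] --> L x1 x2) ->
  (forall x1 x2 : R, x1 < x2 -> (pi^-1 * \int[mu]_(x in `]x1, x2[)
     complex.Im (M1 ((x : R) +i* (e : R))))%:E @[e --> (0 : R)^'+] --> L x1 x2) ->
  c0 = c1.
Proof.
move=> r0 hq0 HM0 hq1 HM1 L0 L1.
have xx : normc (x0%:C - x0%:C : R[i]) < r by rewrite subrr normc0.
have [D0 D00 HD0] := ccont_near (hol_ccont (hq0 _ xx)) ltr01.
have [D1 D10 HD1] := ccont_near (hol_ccont (hq1 _ xx)) ltr01.
pose D := Num.min r (Num.min D0 D1).
have Dpos : 0 < D by rewrite !lt_min r0 D00 D10.
have Dr : D <= r by rewrite !ge_min lexx.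
have DD0 : D <= D0 by rewrite !ge_min lexx !orbT.
have DD1 : D <= D1 by rewrite !ge_min lexx !orbT.
pose Q := normc (q0 x0%:C) + normc (q1 x0%:C) + 1.
have Q0 : 0 < Q by rewrite ltr_wpDl // addr_ge0 // normc_ge0.
have b0 z : normc (z - x0%:C) < D -> hol q0 z /\ normc (q0 z) <= Q.
  move=> zD; split; first by apply: hq0; exact: lt_le_trans Dr.
  have := HD0 z (lt_le_trans zD DD0); have := ler_normc_tri (q0 z) (q0 x0%:C).
  by have := normc_ge0 (q1 x0%:C); rewrite /Q; lra.
have b1 z : normc (z - x0%:C) < D -> hol q1 z /\ normc (q1 z) <= Q.
  move=> zD; split; first by apply: hq1; exact: lt_le_trans Dr.
  have := HD1 z (lt_le_trans zD DD1); have := ler_normc_tri (q1 z) (q1 x0%:C).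
  by have := normc_ge0 (q0 x0%:C); rewrite /Q; lra.
have e0 z : normc (z - x0%:C) < D -> complex.Im z != 0 -> M0 z = c0%:C / (z - x0%:C) + q0 z.
  by move=> zD; apply: HM0; exact: lt_le_trans Dr.
have e1 z : normc (z - x0%:C) < D -> complex.Im z != 0 -> M1 z = c1%:C / (z - x0%:C) + q1 z.
  by move=> zD; apply: HM1; exact: lt_le_trans Dr.
have pi0 := pi_gt0 R.
suff key d : 0 < d -> d < D / 2 -> `|c0 - c1| <= 4 * d * Q + 2 * pi * d.
  apply/eqP; rewrite -subr_eq0 -normr_eq0 eq_le normr_ge0 andbT; apply/ler_addgt0Pr => e epos; rewrite add0r.
  pose K := 4 * Q + 2 * pi.
  have K0 : 0 < K by rewrite /K; lra.
  pose d := Num.min (D / 2) (e / K) / 2.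
  have m0 : 0 < Num.min (D / 2) (e / K) by rewrite lt_min !divr_gt0.
  have dpos : 0 < d by rewrite divr_gt0.
  have : d < Num.min (D / 2) (e / K) by rewrite /d; lra.
  rewrite lt_min => /andP[d1 d2]; apply: (le_trans (key d dpos d1)).
  by move: d2; rewrite ltr_pdivlMr // /K; lra.
move=> dpos dD; pose I0 e := \int[mu]_(x in `]x0 - d, x0 + d[) complex.Im (M0 (x +i* e)).
pose I1 e := \int[mu]_(x in `]x0 - d, x0 + d[) complex.Im (M1 (x +i* e)).
have s0 e : 0 < e -> e < d -> `|I0 e + c0 * (2 * atan (d / e))| <= 2 * d * Q.
  by move=> ep ed; apply: (stieltjes_integral dpos ep _ b0 e0); lra.
have s1 e : 0 < e -> e < d -> `|I1 e + c1 * (2 * atan (d / e))| <= 2 * d * Q.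
  by move=> ep ed; apply: (stieltjes_integral dpos ep _ b1 e1); lra.
(* For [e < d] the arctangent is at least [pi / 4], so the factor of the residues stays away from
   0. *)
have at1 e : 0 < e -> e < d -> 1 <= 2 * atan (d / e) <= pi.
  move=> ep ed; have h1 := atan_ltpi2 (d / e); apply/andP; split; last lra.
  have : atan 1 <= atan (d / e) by apply: le_atan; rewrite ler_pdivlMr // mul1r ltW.
  rewrite atan1; have := pi_ge2 R; lra.
have xlt : x0 - d < x0 + d by lra.
have {}L0 := L0 _ _ xlt; have {}L1 := L1 _ _ xlt.
have I0b e : 0 < e -> e < d -> `|I0 e| <= `|c0| * pi + 2 * d * Q.
  move=> ep ed; have /andP[h1 h2] := at1 e ep ed; have h := s0 e ep ed.
  have -> : I0 e = (I0 e + c0 * (2 * atan (d / e))) - c0 * (2 * atan (d / e)) by ring.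
  apply: (le_trans (ler_normB _ _)); rewrite addrC lerD // normrM ler_wpM2l ?normr_ge0 //.
  by rewrite ger0_norm //; lra.
have nd : \forall e \near (0 : R)^'+, 0 < e < d.
  by near=> e; apply/andP; split.
case: (L (x0 - d) (x0 + d)) L0 L1 => [l| |] L0 L1.
- have /fine_cvgP[_ /cvgrPdist_le f0] := L0; have /fine_cvgP[_ /cvgrPdist_le f1] := L1.
  have [e [/andP[ep ed] [g0 g1]]] := filter_ex (filterI nd (filterI (f0 d dpos) (f1 d dpos))).
  move: g0 g1; rewrite /= -/(I0 e) -/(I1 e) => g0 g1.
  have /andP[h1 h2] := at1 e ep ed; have k0 := s0 e ep ed; have k1 := s1 e ep ed.
  have g : `|pi^-1 * I0 e - pi^-1 * I1 e| <= 2 * d.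
    have -> : pi^-1 * I0 e - pi^-1 * I1 e = (l - pi^-1 * I1 e) - (l - pi^-1 * I0 e) by ring.
    by apply: (le_trans (ler_normB _ _)); lra.
  have {}g : `|I0 e - I1 e| <= 2 * pi * d.
    have -> : I0 e - I1 e = pi * (pi^-1 * I0 e - pi^-1 * I1 e) by rewrite -mulrBr mulVKf // gt_eqF.
    have -> : 2 * pi * d = pi * (2 * d) by [ring].
    by rewrite normrM (gtr0_norm pi0) (ler_pM2l pi0).
  have : `|(c0 - c1) * (2 * atan (d / e))| <= 4 * d * Q + 2 * pi * d.
    have -> : (c0 - c1) * (2 * atan (d / e)) =
      (I0 e + c0 * (2 * atan (d / e))) - (I1 e + c1 * (2 * atan (d / e))) - (I0 e - I1 e) by ring.
    apply: (le_trans (ler_normB _ _)); apply: lerD => //.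
    by apply: (le_trans (ler_normB _ _)); lra.
  apply: le_trans; rewrite normrM [X in _ * X]ger0_norm; last lra.
  by rewrite ler_peMr.
(* The measures may a priori be infinite on the interval; the bound [I0b] on the integrals excludes
   it. *)
- exfalso; have /cvgeyPge f0 := L0.
  have [e [/andP[ep ed] g0]] := filter_ex (filterI nd (f0 (pi^-1 * (`|c0| * pi + 2 * d * Q) + 1))).
  move: g0; rewrite lee_fin -/(I0 e) => g0.
  have := I0b e ep ed; rewrite ler_norml => /andP[_ h].
  have : pi^-1 * I0 e <= pi^-1 * (`|c0| * pi + 2 * d * Q) by rewrite ler_pM2l ?invr_gt0.
  lra.
- exfalso; have /cvgeNyPle f0 := L0.
  have [e [/andP[ep ed] g0]] := filter_ex (filterI nd (f0 (- (pi^-1 * (`|c0| * pi + 2 * d * Q)) - 1))).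
  move: g0; rewrite lee_fin -/(I0 e) => g0.
  have := I0b e ep ed; rewrite ler_norml => /andP[h _].
  have : pi^-1 * - (`|c0| * pi + 2 * d * Q) <= pi^-1 * I0 e by rewrite ler_pM2l ?invr_gt0.
  lra.
Unshelve. all: by end_near. Qed.

End Stieltjes.

(** * Comparison of two operators *)

Section Growth.
Variable R : realType.
Implicit Types (f g : R[i] -> R[i]) (z : R[i]).

(** The order only controls large [z]. On the remaining disc the maximum principle takes the bound
    from the annulus between [r1] and [2 * r1]. *)
Lemma growth_order_exp_bounded f (s p : R) : (forall z, hol f z) -> s < p ->
  (growth_order f <= s%:E)%E -> exp_bounded p f.
Proof.
move=> hf sp fs.
have : (growth_order f < p%:E)%E by apply: le_lt_trans fs _; rewrite lte_fin.
rewrite /growth_order => /ereal_inf_lt[_ [t [t0 [r0 Hr]] <-]]; rewrite lte_fin => tp.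
have p0 : 0 <= p by lra.
pose r1 := Num.max r0 1.
have r10 : 0 < r1 by rewrite lt_max ltr01 orbT.
have r01 : r0 <= r1 by rewrite le_max lexx.
pose B := expR ((2 * r1) `^ t).
have small z : normc z <= r1 -> normc (f z) <= B.
  move=> zr; apply: (@max_annulus R f 0 r1 B r10); last by rewrite subr0.
    by move=> w _; exact: hf.
  move=> w; rewrite subr0 => w1 w2; apply: (le_trans (Hr w (le_trans r01 w1))).
  by rewrite ler_expR; apply: ge0_ler_powR; rewrite ?nnegrE ?normc_ge0 //; lra.
have one z : 1 <= (1 + normc z) `^ p by apply: powR_ge1 => //; rewrite lerDl normc_ge0.
have B0 : 0 <= (2 * r1) `^ t by exact: powR_ge0.
exists ((2 * r1) `^ t + 1) => [|z]; first lra.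
have [zr|zr] := leP (normc z) r1.
  apply: (le_trans (small z zr)); rewrite ler_expR.
  have h : (2 * r1) `^ t + 1 <= ((2 * r1) `^ t + 1) * (1 + normc z) `^ p.
    by rewrite ler_peMr //; lra.
  lra.
apply: (le_trans (Hr z _)); first by apply: le_trans r01 (ltW zr).
rewrite ler_expR.
have h1 : normc z `^ t <= (1 + normc z) `^ t.
  by apply: ge0_ler_powR; rewrite ?nnegrE ?addr_ge0 ?normc_ge0 // lerDr.
have h2 : (1 + normc z) `^ t <= (1 + normc z) `^ p.
  by apply: ler_powR; [rewrite lerDl normc_ge0|exact: ltW].
have h3 : (1 + normc z) `^ p <= ((2 * r1) `^ t + 1) * (1 + normc z) `^ p.
  by rewrite ler_peMl ?powR_ge0 //; lra.
lra.
Qed.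

Lemma exp_bounded_id (p : R) : 0 < p -> exp_bounded p (fun z : R[i] => z).
Proof.
move=> p0; exists p^-1 => [|z]; first by rewrite invr_ge0 ltW.
have n0 := normc_ge0 z; have x0 : 0 < 1 + normc z by lra.
apply: (@le_trans _ _ (1 + normc z)); first by rewrite lerDr.
rewrite -[leLHS]lnK // ler_expR.
have : ln ((1 + normc z) `^ p) <= (1 + normc z) `^ p.
  by apply: le_trans (ltW (ln_sublinear (powR_gt0 _ x0))).
by rewrite ln_powR mulrC -ler_pdivlMr // mulrC.
Qed.

(** The recurrence spreads the bound from two adjacent sites to all; [0 < p] lets the factor [z] be
    absorbed. *)
Lemma solution_exp_bounded (J : jacobi R) (phi : R[i] -> int -> R[i]) (s p : R) :
  real_entire_solution J phi -> 0 < p -> s < p -> growth_order_at_most s phi ->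
  forall n, exp_bounded p (fun z => phi z n).
Proof.
move=> [sol ent] p0 sp [n0 [g0 g1]].
have hp n z : hol (fun z => phi z n) z by have [] := ent n => /entire_hol.
have e0 := growth_order_exp_bounded (hp n0) sp g0.
have e1 := growth_order_exp_bounded (hp (n0 + 1)%R) sp g1.
have p0' := ltW p0.
have up (k : nat) : exp_bounded p (fun z => phi z (n0 + k%:Z)) /\ exp_bounded p (fun z => phi z (n0 + k%:Z + 1)).
  elim: k => [|k [h0 h1]]; first by rewrite addr0.
  have -> : n0 + k.+1%:Z = n0 + k%:Z + 1 by lia.
  split => //; set m := n0 + k%:Z + 1 in h1 *.
  have h0' : exp_bounded p (fun z => phi z (m - 1)) by rewrite /m addrK.
  apply: (exp_bounded_ext (f := fun z => ((z - (jb J m)%:C) * phi z m - (ja J (m - 1))%:C * phi z (m - 1)) * (ja J m)%:C^-1)).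
    by move=> z; rewrite (tau_solution_next (@ja_gt0 R J) (sol z)).
  apply: exp_boundedM => //; last exact: exp_bounded_cst.
  apply: exp_boundedB => //; apply: exp_boundedM => //; last exact: exp_bounded_cst.
  by apply: exp_boundedB => //; [exact: exp_bounded_id|exact: exp_bounded_cst].
have down (k : nat) : exp_bounded p (fun z => phi z (n0 - k%:Z)) /\ exp_bounded p (fun z => phi z (n0 - k%:Z + 1)).
  elim: k => [|k [h0 h1]]; first by rewrite subr0.
  have -> : n0 - k.+1%:Z = n0 - k%:Z - 1 by lia.
  rewrite subrK; split => //; set m := n0 - k%:Z in h0 h1 *.
  apply: (exp_bounded_ext (f := fun z => ((z - (jb J m)%:C) * phi z m - (ja J m)%:C * phi z (m + 1)) * (ja J (m - 1))%:C^-1)).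
    by move=> z; rewrite (tau_solution_prev (@ja_gt0 R J) (sol z)).
  apply: exp_boundedM => //; last exact: exp_bounded_cst.
  apply: exp_boundedB => //; apply: exp_boundedM => //; last exact: exp_bounded_cst.
  by apply: exp_boundedB => //; [exact: exp_bounded_id|exact: exp_bounded_cst].
move=> n; have [n0n|nn0] := leP n0 n.
  by have [h _] := up (absz (n - n0)); rewrite (_ : n = n0 + (absz (n - n0))%:Z) //; lia.
by have [h _] := down (absz (n - n0)); rewrite (_ : n = n0 - (absz (n - n0))%:Z) //; lia.
Qed.

(** Finitely many strict inequalities survive a small increase of [s], which makes room for a growth
    exponent between [s] and [s']. *)
Lemma dissecting_rays_margin (s : R) (m : nat) (t : nat -> R) : 0 < s ->
  dissecting_rays (pi / s) m t -> exists2 s' : R, s < s' & dissecting_rays (pi / s') m t.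
Proof.
move=> s0 [m0 tm H]; have pi0 := pi_gt0 R.
have [s' ss' Hs] : exists2 s' : R, s < s' & forall k, (k < m)%N -> t k.+1 - t k < pi / s'.
  suff : forall j, (j <= m)%N -> exists2 s' : R, s < s' & forall k, (k < j)%N -> t k.+1 - t k < pi / s'.
    by move=> /(_ m (leqnn m)).
  elim=> [|j ih] jm; first by exists (s + 1) => //; lra.
  have [s' ss' Hs] := ih (ltnW jm); have [g0 g1 _] := H j jm.
  pose g := t j.+1 - t j; have gpos : 0 < g by rewrite subr_gt0.
  have sg : s < pi / g by rewrite ltr_pdivlMr // mulrC -ltr_pdivlMr.
  pose s2 := (s + pi / g) / 2; have s2g : s2 < pi / g by rewrite /s2; lra.
  have ss2 : s < s2 by rewrite /s2; lra.
  exists (Num.min s' s2); first by rewrite lt_min ss' ss2.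
  have mpos : 0 < Num.min s' s2 by rewrite lt_min; apply/andP; split; lra.
  move=> k; rewrite ltnS leq_eqVlt => /orP[/eqP->|/Hs h].
    rewrite -/g ltr_pdivlMr // mulrC -ltr_pdivlMr //; apply: le_lt_trans s2g.
    by rewrite ge_min lexx orbT.
  apply: (lt_le_trans h); rewrite ler_pM2l // lef_pV2 ?posrE //; last lra.
  by rewrite ge_min lexx.
exists s' => //; split => // k km; have [h1 _ h3] := H k km; split => //; exact: Hs.
Qed.

(** At each real point the value of the extension given there is used. Extensions at different
    points agree on overlaps, since both are continuous and equal [K] off the real axis. *)
Lemma real_extension (K : R[i] -> R[i]) : (forall z, complex.Im z != 0 -> hol K z) ->
  (forall x : R, exists (r : R) (q : R[i] -> R[i]), [/\ 0 < r,
     forall z, normc (z - x%:C) < r -> hol q z &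
     forall z, normc (z - x%:C) < r -> complex.Im z != 0 -> K z = q z]) ->
  exists2 Kh, (forall z, hol Kh z) & forall z, complex.Im z != 0 -> Kh z = K z.
Proof.
move=> hK loc.
have loc' (x : R) : exists rq : R * (R[i] -> R[i]), [/\ 0 < rq.1,
     forall z, normc (z - x%:C) < rq.1 -> hol rq.2 z &
     forall z, normc (z - x%:C) < rq.1 -> complex.Im z != 0 -> K z = rq.2 z].
  by have [r [q H]] := loc x; exists (r, q).
have [rq Hrq] := choice loc'.
pose Kh z := if complex.Im z == 0 then (rq (complex.Re z)).2 z else K z.
have agree f g (y : R) (r : R) : 0 < r -> hol f y%:C -> hol g y%:C ->
    (forall z, normc (z - y%:C) < r -> complex.Im z != 0 -> f z = g z) -> f y%:C = g y%:C.
  move=> r0 hf hg fg; apply/eqP; rewrite -subr_eq0; apply/eqP; apply: normc_le_eps => e e0.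
  have e2 : 0 < e / 2 by rewrite divr_gt0.
  have [D1 D10 H1] := hol_ccont hf e2; have [D2 D20 H2] := hol_ccont hg e2.
  pose d := Num.min r (Num.min D1 D2) / 2.
  have m0 : 0 < Num.min r (Num.min D1 D2) by rewrite !lt_min r0 D10 D20.
  have d0 : 0 < d by rewrite divr_gt0.
  have : d < Num.min r (Num.min D1 D2) by rewrite /d; lra.
  rewrite !lt_min => /and3P[dr dD1 dD2].
  (* Approaching vertically keeps the comparison points off the real axis. *)
  pose h : R[i] := 0 +i* d.
  have nh : normc h = d by rewrite /normc /= expr0n add0r sqrtr_sqr gtr0_norm.
  have := H1 h; have := H2 h; rewrite nh => /(_ dD2) k2 /(_ dD1) k1.
  have fgh : f (y%:C + h) = g (y%:C + h).
    by apply: fg; rewrite ?[y%:C + _]addrC ?addrK ?nh //= addr0 gt_eqF.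
  have -> : f y%:C - g y%:C = (g (y%:C + h) - g y%:C) - (f (y%:C + h) - f y%:C) by rewrite fgh; ring.
  by apply: (le_trans (ler_normcB _ _)); lra.
exists Kh; last by move=> z /negbTE z0; rewrite /Kh z0.
move=> z; have [z0|z0] := eqVneq (complex.Im z) 0; last first.
  apply: (@hol_ext _ K Kh z `|complex.Im z|) (hK z z0); first by rewrite normr_gt0.
  move=> w wz; rewrite /Kh ifF //; apply: contraTF wz => /eqP w0.
  rewrite -leNgt; apply: le_trans (Im_le_normc _).
  by rewrite raddfB /= w0 sub0r normrN.
have zE : z = (complex.Re z)%:C by rewrite [LHS]complexE z0 mulr0 addr0.
set x := complex.Re z in zE; have [r0 hq qE] := Hrq x.
have zr : normc (z - x%:C) < (rq x).1 by rewrite zE subrr normc0.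
apply: (@hol_ext _ (rq x).2 Kh z (rq x).1 r0 _ (hq z zr)).
move=> w; rewrite zE => wr; rewrite /Kh; case: eqP => [w0|/eqP w0]; last by rewrite qE.
have wE : w = (complex.Re w)%:C by rewrite [LHS]complexE w0 mulr0 addr0.
set y := complex.Re w in wE *; rewrite wE in wr *.
have [ry0 hqy qyE] := Hrq y.
(* The disc of radius [d] about [y] lies in the discs belonging to both [x] and [y]. *)
pose d := Num.min (rq y).1 ((rq x).1 - normc (y%:C - x%:C)).
apply: (@agree _ _ y d); first by rewrite lt_min ry0 subr_gt0.
- exact: hq.
- by apply: hqy; rewrite subrr normc0.
move=> v; rewrite lt_min => /andP[v1 v2] vn; rewrite -qyE // qE //.
have -> : v - x%:C = (v - y%:C) + (y%:C - x%:C) by ring.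
by apply: (le_lt_trans (le_normcD _ _)); lra.
Qed.

End Growth.

(** * Comparison of solutions along non-real rays *)

Section Rays.
Variable R : realType.
Implicit Types (t r : R) (q : R[i] -> R[i]).

Lemma bounded_alongP t q : bounded_along t q <->
  exists C r0 : R, [/\ 0 <= C, 1 <= r0 & forall r, r0 <= r -> normc (q (ray t r)) <= C].
Proof.
split=> [[C [M [_ H]]]|[C [r0 [C0 _ H]]]].
  exists `|C|, (Num.max (M + 1) 1); split => //; first by rewrite le_max lexx orbT.
  move=> r; rewrite ge_max => /andP[Mr _]; apply: le_trans (H r _) (ler_norm _).
  by apply: lt_le_trans Mr; rewrite ltrDl.
by exists C; exists r0; split; [exact: num_real|move=> r /ltW /H].
Qed.

Lemma ray_Im t r : complex.Im (ray t r) = r * sin t.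
Proof. by []. Qed.

Lemma normc_ray t r : 0 <= r -> normc (ray t r) = r.
Proof. by move=> r0; rewrite /normc /= !exprMn -mulrDr cos2Dsin2 mulr1 sqrtr_sqr ger0_norm. Qed.

Lemma normc_ratio (x y : R[i]) (C : R) : y != 0 -> (normc (x / y) <= C) = (normc x <= C * normc y).
Proof. by move=> y0; rewrite normcM normcV ler_pdivrMr // normc_gt0. Qed.

Lemma ray_nonreal t r : sin t != 0 -> 1 <= r -> complex.Im (ray t r) != 0.
Proof. by move=> t0 r1; rewrite ray_Im mulf_neq0 // gt_eqF //; lra. Qed.

Section Growth.
Variables (J : jacobi R) (phi : R[i] -> int -> R[i]).
Hypothesis hphi : real_entire_solution J phi.
Hypothesis dphi : forall z, nontrivial (phi z) /\ in_domain_near_ninfty J (phi z).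
Local Notation a := (ja J).
Local Notation b := (jb J).

(** On the ray [|Im z|] is proportional to [r]: [phi_growth] bounds [r * phi n] by [phi (n + 1)],
    and the recurrence, with [phi (n - 1)] estimated likewise, gives the converse. *)
Lemma ray_growth t n : sin t != 0 -> exists2 A : R, 0 < A & forall r, 1 <= r ->
  normc (phi (ray t r) (n + 1)) <= A * r * normc (phi (ray t r) n) /\
  r * normc (phi (ray t r) n) <= A * normc (phi (ray t r) (n + 1)).
Proof.
move=> t0; pose S := `|sin t|; have S0 : 0 < S by rewrite normr_gt0.
have an : 0 < a n by exact: ja_gt0.
have an1 : 0 < a (n - 1) by exact: ja_gt0.
pose A1 := (1 + `|b n| + a (n - 1) ^+ 2 / S) / a n; pose A2 := a n / S.
have A10 : 0 < A1 by rewrite divr_gt0 // addr_gt0 ?divr_gt0 ?exprn_gt0 // ltr_pwDl.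
have A20 : 0 < A2 by rewrite divr_gt0.
exists (A1 + A2); first exact: addr_gt0.
move=> r r1; have z0 := ray_nonreal t0 r1; set z := ray t r in z0 *.
have r0 : 0 < r by lra.
have nIm : `|complex.Im z| = r * S by rewrite ray_Im normrM gtr0_norm.
have nz : normc z = r by rewrite normc_ray // ltW.
have g1 := phi_growth hphi dphi n z0; have := phi_growth hphi dphi (n - 1) z0.
rewrite subrK nIm => g2; rewrite nIm in g1.
have p0 := normc_ge0 (phi z n); have p1 := normc_ge0 (phi z (n + 1)).
split; last first.
  have : r * normc (phi z n) <= A2 * normc (phi z (n + 1)).
    rewrite /A2 mulrAC ler_pdivlMr //; apply: le_trans g1.
    by rewrite mulrAC.
  by have := mulr_ge0 (ltW A10) p1; rewrite mulrDl; lra.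
suff : normc (phi z (n + 1)) <= A1 * r * normc (phi z n).
  by have := mulr_ge0 (mulr_ge0 (ltW A20) (ltW r0)) p0; rewrite !mulrDl; lra.
rewrite (tau_solution_next (@ja_gt0 R J) (hphi.1 z)) normcM normcV normc_real (gtr0_norm an).
rewrite ler_pdivrMr //; apply: (le_trans (ler_normcB _ _)).
have h1 : normc ((z - (b n)%:C) * phi z n) <= (r + `|b n|) * normc (phi z n).
  by rewrite normcM ler_wpM2r //; apply: (le_trans (ler_normcB _ _)); rewrite nz normc_real.
have h2 : normc ((a (n - 1))%:C * phi z (n - 1)) <= a (n - 1) ^+ 2 / (r * S) * normc (phi z n).
  rewrite normcM normc_real (gtr0_norm an1) expr2 -!mulrA ler_pM2l //.
  by rewrite mulrCA [_^-1 * _]mulrC ler_pdivlMr ?mulr_gt0 // mulrC.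
apply: (le_trans (lerD h1 h2)); rewrite -mulrDl.
have -> : A1 * r * normc (phi z n) * a n = (r + `|b n| * r + a (n - 1) ^+ 2 / S * r) * normc (phi z n).
  by rewrite /A1; field; rewrite !gt_eqF.
rewrite ler_wpM2r //; apply: lerD.
  by rewrite lerD2l ler_peMr.
rewrite invfM [r^-1 * _]mulrC mulrA ler_wpM2l ?divr_ge0 ?sqr_ge0 ?(ltW S0) //.
by apply: (le_trans _ r1); rewrite invf_le1.
Qed.

End Growth.

Section Ratio.
Variables (JA JB : jacobi R) (phA phB : R[i] -> int -> R[i]).
Hypothesis hA : real_entire_solution JA phA.
Hypothesis hB : real_entire_solution JB phB.
Hypothesis dA : forall z, nontrivial (phA z) /\ in_domain_near_ninfty JA (phA z).
Hypothesis dB : forall z, nontrivial (phB z) /\ in_domain_near_ninfty JB (phB z).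
Local Notation ratio t n := (bounded_along t (fun z => phA z n / phB z n)).

(** Numerator and denominator both change by a factor comparable to [r], which cancels. *)
Lemma ratio_step t n : sin t != 0 -> ratio t n <-> ratio t (n + 1).
Proof.
move=> t0; have [A A0 HA] := ray_growth hA dA n t0; have [B B0 HB] := ray_growth hB dB n t0.
split=> /bounded_alongP[C [r0 [C0 r01 H]]]; apply/bounded_alongP.
  exists (A * B * C), r0; split; rewrite ?mulr_ge0 ?(ltW A0) ?(ltW B0) //.
  move=> r rr; have r1 := le_trans r01 rr; have z0 := ray_nonreal t0 r1.
  have rp : 0 < r by lra.
  have := H r rr; rewrite !normc_ratio ?(phi_neq0 hB dB) // => h.
  have [a1 _] := HA r r1; have [_ b2] := HB r r1.
  apply: (le_trans a1); apply: (@le_trans _ _ (A * r * (C * normc (phB (ray t r) n)))).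
    by rewrite ler_wpM2l // mulr_ge0 // ?(ltW A0) ?(ltW rp).
  have -> : A * r * (C * normc (phB (ray t r) n)) = A * C * (r * normc (phB (ray t r) n)) by ring.
  have -> : A * B * C * normc (phB (ray t r) (n + 1)) = A * C * (B * normc (phB (ray t r) (n + 1))) by ring.
  by rewrite ler_wpM2l // mulr_ge0 // ?(ltW A0) ?(ltW rp).
exists (A * B * C), r0; split; rewrite ?mulr_ge0 ?(ltW A0) ?(ltW B0) //.
move=> r rr; have r1 := le_trans r01 rr; have z0 := ray_nonreal t0 r1.
have rp : 0 < r by lra.
have := H r rr; rewrite !normc_ratio ?(phi_neq0 hB dB) // => h.
have [_ a2] := HA r r1; have [b1 _] := HB r r1.
rewrite -(ler_pM2l rp); apply: (le_trans a2).
apply: (@le_trans _ _ (A * (C * normc (phB (ray t r) (n + 1))))); first by rewrite ler_pM2l.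
have -> : r * (A * B * C * normc (phB (ray t r) n)) = A * (C * (B * r * normc (phB (ray t r) n))) by ring.
by rewrite ler_pM2l // ler_wpM2l.
Qed.

Lemma ratio_all t n k : sin t != 0 -> ratio t n -> ratio t k.
Proof.
move=> t0 rn.
have up (j : nat) : ratio t (n + j%:Z).
  elim: j => [|j ih]; first by rewrite addr0.
  by rewrite (_ : n + j.+1%:Z = n + j%:Z + 1); [exact: ((ratio_step _ t0).1 ih)|lia].
have down (j : nat) : ratio t (n - j%:Z).
  elim: j => [|j ih]; first by rewrite subr0.
  by apply: (ratio_step _ t0).2; rewrite (_ : n - j.+1%:Z + 1 = n - j%:Z) //; lia.
have [nk|kn] := leP n k.
  by rewrite (_ : k = n + (absz (k - n))%:Z) //; lia.
by rewrite (_ : k = n - (absz (k - n))%:Z) //; lia.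
Qed.

End Ratio.
End Rays.

(** * The entire function combining the solutions of the two operators *)

Section Comparison.
Variable R : realType.
Variables (J0 J1 : jacobi R) (phi0 phi1 theta0 theta1 u0 u1 : R[i] -> int -> R[i]).
Hypothesis hphi0 : real_entire_solution J0 phi0.
Hypothesis hphi1 : real_entire_solution J1 phi1.
Hypothesis dphi0 : forall z, nontrivial (phi0 z) /\ in_domain_near_ninfty J0 (phi0 z).
Hypothesis dphi1 : forall z, nontrivial (phi1 z) /\ in_domain_near_ninfty J1 (phi1 z).
Hypothesis htheta0 : real_entire_solution J0 theta0.
Hypothesis htheta1 : real_entire_solution J1 theta1.
Hypothesis hW0 : forall z n, wronskian (ja J0) (theta0 z) (phi0 z) n = 1.
Hypothesis hW1 : forall z n, wronskian (ja J1) (theta1 z) (phi1 z) n = 1.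
Hypothesis hu0 : forall z, complex.Im z != 0 ->
  [/\ solution (ja J0) (jb J0) z (u0 z), nontrivial (u0 z) & in_domain_near_pinfty J0 (u0 z)].
Hypothesis hu1 : forall z, complex.Im z != 0 ->
  [/\ solution (ja J1) (jb J1) z (u1 z), nontrivial (u1 z) & in_domain_near_pinfty J1 (u1 z)].
Local Notation M0 := (weyl_M J0 theta0 phi0 u0).
Local Notation M1 := (weyl_M J1 theta1 phi1 u1).
Local Notation psi0 := (weyl_sol J0 phi0 theta0 u0).
Local Notation psi1 := (weyl_sol J1 phi1 theta1 u1).
Variable K : R[i] -> R[i].
Hypothesis hK : forall z, hol K z.
Hypothesis KE : forall z, complex.Im z != 0 -> K z = M0 z - M1 z.
Implicit Types (z : R[i]) (m n : int).

(* Off the real axis this is [phi1 m * psi0 n - phi0 n * psi1 m], see [crossE]. *)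
Definition cross m n z :=
  phi1 z m * theta0 z n - phi0 z n * theta1 z m + phi1 z m * phi0 z n * K z.

Lemma cross_hol m n z : hol (cross m n) z.
Proof.
have h0 := phi_hol hphi0; have h1 := phi_hol hphi1.
have k0 := theta_hol htheta0; have k1 := theta_hol htheta1.
by apply: holD; [apply: holB; apply: holM|apply: holM; [apply: holM|]].
Qed.

Lemma crossE m n z : complex.Im z != 0 ->
  cross m n z = phi1 z m * psi0 z n - phi0 z n * psi1 z m.
Proof. by move=> z0; rewrite /cross KE // /weyl_sol; ring. Qed.

Lemma phi_psi_bound0 m n z : m <= n -> complex.Im z != 0 ->
  normc (phi0 z m * psi0 z n) <= `|complex.Im z|^-1.
Proof.
move=> mn z0; have := green_bound hphi0 dphi0 htheta0 hW0 hu0 n m z0.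
by rewrite /green mn normcN.
Qed.

(** For [n = m + 1] the indices are in the wrong order for a Green entry; the Wronskian exchanges
    them at the cost of [1 / ja J1 m]. *)
Lemma phi_psi_bound1 m n z : n = m \/ n = m + 1 -> complex.Im z != 0 ->
  normc (phi1 z n * psi1 z m) <= `|complex.Im z|^-1 + (ja J1 m)^-1.
Proof.
have am : 0 < ja J1 m by exact: ja_gt0.
have amC : (ja J1 m)%:C != 0 :> R[i] by rewrite -normc_eq0 normc_real normr_eq0 gt_eqF.
move=> mn z0; have H := green_bound hphi1 dphi1 htheta1 hW1 hu1.
case: mn => ->.
  have := H z m m z0; rewrite /green lexx normcN => /le_trans; apply.
  by rewrite lerDl invr_ge0 ltW.
have := weyl_sol_wronskian u1 hW1 z m; rewrite /wronskian => w.
have -> : phi1 z (m + 1) * psi1 z m = phi1 z m * psi1 z (m + 1) + (ja J1 m)%:C^-1.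
  by apply: (mulfI amC); rewrite [RHS]mulrDr (divff amC) -w; ring.
apply: (le_trans (le_normcD _ _)); apply: lerD.
  by have := H z (m + 1) m z0; rewrite /green lerDl ler01 normcN.
by rewrite normcV normc_real gtr0_norm.
Qed.

Lemma cross_exp_bounded (p : R) m n : 0 <= p -> n = m \/ n = m + 1 ->
  (forall n, exp_bounded p (fun z => phi0 z n)) -> (forall n, exp_bounded p (fun z => phi1 z n)) ->
  exp_bounded p (cross m n).
Proof.
move=> p0 mn e0 e1; have h0 := phi_hol hphi0; have h1 := phi_hol hphi1.
(* At ['i], as at any non-real point, neither [phi0] nor [phi1] vanishes, so the divisor does not
   vanish identically. *)
have i0 : complex.Im ('i%C : R[i]) != 0 by rewrite /= oner_eq0.
have eQ : exp_bounded p (fun z => phi0 z m * phi1 z n) by exact: exp_boundedM.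
have hQ z : hol (fun z => phi0 z m * phi1 z n) z by exact: holM.
apply: (@quotient_exp_bounded R (fun z => cross m n z * (phi0 z m * phi1 z n))
  (fun z => phi0 z m * phi1 z n) _ 'i%C) => //.
- by move=> z; apply: holM => //; exact: cross_hol.
- by move=> z; exact: cross_hol.
- by rewrite mulf_neq0 ?(phi_neq0 hphi0 dphi0) ?(phi_neq0 hphi1 dphi1).
pose c := 1 + (ja J1 m)^-1.
have c0 : 0 < (ja J1 m)^-1 by rewrite invr_gt0 ja_gt0.
(* A real-valued majorant collecting both products; [exp_bounded] only concerns the modulus, so [f]
   need not be holomorphic. *)
pose f z : R[i] := (normc (phi1 z m * phi1 z n) + c * normc (phi0 z m * phi0 z n))%:C.
have ef : exp_bounded p f.
  apply: (exp_bounded_le2 p0 (f := fun z => phi1 z m * phi1 z n) (g := fun z => c%:C * (phi0 z m * phi0 z n))).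
  - exact: exp_boundedM.
  - by apply: exp_boundedM => //; [exact: exp_bounded_cst|exact: exp_boundedM].
  move=> z; rewrite /f normc_real ger0_norm ?addr_ge0 ?normc_ge0 ?mulr_ge0 ?normc_ge0 //; last by rewrite /c; lra.
  by rewrite [normc (c%:C * _)]normcM normc_real gtr0_norm // /c; lra.
apply: (exp_bounded_im p0 _ ef); first by move=> z; apply: holM => //; exact: cross_hol.
move=> z z0; rewrite crossE //.
have -> : (phi1 z m * psi0 z n - phi0 z n * psi1 z m) * (phi0 z m * phi1 z n) =
  phi1 z m * phi1 z n * (phi0 z m * psi0 z n) - phi0 z m * phi0 z n * (phi1 z n * psi1 z m) by ring.
apply: (le_trans (ler_normcB _ _)).
have mn' : m <= n by case: mn => ->; rewrite ?lexx // lerDl.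
have b0 := phi_psi_bound0 mn' z0; have b1 := phi_psi_bound1 mn z0.
rewrite [normc (_ * _ * (phi0 z m * psi0 z n))]normcM [normc (_ * (phi1 z n * psi1 z m))]normcM.
set A := normc (phi1 z m * phi1 z n); set B := normc (phi0 z m * phi0 z n).
have A0 : 0 <= A by exact: normc_ge0.
have B0 : 0 <= B by exact: normc_ge0.
set y := `|complex.Im z|^-1 in b0 b1 *; have y0 : 0 <= y by rewrite invr_ge0.
rewrite /f -/A -/B normc_real ger0_norm; last by rewrite addr_ge0 // mulr_ge0 // /c; lra.
rewrite mulrDl; apply: lerD.
  by rewrite ler_wpM2l //; lra.
rewrite mulrAC mulrC ler_wpM2r //; apply: (le_trans b1); rewrite /c.
by have := mulr_ge0 (ltW c0) y0; rewrite mulrDl mul1r mulrDr mulr1; lra.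
Qed.

Lemma cross_ray t m n : sin t != 0 -> n = m \/ n = m + 1 ->
  bounded_along t (fun z => phi1 z m / phi0 z m) -> bounded_along t (fun z => phi0 z n / phi1 z n) ->
  bounded_along t (cross m n).
Proof.
move=> t0 mn /bounded_alongP[C [r0 [C0 r01 H]]] /bounded_alongP[D [r2 [D0 r21 H']]].
apply/bounded_alongP; pose S := `|sin t|; have S0 : 0 < S by rewrite normr_gt0.
exists (C * S^-1 + D * (S^-1 + (ja J1 m)^-1)), (Num.max r0 r2); split.
- by rewrite addr_ge0 // mulr_ge0 ?addr_ge0 ?invr_ge0 // ltW // ja_gt0.
- by rewrite le_max r01.
move=> r; rewrite ge_max => /andP[/[dup] rr0 /H h /H' h']; have r1 := le_trans r01 rr0.
have z0 := ray_nonreal t0 r1; set z := ray t r in z0 h h' *.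
have p0 := phi_neq0 hphi0 dphi0 m z0; have p1 := phi_neq0 hphi1 dphi1 n z0.
have -> : cross m n z = phi1 z m / phi0 z m * (phi0 z m * psi0 z n) - phi0 z n / phi1 z n * (phi1 z n * psi1 z m).
  by rewrite crossE //; field; rewrite p0 p1.
have mn' : m <= n by case: mn => ->; rewrite ?lexx // lerDl.
have Sle : `|complex.Im z|^-1 <= S^-1.
  rewrite lef_pV2 ?posrE ?normr_gt0 // ray_Im normrM ger0_norm; last lra.
  by rewrite ler_peMl // ltW.
have b0 := le_trans (phi_psi_bound0 mn' z0) Sle; have b1 := phi_psi_bound1 mn z0.
apply: (le_trans (ler_normcB _ _)); rewrite !normcM -!normcM; apply: lerD.
  by rewrite normcM; apply: ler_pM; rewrite ?normc_ge0.
by rewrite normcM; apply: ler_pM; rewrite ?normc_ge0 //; lra.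
Qed.

(* On the diagonal both products are Green functions, which vanish at infinity. *)
Lemma cross_diag t m : sin t != 0 ->
  bounded_along t (fun z => phi1 z m / phi0 z m) -> bounded_along t (fun z => phi0 z m / phi1 z m) ->
  (forall z, cross m m z = cross m m 0) -> forall z, cross m m z = 0.
Proof.
move=> t0 /bounded_alongP[C [r0 [C0 r01 H]]] /bounded_alongP[D [r2 [D0 r21 H']]] cst z'.
rewrite cst; apply: normc_le_eps => e e0.
pose S := `|sin t|; have S0 : 0 < S by rewrite normr_gt0.
pose r := Num.max (Num.max r0 r2) ((C + D) / (S * e)).
have rr0 : r0 <= r by rewrite !le_max lexx.
have rr2 : r2 <= r by rewrite !le_max lexx !orbT.
have rr3 : (C + D) / (S * e) <= r by rewrite !le_max lexx !orbT.
have r1 := le_trans r01 rr0; have rp : 0 < r by lra.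
have z0 := ray_nonreal t0 r1; rewrite -(cst (ray t r)).
have h := H r rr0; have h' := H' r rr2; set z := ray t r in z0 h h' *.
have p0 := phi_neq0 hphi0 dphi0 m z0; have p1 := phi_neq0 hphi1 dphi1 m z0.
have -> : cross m m z = phi1 z m / phi0 z m * (phi0 z m * psi0 z m) - phi0 z m / phi1 z m * (phi1 z m * psi1 z m).
  by rewrite crossE //; field; rewrite p0 p1.
have nIm : `|complex.Im z| = r * S by rewrite ray_Im normrM gtr0_norm.
have b0 := phi_psi_bound0 (lexx m) z0.
have b1 : normc (phi1 z m * psi1 z m) <= `|complex.Im z|^-1.
  by have := green_bound hphi1 dphi1 htheta1 hW1 hu1 m m z0; rewrite /green lexx normcN.
apply: (le_trans (ler_normcB _ _)).
apply: (@le_trans _ _ (C * `|complex.Im z|^-1 + D * `|complex.Im z|^-1)).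
  by apply: lerD; rewrite normcM; apply: ler_pM; rewrite ?normc_ge0.
rewrite -mulrDl nIm ler_pdivrMr ?mulr_gt0 //.
by move: rr3; rewrite ler_pdivrMr ?mulr_gt0 //; congr (_ <= _); ring.
Qed.

(** Multiply [phi1 z m] by the Wronskian of [psi0] and [phi0], which is 1, and replace
    [phi1 z m * psi0 z m] by [phi0 z m * psi1 z m]: then [phi0 z m] factors out and the cross term
    at [m + 1] remains. *)
Lemma proportional_of_cross m (kappa : R[i]) z : complex.Im z != 0 ->
  cross m m z = 0 -> cross m (m + 1) z = kappa ->
  phi1 z m = - ((ja J0 m)%:C * kappa) * phi0 z m /\ psi1 z m = - ((ja J0 m)%:C * kappa) * psi0 z m.
Proof.
move=> z0; rewrite !crossE // => c0 c1.
have p0 := phi_neq0 hphi0 dphi0 m z0.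
have := weyl_sol_wronskian u0 hW0 z m; rewrite /wronskian => w.
have e1 : phi1 z m = - ((ja J0 m)%:C * kappa) * phi0 z m.
  have c0' : phi0 z m * psi1 z m = phi1 z m * psi0 z m by apply/eqP; rewrite eq_sym -subr_eq0 c0.
  have -> : - ((ja J0 m)%:C * kappa) * phi0 z m =
     (ja J0 m)%:C * (phi0 z (m + 1) * (phi0 z m * psi1 z m) - phi0 z m * (phi1 z m * psi0 z (m + 1))).
    by rewrite -c1; ring.
  rewrite c0' -[LHS]mulr1 -w; ring.
split => //; apply: (mulfI p0); rewrite mulrCA.
have -> : phi0 z m * psi1 z m = phi1 z m * psi0 z m by apply/eqP; rewrite eq_sym -subr_eq0 c0.
by rewrite e1; ring.
Qed.

End Comparison.

(** * From proportional solutions to equal operators *)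

Section Conclusion.
Variable R : realType.
Implicit Types (J : jacobi R) (z : R[i]).

(** Along the imaginary axis [z] times either diagonal Green entry tends to -1. *)
Lemma green_scale_eq1 J0 J1 (G0 G1 : R[i] -> int -> R[i]) (D : R[i]) n :
  (forall z, complex.Im z != 0 -> rsol J0 z n (G0 z)) ->
  (forall z, complex.Im z != 0 -> rsol J1 z n (G1 z)) ->
  (forall z, complex.Im z != 0 -> G1 z n = D * G0 z n) -> D = 1.
Proof.
move=> H0 H1 e; apply/eqP; rewrite -subr_eq0; apply/eqP; apply: normc_le_eps => eps eps0.
pose A J := ja J n + ja J (n - 1) + `|jb J n|.
have A0 J : 0 < A J by rewrite ltr_pwDl // addr_gt0 // ja_gt0.
pose B := normc D * A J0 + A J1.
have B0 : 0 < B by rewrite ltr_wpDl // mulr_ge0 ?normc_ge0 // ltW.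
pose y := B / eps; have y0 : 0 < y by rewrite divr_gt0.
pose z : R[i] := 0 +i* y; have z0 : complex.Im z != 0 by rewrite gt_eqF.
have [d0 e0] := H0 z z0; have [d1 e1] := H1 z z0.
have zy : `|complex.Im z| = y by rewrite gtr0_norm.
have := green_asymptotic z0 d1 e1; have := green_asymptotic z0 d0 e0.
rewrite zy -/(A J0) -/(A J1) => h0 h1.
have -> : D - 1 = D * (z * G0 z n + 1) - (z * G1 z n + 1) by rewrite e //; ring.
apply: (le_trans (ler_normcB _ _)); rewrite normcM.
apply: (@le_trans _ _ (normc D * (A J0 / y) + A J1 / y)).
  by apply: lerD => //; rewrite ler_wpM2l ?normc_ge0.
rewrite mulrA -mulrDl -/B /y invfM invrK mulrA divff ?gt_eqF // mul1r //.
Qed.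

(** Each [d n] is 1 or -1, and a change of sign between neighbours would make their product
    negative. *)
Lemma sign_constant (c : int -> R) (d : int -> R[i]) : (forall n, 0 < c n) ->
  (forall n, d n * d n = 1) -> (forall n, d n * d (n + 1) = (c n)%:C) -> forall n k, d n * d k = 1.
Proof.
move=> c0 d1 dc.
have step n : d (n + 1) = d n.
  have /eqP : d (n + 1) ^+ 2 = d n ^+ 2 by rewrite !expr2 !d1.
  rewrite eqf_sqr => /orP[/eqP //|/eqP h].
  have := dc n; rewrite h mulrN d1 => /(congr1 (fun w => complex.Re w)) /= h1.
  by exfalso; have := c0 n; lra.
have all0 n : d n = d 0.
  have up (j : nat) : d j%:Z = d 0.
    by elim: j => // j ih; rewrite (_ : j.+1%:Z = j%:Z + 1) ?step //; lia.
  have down (j : nat) : d (- j%:Z) = d 0.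
    elim: j => [|j ih]; first by rewrite oppr0.
    by rewrite -step (_ : - j.+1%:Z + 1 = - j%:Z) //; lia.
  have [n0|n0] := leP 0 n; first by rewrite (_ : n = (absz n)%:Z) //; lia.
  by rewrite (_ : n = - (absz n)%:Z) //; lia.
by move=> n k; rewrite all0 (all0 k).
Qed.

(* By Lagrange's identity, [f = (T - z)^-1 g] is determined by [g] and the
   common Green functions: [f n] is the pairing of [g] with the [n]-th one. *)
Lemma green_inclusion J J' z : resolvent_set (jacobi_operator J') z ->
  (forall n, exists G, rsol J z n G /\ rsol J' z n G) ->
  jacobi_operator J `<=` jacobi_operator J'.
Proof.
move=> [C HC] HG [f h] /jacobi_operatorP[df hE].
have pairing (J2 : jacobi R) (f2 g G : int -> R[i]) n : jacobi_domain J2 f2 ->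
    (forall k, tau (ja J2) (jb J2) f2 k = z * f2 k + g k) -> rsol J2 z n G ->
    clim0 (fun N => win (fun k => G k * g k) N - f2 n).
  move=> d2 e2 [dG eG]; apply: clim0_eventually (absz n).+1 _ (win_lagrange_clim0 dG d2) => N nN.
  rewrite -(win_delta f2 nN) -mulN1r -winZ -winD; apply: win_ext => k.
  by rewrite e2 eG /delta; ring.
pose g n := h n - z * f n.
have fE k : tau (ja J) (jb J) f k = z * f k + g k by rewrite /g -hE; ring.
have [df1 df2 _ _] := df.
have gl2 : ell2 g.
  have /ell2P[A HA] := df1; have /ell2P[B HB] := df2.
  apply/ell2P; exists (2 * B + 2 * (normc (- z) ^+ 2 * A)).
  move=> N; have := sqb_add HB (sqb_scale (- z) HA) N.
  by congr (_ <= _); apply: win_ext => n; rewrite /g hE mulNr.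
have [f1 [/jacobi_operatorP[d1 e1] _ _]] := HC g gl2.
have ff1 : f = f1.
  apply/funext => n; have [G [rG rG']] := HG n.
  have l0 := pairing _ _ _ _ _ df fE rG.
  have l1 := pairing _ _ _ _ _ d1 (fun k => esym (e1 k)) rG'.
  apply/eqP; rewrite -subr_eq0; apply/eqP; apply: clim0_cst.
  apply: clim0_eventually 0%N _ (clim0D l1 (clim0Z (-1) l0)) => k _; ring.
apply/jacobi_operatorP; split; first by rewrite ff1.
by move=> n; rewrite ff1 -e1 -ff1 /g; ring.
Qed.

End Conclusion.

Theorem theorem5p2 (R : realType) (H0 H1 : jacobi R)
  (phi0 phi1 : R[i] -> int -> R[i])
  (rho0 rho1 : {measure set (measurableTypeR R) -> \bar R})
  (s : R) (m : nat) (t : nat -> R) (n : int) :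
  real_entire_solution H0 phi0 ->
  real_entire_solution H1 phi1 ->
  (forall z, nontrivial (phi0 z) /\ in_domain_near_ninfty H0 (phi0 z)) ->
  (forall z, nontrivial (phi1 z) /\ in_domain_near_ninfty H1 (phi1 z)) ->
  spectral_measure H0 phi0 rho0 ->
  spectral_measure H1 phi1 rho1 ->
  0 < s ->
  growth_order_at_most s phi0 ->
  growth_order_at_most s phi1 ->
  dissecting_rays (pi / s) m t ->
  (forall k, (k < m)%N -> asymp_along (t k) (phi0^~ n) (phi1^~ n)) ->
  purely_discrete (jacobi_operator H0) ->
  purely_discrete (jacobi_operator H1) ->
  (convergence_exponent (spectrum (jacobi_operator H0)) <= s%:E)%E ->
  (convergence_exponent (spectrum (jacobi_operator H1)) <= s%:E)%E ->
  (forall A : set (measurableTypeR R), measurable A -> rho0 A = rho1 A) ->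
  jacobi_operator H1 = jacobi_operator H0.
Proof.
move=> hphi0 hphi1 dphi0 dphi1 [theta0 [u0 [ht0 hW0 hu0 L0]]] [theta1 [u1 [ht1 hW1 hu1 L1]]].
move=> s0 g0 g1 rays asymp pd0 pd1 _ _ rho_eq.
pose K z := weyl_M H0 theta0 phi0 u0 z - weyl_M H1 theta1 phi1 u1 z.
have hK z : complex.Im z != 0 -> hol K z.
  move=> z0; apply: holB.
    exact: (weyl_M_hol pd0 hphi0 dphi0 ht0 hW0 hu0 z0).
  exact: (weyl_M_hol pd1 hphi1 dphi1 ht1 hW1 hu1 z0).
(* At a real point the two Weyl functions have the same residue by Stieltjes inversion, so the polar
   parts cancel in [K]. *)
have [x|Kh hKh KhE] := real_extension hK.
  have [r0 [c0 [q0 [r00 hq0 qE0]]]] := weyl_local pd0 hphi0 dphi0 ht0 hW0 hu0 x.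
  have [r1 [c1 [q1 [r10 hq1 qE1]]]] := weyl_local pd1 hphi1 dphi1 ht1 hW1 hu1 x.
  pose r := Num.min r0 r1; have rpos : 0 < r by rewrite lt_min r00 r10.
  have lt0 z : normc (z - x%:C) < r -> normc (z - x%:C) < r0 by rewrite lt_min => /andP[].
  have lt1 z : normc (z - x%:C) < r -> normc (z - x%:C) < r1 by rewrite lt_min => /andP[].
  have L1' x1 x2 : x1 < x2 -> (pi^-1 * \int[lebesgue_measure]_(x in `]x1, x2[)
      complex.Im (weyl_M H1 theta1 phi1 u1 ((x : R) +i* (e : R))))%:E @[e --> (0 : R)^'+] -->
      ((2^-1)%:E * (rho0 `]x1, x2[%classic + rho0 `[x1, x2]%classic))%E.
    by move=> x12; rewrite !rho_eq; [exact: L1|exact: measurable_itv|exact: measurable_itv].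
  have cc : c0 = c1.
    exact: (stieltjes_unique rpos (fun z zr => hq0 z (lt0 z zr)) (fun z zr => qE0 z (lt0 z zr))
      (fun z zr => hq1 z (lt1 z zr)) (fun z zr => qE1 z (lt1 z zr)) L0 L1').
  exists r, (fun z => q0 z - q1 z); split => //.
  - by move=> z zr; apply: holB; [exact: hq0 (lt0 _ zr)|exact: hq1 (lt1 _ zr)].
  - by move=> z zr z0; rewrite /K qE0 ?(lt0 _ zr) // qE1 ?(lt1 _ zr) // cc; ring.
have [s' ss' rays'] := dissecting_rays_margin s0 rays.
(* Above [s], so that the growth order yields [exp_bounded p]; below [s'], as the sectors
   require. *)
pose p := (s + s') / 2; have sp : s < p by rewrite /p; lra.
have ps' : p < s' by rewrite /p; lra.
have p0 : 0 < p by lra.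
have e0 := solution_exp_bounded hphi0 p0 sp g0.
have e1 := solution_exp_bounded hphi1 p0 sp g1.
have sin0 k : (k < m)%N -> sin (t k) != 0 by have [_ _ H] := rays => /H[].
have r01 k j : (k < m)%N -> bounded_along (t k) (fun z => phi0 z j / phi1 z j).
  by move=> km; apply: (ratio_all hphi0 hphi1 dphi0 dphi1 (n := n)) (sin0 k km) _; have [] := asymp k km.
have r10 k j : (k < m)%N -> bounded_along (t k) (fun z => phi1 z j / phi0 z j).
  by move=> km; apply: (ratio_all hphi1 hphi0 dphi1 dphi0 (n := n)) (sin0 k km) _; have [] := asymp k km.
pose F := cross phi0 phi1 theta0 theta1 Kh.
have Fcst j k : k = j \/ k = j + 1 -> forall z, F j k z = F j k 0.
  move=> jk; apply: (phragmen_lindelof _ _ (ltW p0) ps' rays').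
  - exact: (cross_hol hphi0 hphi1 ht0 ht1 hKh).
  - exact: (cross_exp_bounded hphi0 hphi1 dphi0 dphi1 ht0 ht1 hW0 hW1 hu0 hu1 hKh KhE (ltW p0) jk e0 e1).
  - move=> i im.
    exact: (cross_ray hphi0 hphi1 dphi0 dphi1 ht0 ht1 hW0 hW1 hu0 hu1 KhE (sin0 i im) jk (r10 i j im) (r01 i k im)).
have m0 : (0 < m)%N by case: rays.
have Fdiag j z : F j j z = 0.
  apply: (cross_diag hphi0 hphi1 dphi0 dphi1 ht0 ht1 hW0 hW1 hu0 hu1 KhE (sin0 0%N m0) (r10 _ j m0) (r01 _ j m0)).
  by apply: Fcst; left.
pose d j : R[i] := - ((ja H0 j)%:C * F j (j + 1) 0).
pose psi0 := weyl_sol H0 phi0 theta0 u0; pose psi1 := weyl_sol H1 phi1 theta1 u1.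
have prop z j : complex.Im z != 0 -> phi1 z j = d j * phi0 z j /\ psi1 z j = d j * psi0 z j.
  move=> z0; apply: (proportional_of_cross hphi0 dphi0 hW0 KhE z0 (Fdiag j z)).
  by apply: Fcst; right.
pose G0 z j := green (phi0 z) (psi0 z) j; pose G1 z j := green (phi1 z) (psi1 z) j.
have rG0 z j : complex.Im z != 0 -> rsol H0 z j (G0 z j) by exact: green_rsol.
have rG1 z j : complex.Im z != 0 -> rsol H1 z j (G1 z j) by exact: green_rsol.
have dd j : d j * d j = 1.
  apply: (green_scale_eq1 (n := j) (fun z => @rG0 z j) (fun z => @rG1 z j)) => z z0.
  by rewrite /G0 /G1 /green lexx; have [-> ->] := prop z j z0; ring.
(* Both Wronskians equal 1, and [psi1], [phi1] at [j] and [j + 1] carry the factor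
   [d j * d (j + 1)], which must compensate the ratio of the weights. *)
have dd1 j : d j * d (j + 1) = (ja H0 j / ja H1 j)%:C.
  have i0 : complex.Im ('i%C : R[i]) != 0 by rewrite /= oner_eq0.
  have := weyl_sol_wronskian u0 hW0 'i%C j; have := weyl_sol_wronskian u1 hW1 'i%C j.
  rewrite /wronskian -/psi0 -/psi1; have [-> ->] := prop _ j i0; have [-> ->] := prop _ (j + 1) i0.
  have aC (J : jacobi R) : (ja J j)%:C != 0 :> R[i].
    by rewrite -normc_eq0 normc_real normr_eq0 gt_eqF // ja_gt0.
  set w := psi0 'i%C j * phi0 'i%C (j + 1) - psi0 'i%C (j + 1) * phi0 'i%C j => w1 w0.
  apply: (mulIf (aC H1)); rewrite -rmorphM divfK; last by rewrite gt_eqF // ja_gt0.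
  have -> : d j * d (j + 1) * (ja H1 j)%:C = (ja H0 j)%:C * w * (d j * d (j + 1) * (ja H1 j)%:C) by rewrite w0 mul1r.
  rewrite -[RHS]mulr1 -w1 /w; ring.
have Gsame z j : complex.Im z != 0 -> G1 z j = G0 z j.
  move=> z0; have c0 k : 0 < ja H0 k / ja H1 k by rewrite divr_gt0 ?ja_gt0.
  have sg := sign_constant c0 dd dd1; apply/funext => k; rewrite /G0 /G1 /green.
  have [pk sk] := prop z k z0; have [pj sj] := prop z j z0.
  case: ifP => _; rewrite ?pk ?sk ?pj ?sj; congr (- _).
    by rewrite mulrACA sg mul1r.
  by rewrite mulrACA sg mul1r.
have i0 : complex.Im ('i%C : R[i]) != 0 by rewrite /= oner_eq0.
(* The resolvents at the single point ['i] already agree on every [delta], which yields both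
   inclusions of graphs. *)
apply/seteqP; split; apply: (green_inclusion (z := 'i%C)).
- exact: nonreal_res.
- by move=> j; exists (G0 'i%C j); split; [rewrite -Gsame //; exact: rG1|exact: rG0].
- exact: nonreal_res.
- by move=> j; exists (G0 'i%C j); split; [exact: rG0|rewrite -Gsame //; exact: rG1].
Qed.
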